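(* Consider a fluid queue with phase generator $T$ and nonzero fluid rates $\boldsymbol c$, as in the context. The matrix $\Gamma(x)$ of mean sojourn times in $[0,x]$ before the first return to the initial level $0$, starting from level $0$ in a phase with positive rate, is, for every $x\ge 0$, \[ \Gamma(x)=\mathcal{F}(K;x)\begin{bmatrix}C_+^{-1} & \Psi|C_-|^{-1}\end{bmatrix}, \] where $\mathcal{F}(K;x)=\int_0^xe^{Ku}du$ and $K=C_+^{-1}T_{++}+\Psi|C_-|^{-1}T_{-+}$.
   Context: Let $T$ be an irreducible generator on a finite set $\mathcal{S}$, and $\boldsymbol c=(c_s)_{s\in\mathcal{S}}$ with all $c_s\neq0$; let $\mathcal{S}_+=\{s:c_s>0\}$, $\mathcal{S}_-=\{s:c_s<0\}$, $C=\mathrm{diag}(c_s)$ with diagonal blocks $C_+$ (on $\mathcal{S}_+$) and $C_-$ (on $\mathcal{S}_-$), $|C_-|$ the entrywise absolute value, and $T_{++},T_{+-},T_{-+},T_{--}$ the corresponding blocks of $T$. The fluid queue is $X(t)=X(0)+\int_0^tc_{\varphi(u)}du$, where $\varphi$ is a Markov chain with generator $T$. Let $\tau=\inf\{t>0:X(t)=0\}$. $\Psi$ is the $\mathcal{S}_+\times\mathcal{S}_-$ matrix with $\Psi_{ss'}=P[\tau<\infty,\varphi(\tau)=s'\mid X(0)=0,\varphi(0)=s]$. $\Gamma(x)$ is the $\mathcal{S}_+\times\mathcal{S}$ matrix with $\Gamma(x)_{ss'}=E[\int_0^\tau\mathbf 1\{X(u)\in[0,x],\varphi(u)=s'\}du\mid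 X(0)=0,\varphi(0)=s]$, columns ordered $(\mathcal{S}_+,\mathcal{S}_-)$. *)

(* Defs.v *)
From HB Require Import structures.
From mathcomp Require Import all_boot all_order all_algebra.
From mathcomp Require Import all_classical all_reals all_analysis.
Set Implicit Arguments. Unset Strict Implicit. Unset Printing Implicit Defensive.
Import Order.TTheory GRing.Theory Num.Theory.
Import numFieldNormedType.Exports.
Local Open Scope classical_set_scope.
Local Open Scope ring_scope.

(* "Matrices" indexed by a finite type S are functions S -> S -> R; a block
   is selected by a predicate A on S (e.g. S_+ = [pred s | 0 < c s]). *)

Section MatrixDefs.
Variables (R : realType) (S : finType).

Fixpoint mpow (A : {pred S}) (M : S -> S -> R) (k : nat) : S -> S -> R :=
  match k with
  | 0 => fun i j => (i == j)%:R
  | k.+1 => fun i j => \sum_(l in A) mpow A M k i l * M l j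
  end.

Definition expm (A : {pred S}) (M : S -> S -> R) : S -> S -> R :=
  fun i j => limn (fun n => \sum_(k < n) mpow A M k i j / (k`!)%:R).

Definition generator (T : S -> S -> R) : Prop :=
  (forall i j, i != j -> 0 <= T i j) /\ (forall i, \sum_j T i j = 0).

Definition irreducible_generator (T : S -> S -> R) : Prop :=
  generator T /\ forall i j, connect (fun a b => 0 < T a b) i j.

Definition Splus (c : S -> R) : {pred S} := [pred s | 0 < c s].
Definition Sminus (c : S -> R) : {pred S} := [pred s | c s < 0].

End MatrixDefs.

Section FluidDefs.
Variables (R : realType) (S : finType) (d : measure_display) (Omega : measurableType d).

Definition cadlag_step_paths (phi : R -> Omega -> S) : Prop :=
  forall w,
    (forall t, 0 <= t -> exists2 e, 0 < e &
        forall u, t <= u -> u < t + e -> phi u w = phi t w) /\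
    (forall t, 0 < t -> exists2 e, 0 < e & exists s,
        forall u, t - e < u -> u < t -> phi u w = s).

Definition markov_chain_from (T : S -> S -> R) (s : S)
    (P : probability Omega R) (phi : R -> Omega -> S) : Prop :=
  (forall t x, 0 <= t -> measurable [set w | phi t w = x]) /\
  (forall (n : nat) (t : 'I_n.+1 -> R) (x : 'I_n.+1 -> S),
      t ord0 = 0 ->
      (forall k : 'I_n, t (widen_ord (leqnSn n) k) <= t (lift ord0 k)) ->
      P [set w | forall k, phi (t k) w = x k] =
      ((x ord0 == s)%:R *
       \prod_(k < n) expm [pred _ : S | true]
          (fun i j => (t (lift ord0 k) - t (widen_ord (leqnSn n) k)) * T i j)
          (x (widen_ord (leqnSn n) k)) (x (lift ord0 k)))%:E).

Definition fluid_level (c : S -> R) (phi : R -> Omega -> S) (w : Omega) (t : R) : R :=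
  \int[lebesgue_measure]_(u in `[0, t]) c (phi u w).

Definition return_time (c : S -> R) (phi : R -> Omega -> S) (w : Omega) : \bar R :=
  ereal_inf [set (t%:E)%E | t in [set t | 0 < t /\ fluid_level c phi w t = 0]].

Definition Psi_mat (c : S -> R) (P : S -> probability Omega R)
    (phi : R -> Omega -> S) (s s' : S) : R :=
  fine (P s [set w | (return_time c phi w < +oo)%E /\
                     phi (fine (return_time c phi w)) w = s']).

Definition Gamma_mat (c : S -> R) (P : S -> probability Omega R)
    (phi : R -> Omega -> S) (x : R) (s s' : S) : \bar R :=
  (\int[P s]_w
     lebesgue_measure [set u : R | (0 <= u)%R /\ (u%:E < return_time c phi w)%E /\
                               (0 <= fluid_level c phi w u <= x)%R /\ phi u w = s'])%E.

End FluidDefs.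

Section Formula.
Variables (R : realType) (S : finType).

Definition Kmat (T : S -> S -> R) (c : S -> R) (Psi : S -> S -> R) : S -> S -> R :=
  fun i j => T i j / c i + \sum_(k in Sminus c) Psi i k / `|c k| * T k j.

Definition Fint (c : S -> R) (K : S -> S -> R) (x : R) : S -> S -> R :=
  fun i j => \int[lebesgue_measure]_(u in `[0, x])
               expm (Splus c) (fun a b => u * K a b) i j.

Definition Gamma_formula (T : S -> S -> R) (c : S -> R) (Psi : S -> S -> R)
    (x : R) : S -> S -> R :=
  fun i j =>
    if 0 < c j then Fint c (Kmat T c Psi) x i j / c j
    else (\sum_(k in Splus c) Fint c (Kmat T c Psi) x i k * Psi k j) / `|c j|.

End Formula.

(* Main.v *)
(** Discount the queue at rate q > 0 and sample it with mesh 1/(n+1).  The Markov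
property gives a discrete Dynkin formula for the sampled walk killed when it returns
below 0, and as n grows it becomes, for smooth f,
  E[e^(-q tau) f(0, phi(tau))] - f(0, s) =
    E[int_0^tau e^(-q u) (c d/dy f + T f - q f)(X(u), phi(u)) du].
The passage to the limit needs that almost surely the phase does not jump while the
level is 0.

A bounded harmonic f, built from a solution of the discounted Riccati equation,
identifies that solution with the matrix Psi^q of discounted return probabilities.
The test functions f(y, j) = max(x - y, 0)^2/2 1{j = l} show that the discounted mean
sojourn times Gamma^q solve
  c_l Gamma_l' = 1{l = s} - Psi^q_(s l) + sum_j Gamma_j T_(j l) - q Gamma_l.
The right-hand side of the claim solves the same system with q = 0, because the Riccati
equation for Psi says [C_+^-1, Psi |C_-|^-1] T = K [I, - Psi].  Now let q tend to 0:
Gamma^q tends to Gamma by monotone convergence, and to the claimed matrix by a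
Gronwall estimate. *)

Require Import Defs.
From HB Require Import structures.
From mathcomp Require Import all_boot all_order all_algebra.
From mathcomp Require Import all_classical all_reals all_analysis.
From mathcomp Require Import measurable_realfun ring lra.
Set Implicit Arguments. Unset Strict Implicit. Unset Printing Implicit Defensive.
Import Order.TTheory GRing.Theory Num.Theory.
Import numFieldNormedType.Exports.
Local Open Scope classical_set_scope.
Local Open Scope ring_scope.

(** * Matrix exponentials *)

(** Only finite-dimensional distributions are given, so there is no strong Markov property at [tau];
    on a grid the elementary Markov property suffices. The discount makes the horizon effectively
    finite, lets one-step errors of order mesh^2 sum to order mesh, and forces uniqueness: without
    it the Riccati equation may have several substochastic solutions, and sojourn times could a
    priori be infinite.

    A path could come down to 0 and jump to a positive rate at that very instant, a touch that the
    sampled walk need not notice. That this has probability zero is itself obtained from the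
    discrete Dynkin formula, without killing: the walk spends a time O(e) within O(e) of level 0, so
    jumps there are rare. The mesh must tend to 0 before e does.

    The indicator of [0, x] is not an admissible test function, because the one-step error needs a
    quadratic Taylor remainder. Its second antiderivative in x has one, and two differentiations in
    x of the resulting identity bring the indicator back. *)

Section MatrixExponential.
Variables (R : realType) (S : finType).
Implicit Types (A : {pred S}) (M : S -> S -> R).

Lemma mpow_scale A M (u : R) k i j :
  mpow A (fun a b => u * M a b) k i j = u ^+ k * mpow A M k i j.
Proof.
elim: k i j => [|k IH] i j /=; first by rewrite expr0 mul1r.
by rewrite mulr_sumr; apply: eq_bigr => l _; rewrite IH exprSr; ring.
Qed.

Lemma mpow_bound A M (m : R) : (forall i j, `|M i j| <= m) ->
  forall k i j, `|mpow A M k i j| <= (#|S|%:R * m) ^+ k.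
Proof.
move=> Mm; elim=> [|k IH] i j /=.
  by rewrite expr0; case: (i == j); rewrite ?normr1 ?normr0.
have m0 : 0 <= m by apply: le_trans (Mm i i).
apply: (le_trans (ler_norm_sum _ _ _)).
apply: (@le_trans _ _ (\sum_(l in A) ((#|S|%:R * m) ^+ k * m))).
  by apply: ler_sum => l _; rewrite normrM ler_pM.
rewrite sumr_const exprS -[leLHS]mulr_natl [_ * m in leLHS]mulrC -[leRHS]mulrA.
by rewrite ler_wpM2r ?mulr_ge0 ?exprn_ge0 ?mulr_ge0// ler_nat max_card.
Qed.

(** Crude on purpose: it bounds the growth of the powers for every block [A] at once, which is
    enough for convergence. *)
Definition mnorm M : R := #|S|%:R * \sum_a \sum_b `|M a b|.

Lemma le_mnorm M a b : `|M a b| <= \sum_a \sum_b `|M a b|.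
Proof.
rewrite (bigD1 a)//= (bigD1 b)//= -addrA lerDl addr_ge0// ?sumr_ge0//.
by move=> *; rewrite sumr_ge0.
Qed.

Lemma mnorm_ge0 M : 0 <= mnorm M.
Proof. by rewrite mulr_ge0// sumr_ge0// => *; rewrite sumr_ge0. Qed.

(** Each entry of exp(uM) is a scalar power series in u with these coefficients, so termwise
    differentiation applies entry by entry. *)
Definition expm_coef A M i j : R^nat := fun k => mpow A M k i j / (k`!)%:R.

Lemma expm_coef_bound A M i j (u : R) k :
  `|expm_coef A M i j k * u ^+ k| <= exp_coeff (mnorm M * `|u|) k.
Proof.
rewrite /expm_coef /exp_coeff /= exprMn !normrM normrX.
rewrite normfV normr_nat [leRHS]mulrAC.
rewrite ler_wpM2r ?exprn_ge0// ler_wpM2r ?invr_ge0//.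
exact/mpow_bound/le_mnorm.
Qed.

Lemma is_cvg_expm_coef A M i j (u : R) : cvgn (pseries (expm_coef A M i j) u).
Proof.
apply: normed_cvg; apply: (@series_le_cvg _ _ (exp_coeff (mnorm M * `|u|))).
- by move=> n; exact: normr_ge0.
- by move=> n; rewrite exp_coeff_ge0// mulr_ge0// mnorm_ge0.
- exact: expm_coef_bound.
- exact: is_cvg_series_exp_coeff.
Qed.

Lemma expm_pseries A M (u : R) i j :
  expm A (fun a b => u * M a b) i j = limn (pseries (expm_coef A M i j) u).
Proof.
congr (limn _); apply/funext => n; rewrite /pseries /series/= big_mkord.
by apply: eq_bigr => k _; rewrite mpow_scale /expm_coef; ring.
Qed.

Lemma expm_bound A M (u : R) i j :
  `|expm A (fun a b => u * M a b) i j| <= expR (mnorm M * `|u|).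
Proof.
have C := @is_cvg_expm_coef A M i j u.
rewrite expm_pseries -lim_norm//.
apply: limr_le; first exact: is_cvg_norm.
near=> n; apply: (le_trans (ler_norm_sum _ _ _)).
apply: (@le_trans _ _ (series (exp_coeff (mnorm M * `|u|)) n)).
  by apply: ler_sum => k _; exact: expm_coef_bound.
rewrite /expR; apply: nondecreasing_cvgn_le; last exact: is_cvg_series_exp_coeff.
apply/nondecreasing_seqP => k; rewrite /series/= big_nat_recr//= lerDl.
by rewrite exp_coeff_ge0// mulr_ge0// mnorm_ge0.
Unshelve. all: by end_near. Qed.

(** (k+1) M^(k+1) / (k+1)! = (M^k / k!) M, with M on the right because [mpow] multiplies on the
    right. *)
Lemma pseries_diffs_expm_coef A M i j :
  pseries_diffs (expm_coef A M i j) =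
  fun k => \sum_(l in A) expm_coef A M i l k * M l j.
Proof.
apply/funext => k; rewrite /pseries_diffs /expm_coef /= factS natrM invfM.
rewrite [in LHS]mulr_suml mulr_sumr; apply: eq_bigr => l _.
have k0 : k.+1%:R != 0 :> R by rewrite pnatr_eq0.
rewrite (_ : k.+1%:R * _ = k.+1%:R * k.+1%:R^-1 * (mpow A M k i l / k`!%:R * M l j)); last by ring.
by rewrite mulfV// mul1r.
Qed.

Lemma cvg_pseries_sum_expm_coef A M i (g : S -> R) (u : R) :
  pseries (fun k => \sum_(l in A) expm_coef A M i l k * g l) u @ \oo -->
  \sum_(l in A) limn (pseries (expm_coef A M i l) u) * g l.
Proof.
rewrite (_ : pseries _ _ = fun n => \sum_(l in A) pseries (expm_coef A M i l) u n * g l).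
  apply: cvg_big => [x|l _]; first exact: add_continuous.
  by apply: cvgMl; exact: is_cvg_expm_coef.
apply/funext => n; rewrite /pseries /series/=.
rewrite (eq_bigr (fun k => \sum_(l in A) expm_coef A M i l k * u ^+ k * g l)).
  by rewrite exchange_big/=; apply: eq_bigr => l _; rewrite mulr_suml.
by move=> k _; rewrite mulr_suml; apply: eq_bigr => l _; ring.
Qed.

Lemma is_derive_expm A M i j (u : R) :
  is_derive u 1 (fun v : R => expm A (fun a b => v * M a b) i j)
    (\sum_(l in A) expm A (fun a b => u * M a b) i l * M l j).
Proof.
rewrite (_ : (fun v => _) = fun v : R => limn (pseries (expm_coef A M i j) v)); last first.
  by apply/funext => v; rewrite expm_pseries.
rewrite (_ : \sum_(l in A) _ = limn (pseries (pseries_diffs (expm_coef A M i j)) u)).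
  apply: (@pseries_snd_diffs _ _ (`|u| + 1)).
  - exact: is_cvg_expm_coef.
  - by rewrite pseries_diffs_expm_coef; apply/cvg_ex; eexists; apply: cvg_pseries_sum_expm_coef.
  - rewrite pseries_diffs_expm_coef.
    (* The second formal derivative is the series of exp(uM) M^2. *)
    rewrite (_ : pseries_diffs _ =
       fun k => \sum_(l in A) expm_coef A M i l k * (\sum_(p in A) M l p * M p j)).
      by apply/cvg_ex; eexists; apply: cvg_pseries_sum_expm_coef.
    apply/funext => k; rewrite /pseries_diffs mulr_sumr.
    rewrite (eq_bigr (fun p => pseries_diffs (expm_coef A M i p) k * M p j)); last first.
      by move=> p _; rewrite /pseries_diffs mulrA.
    under eq_bigr do rewrite pseries_diffs_expm_coef mulr_suml.
    rewrite exchange_big/=; apply: eq_bigr => p _; rewrite mulr_sumr.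
    by apply: eq_bigr => l _; ring.
  - by rewrite [ltRHS]ger0_norm ?addr_ge0// ltrDl.
rewrite pseries_diffs_expm_coef; apply/esym/cvg_lim => //.
under eq_bigr do rewrite expm_pseries.
exact: cvg_pseries_sum_expm_coef.
Qed.

Lemma expm0 A M i j : expm A (fun a b => 0 * M a b) i j = (i == j)%:R.
Proof.
rewrite /expm; apply: lim_near_cst => //; near=> n.
rewrite -[n]prednK; last by near: n; exact: nbhs_infty_gt.
rewrite big_ord_recl big1 ?addr0 => [|k _]; first exact: divr1.
by rewrite mpow_scale exprS !mul0r.
Unshelve. all: by end_near. Qed.

(** By induction the entries of M^k are at most m^k, since column sums are at most m. Unlike
    [expm_bound] this has the sharp rate m, which later cancels a factor exp(-mu) exactly. *)
Lemma expm_ge0_bound A M (m u : R) : 0 <= u ->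
  (forall i j, 0 <= M i j) -> (forall j, j \in A -> \sum_(l in A) M l j <= m) ->
  forall i j, j \in A -> 0 <= expm A (fun a b => u * M a b) i j <= expR (m * u).
Proof.
move=> u0 M0 Mm i j jA.
have m0 : 0 <= m by rewrite (le_trans _ (Mm _ jA))// sumr_ge0.
have pw0 k l : 0 <= mpow A M k i l.
  elim: k l => [|k IH] l /=; first by rewrite ler0n.
  by rewrite sumr_ge0// => ? _; rewrite mulr_ge0.
have pwm k l : l \in A -> mpow A M k i l <= m ^+ k.
  elim: k l => [|k IH] l lA /=; first by rewrite expr0 lern1 leq_b1.
  apply: (@le_trans _ _ (\sum_(p in A) m ^+ k * M p l)).
    by apply: ler_sum => p pA; rewrite ler_wpM2r// IH.
  by rewrite -mulr_sumr exprSr ler_wpM2l ?exprn_ge0// Mm.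
have C := @is_cvg_expm_coef A M i j u.
rewrite expm_pseries; apply/andP; split.
  apply: limr_ge => //; near=> n.
  apply: sumr_ge0 => k _; rewrite /expm_coef.
  by rewrite mulr_ge0 ?exprn_ge0// divr_ge0.
apply: limr_le => //; near=> n.
apply: (@le_trans _ _ (series (exp_coeff (m * u)) n)).
  apply: ler_sum => k _; rewrite /expm_coef /exp_coeff/= exprMn mulrAC.
  by rewrite ler_wpM2r ?invr_ge0// ler_wpM2r ?exprn_ge0// pwm.
rewrite /expR; apply: nondecreasing_cvgn_le; last exact: is_cvg_series_exp_coeff.
apply/nondecreasing_seqP => k; rewrite /series/= big_nat_recr//= lerDl.
by rewrite exp_coeff_ge0// mulr_ge0.
Unshelve. all: by end_near. Qed.

End MatrixExponential.

(** * Derivatives and Gronwall estimates *)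

Section RealAnalysis.
Variable R : realType.
Implicit Types (f g : R -> R) (x a b : R).

Lemma drv_cst x a : is_derive x (1 : R) (fun _ : R => a) 0.
Proof. exact: is_derive_cst. Qed.

Lemma drv_id x : is_derive x (1 : R) (fun y : R => y) 1.
Proof. exact: is_derive_id. Qed.

Lemma drvD f g x a b : is_derive x (1 : R) f a -> is_derive x (1 : R) g b ->
  is_derive x (1 : R) (fun y => f y + g y) (a + b).
Proof. exact: is_deriveD. Qed.

Lemma drvN f x a : is_derive x (1 : R) f a -> is_derive x (1 : R) (fun y => - f y) (- a).
Proof. exact: is_deriveN. Qed.

Lemma drvB f g x a b : is_derive x (1 : R) f a -> is_derive x (1 : R) g b ->
  is_derive x (1 : R) (fun y => f y - g y) (a - b).
Proof. exact: is_deriveB. Qed.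

Lemma drvM f g x a b : is_derive x (1 : R) f a -> is_derive x (1 : R) g b ->
  is_derive x (1 : R) (fun y => f y * g y) (f x * b + g x * a).
Proof. exact: is_deriveM. Qed.

Lemma drvZ f x a c : is_derive x (1 : R) f a -> is_derive x (1 : R) (fun y => c * f y) (c * a).
Proof. by move=> fa; apply: is_derive_eq (drvM (drv_cst x c) fa) _; rewrite mulr0 addr0. Qed.

Lemma drv_sum (I : Type) (r : seq I) (Q : pred I) (f : I -> R -> R) (df : I -> R) x :
  (forall i, Q i -> is_derive x (1 : R) (f i) (df i)) ->
  is_derive x (1 : R) (fun y => \sum_(i <- r | Q i) f i y) (\sum_(i <- r | Q i) df i).
Proof.
move=> fdf; rewrite (_ : (fun y => _) = \sum_(i <- r | Q i) f i); last first.
  by apply/funext => y; rewrite fct_sumE.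
by elim/big_ind2 : _ => // [|] *; [exact: is_derive_cst|exact: is_deriveD].
Qed.

(** By the mean value theorem the remainder is t (g z - g y) for an intermediate z; no second
    derivative is involved. *)
Lemma taylor1_lip (f g : R -> R) (L y t : R) :
  (forall z, is_derive z (1 : R) f (g z)) ->
  (forall z, (y <= z <= y + t) || (y + t <= z <= y) -> `|g z - g y| <= L * `|t|) ->
  `|f (y + t) - f y - t * g y| <= L * t ^+ 2.
Proof.
move=> fg gL.
have cf (a b : R) : {within `[a, b], continuous f}.
  apply: continuous_subspaceT => z.
  by apply: differentiable_continuous; apply/derivable1_diffP; exact: (@ex_derive _ _ _ _ _ _ _ (fg z)).
have [t0|t0|->] := ltgtP t 0; last first.
- by rewrite addr0 mul0r subr0 subrr normr0 expr0n mulr0.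
- have yt : y < y + t by rewrite ltrDl.
  have [z] := MVT yt (fun z _ => fg z) (cf _ _).
  rewrite in_itv/= => /andP[yz zt]; rewrite (addrC y t) addrK => e.
  rewrite (_ : _ - _ - _ = (g z - g y) * t); last by lra.
  rewrite normrM -[t ^+ 2](real_normK (num_real t)) expr2 mulrA ler_wpM2r// gL//.
  by rewrite (ltW yz) (ltW zt).
- have yt : y + t < y by rewrite gtrDl.
  have [z] := MVT yt (fun z _ => fg z) (cf _ _).
  rewrite in_itv/= => /andP[yz zt] e.
  rewrite (_ : _ - _ - _ = (g z - g y) * t); last by lra.
  rewrite normrM -[t ^+ 2](real_normK (num_real t)) expr2 mulrA ler_wpM2r// gL//.
  by rewrite (ltW yz) (ltW zt) orbT.
Qed.

(** Derivatives are asked for in the open interval only, because the fluxes below are differentiated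
    only at positive levels. *)
Lemma gronwall (e de : R -> R) (b M D : R) : 0 <= b -> 0 <= M -> 0 <= D ->
  {within `[0, b], continuous e} ->
  (forall x, x \in `]0, b[ -> is_derive x (1 : R) e (de x)) ->
  (forall x, x \in `]0, b[ -> de x <= M * e x + D) ->
  e 0 <= 0 -> e b <= D * b * expR (M * b).
Proof.
move=> b0 M0 D0 ce dee leM e0.
have [b00|bN0] := eqVneq b 0.
  by move: e0; rewrite b00 mulr0 mul0r.
have bp : 0 < b by rewrite lt_neqAle eq_sym bN0.
(* Its derivative is at most D (exp(-Mx) - 1), hence nonpositive. *)
pose g := (fun x : R => e x * expR (- M * x) - D * x).
have dg x : x \in `]0, b[ ->
    is_derive x (1 : R) g ((de x - M * e x) * expR (- M * x) - D).
  move=> xb; have := dee _ xb => ?.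
  apply: is_derive_eq; rewrite /GRing.scale/=; ring.
have cg : {within `[0, b], continuous g}.
  have cl (a : R) : {within `[0, b], continuous (fun y : R => a * y)}.
    by apply: continuous_subspaceT; exact: mulrl_continuous.
  move=> x; apply: cvgB; last exact: cl.
  apply: cvgM; first exact: ce.
  apply: continuous_subspaceT => y.
  by apply: continuous_comp; [exact: mulrl_continuous|exact: continuous_expR].
have [z zb] := MVT bp dg cg.
rewrite subr0 /g !mulr0 expR0 mulr1 subr0 => E.
have : (de z - M * e z) * expR (- M * z) - D <= 0.
  have h := leM _ zb.
  have : expR (- M * z) <= 1.
    rewrite -[leRHS]expR0 ler_expR mulNr oppr_le0 mulr_ge0//.
    by move: zb; rewrite in_itv/= => /andP[/ltW].
  have : 0 <= expR (- M * z) by exact: expR_ge0.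
  nra.
move=> h.
have : e b * expR (- M * b) <= D * b by nra.
move=> h2.
have -> : e b = e b * expR (- M * b) * expR (M * b).
  by rewrite -mulrA -expRD mulNr addNr expR0 mulr1.
by rewrite ler_wpM2r// expR_ge0.
Qed.

(** The scalar estimate is applied to the sum of squares, which is differentiable where the sum of
    absolute values is not. *)
Lemma system_gronwall (S : finType) (w dw : S -> R -> R) (b M D : R) :
  0 <= b -> 0 <= M -> 0 <= D ->
  (forall l, {within `[0, b], continuous (w l)}) ->
  (forall l x, x \in `]0, b[ -> is_derive x (1 : R) (w l) (dw l x)) ->
  (forall l x, x \in `]0, b[ -> `|dw l x| <= M * (\sum_j `|w j x|) + D) ->
  (forall l, w l 0 = 0) ->
  forall l, (w l b) ^+ 2 <=
    #|S|%:R * D ^+ 2 * b * expR ((1 + 2 * M * #|S|%:R) * b).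
Proof.
move=> b0 M0 D0 cw dww leM w0 l.
apply: (@le_trans _ _ (\sum_l w l b ^+ 2)).
  by rewrite (bigD1 l)//= lerDl sumr_ge0// => j _; rewrite sqr_ge0.
apply: (@gronwall (fun x => \sum_l w l x ^+ 2) (fun x => \sum_l (w l x * dw l x *+ 2)));
  rewrite ?addr_ge0 ?mulr_ge0 ?sqr_ge0//.
- move=> x; apply: cvg_big => [y|j _]; first exact: add_continuous.
  by apply: cvgM; exact: cw.
- move=> x xb; have ? j := dww j x xb.
  apply: drv_sum => j _; apply: is_derive_eq (drvM (dww j x xb) (dww j x xb)) _.
  by rewrite mulr2n.
- move=> x xb.
  (* From 2ab <= a^2 + b^2, applied to each product. Summed over j this yields the rate 1 + 2 M #|S|
     and the defect #|S| D^2. *)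
  have h j : w j x * dw j x *+ 2 <= w j x ^+ 2 + D ^+ 2 + M * \sum_k (w j x ^+ 2 + w k x ^+ 2).
    have := leM j x xb; set s := \sum_k _ => h1.
    have : `|w j x * dw j x| <= `|w j x| * (M * s + D) by rewrite normrM ler_wpM2l.
    have : 2 * `|w j x| * s <= \sum_k (w j x ^+ 2 + w k x ^+ 2).
      rewrite mulr_sumr; apply: ler_sum => k _.
      rewrite -[w j x ^+ 2](real_normK (num_real _)) -[w k x ^+ 2](real_normK (num_real _)).
      have := sqr_ge0 (`|w j x| - `|w k x|); nra.
    set s2 := \sum_k (w j x ^+ 2 + w k x ^+ 2) => h2 h3.
    have := ler_norm (w j x * dw j x).
    have : 2 * `|w j x| * D <= w j x ^+ 2 + D ^+ 2.
      rewrite -[w j x ^+ 2](real_normK (num_real _)); have := sqr_ge0 (`|w j x| - D); nra.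
    have : M * (2 * `|w j x| * s) <= M * s2 by rewrite ler_wpM2l.
    nra.
  apply: (le_trans (ler_sum _ (fun j _ => h j))).
  have sumE : \sum_i \sum_k (w i x ^+ 2 + w k x ^+ 2) = 2 * #|S|%:R * \sum_j w j x ^+ 2.
    under eq_bigr do rewrite big_split/= sumr_const.
    rewrite big_split/= sumr_const sumrMnl -[_ *+ #|_|]mulr_natl cardT.
    by lra.
  rewrite big_split/= -mulr_sumr sumE big_split/= sumr_const -[_ *+ #|_|]mulr_natl cardT.
  by lra.
- by rewrite big1// => j _; rewrite w0 expr0n.
Qed.

End RealAnalysis.

(** * The discounted Riccati equation *)

Section Riccati.
Variables (R : realType) (S : finType) (T : S -> S -> R) (c : S -> R).

(** In blocks: C_+^-1 T_+- + C_+^-1 T_++ Y + Y |C_-|^-1 T_-- + Y |C_-|^-1 T_-+ Y. It is meant for i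
    in S_+ and j in S_-, where |c i| = c i. *)
Definition riccati (Y : S -> S -> R) i j : R :=
  T i j / `|c i| + \sum_(k in Splus c) T i k / `|c i| * Y k j +
  \sum_(k in Sminus c) Y i k / `|c k| *
     (T k j + \sum_(l in Splus c) T k l * Y l j).

Hypotheses (Tgen : generator T) (c0 : forall s, c s != 0).

Lemma SplusNminus s : (s \in Splus c) = (s \notin Sminus c).
Proof. by rewrite !inE -leNgt le_eqVlt eq_sym (negbTE (c0 s)). Qed.

Lemma sum_Splus_Sminus (F : S -> R) :
  \sum_s F s = \sum_(s in Sminus c) F s + \sum_(s in Splus c) F s.
Proof.
rewrite (bigID (mem (Sminus c)))/=; congr (_ + _).
by apply: eq_bigl => s; rewrite SplusNminus.
Qed.

Variables (q : R) (q0 : 0 < q).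

Let off i k : R := (i != k)%:R * T i k / `|c i|.
Let dia i : R := (q - T i i) / `|c i|.

Lemma off_ge0 i k : 0 <= off i k.
Proof.
rewrite divr_ge0//; have [_|/Tgen.1] := eqVneq i k; first by rewrite mul0r.
by rewrite mul1r.
Qed.

Lemma generator_diag_le0 i : T i i <= 0.
Proof.
have := Tgen.2 i; rewrite (bigD1 i)//= => /eqP; rewrite addr_eq0 => /eqP ->.
by rewrite oppr_le0 sumr_ge0// => k ki; apply: Tgen.1; rewrite eq_sym.
Qed.

Lemma dia_gt0 i : 0 < dia i.
Proof.
have h := generator_diag_le0 i.
by rewrite /dia divr_gt0 ?normr_gt0 ?c0// subr_gt0 (le_lt_trans h).
Qed.

Lemma sum_off i : \sum_(k in Sminus c) off i k + \sum_(k in Splus c) off i k <= dia i.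
Proof.
rewrite -sum_Splus_Sminus /off /dia -mulr_suml ler_wpM2r ?invr_ge0//.
rewrite (bigD1 i)//= eqxx mul0r add0r.
have := Tgen.2 i; rewrite (bigD1 i)//=.
rewrite [X in _ -> X <= _](eq_bigr (fun k => T i k)) => [|k ki].
  by have := q0; lra.
by rewrite eq_sym ki mul1r.
Qed.

(* [riccati T c Y = q (1/|c i| + 1/|c j|) Y] solved for the terms coming from the
   diagonal of [T]: the resulting map is monotone and preserves row sums at most 1. *)
Definition riccati_map (Y : S -> S -> R) i j : R :=
  (off i j + \sum_(k in Splus c) off i k * Y k j +
   \sum_(k in Sminus c) Y i k * (off k j + \sum_(l in Splus c) off k l * Y l j))
  / (dia i + dia j).

Lemma riccati_map_le (Y Z : S -> S -> R) :
  (forall i j, 0 <= Y i j) -> (forall i j, Y i j <= Z i j) ->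
  forall i j, 0 <= riccati_map Y i j <= riccati_map Z i j.
Proof.
move=> Y0 YZ i j; have Z0 a b : 0 <= Z a b by apply: le_trans (YZ a b).
have d0 : 0 < dia i + dia j by rewrite addr_gt0// dia_gt0.
apply/andP; split.
  rewrite divr_ge0 ?(ltW d0)// !addr_ge0 ?off_ge0 ?sumr_ge0// => k _.
    by rewrite mulr_ge0// off_ge0.
  by rewrite mulr_ge0// addr_ge0 ?off_ge0 ?sumr_ge0// => l _; rewrite mulr_ge0// off_ge0.
rewrite ler_wpM2r ?invr_ge0 ?(ltW d0)// lerD ?lerD2l ?ler_sum// => k _.
  by rewrite ler_wpM2l// off_ge0.
rewrite ler_pM ?lerD2l ?ler_sum//.
  by rewrite addr_ge0 ?off_ge0 ?sumr_ge0// => l _; rewrite mulr_ge0// off_ge0.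
by move=> l _; rewrite ler_wpM2l// off_ge0.
Qed.

Let Yn n := iter n riccati_map (fun _ _ => 0).

Lemma Yn_mono n i j : 0 <= Yn n i j <= Yn n.+1 i j.
Proof.
elim: n i j => [|n IH] i j.
  have z (a b : S) : (0 : R) <= 0 by [].
  by rewrite lexx/=; have /andP[] := riccati_map_le z z i j.
apply: riccati_map_le => a b; first by have /andP[] := IH a b.
by have /andP[] := IH a b.
Qed.

Lemma Yn_ge0 n i j : 0 <= Yn n i j. Proof. by have /andP[] := Yn_mono n i j. Qed.

(** The denominator [dia i + dia j] depends on j, so row sums cannot be read off directly. After
    multiplication by it, the numerators sum to at most [dia i] plus the sum of [dia j * Yn n i j].
    By monotonicity in n the latter is at most the same sum at n+1, which cancels. *)
Lemma Yn_row_le1 n i : i \in Splus c -> \sum_(j in Sminus c) Yn n i j <= 1.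
Proof.
elim: n i => [|n IH] i ip; first by rewrite big1.
have di := dia_gt0 i.
rewrite -(ler_pM2l di) mulr1 mulr_sumr.
have E j : dia i * Yn n.+1 i j + dia j * Yn n.+1 i j =
   off i j + \sum_(k in Splus c) off i k * Yn n k j +
   \sum_(k in Sminus c) Yn n i k * (off k j + \sum_(l in Splus c) off k l * Yn n l j).
  by rewrite -mulrDl mulrC /= /riccati_map divfK// gt_eqF// addr_gt0// dia_gt0.
have : \sum_(j in Sminus c) (dia i * Yn n.+1 i j + dia j * Yn n.+1 i j) <=
   dia i + \sum_(j in Sminus c) dia j * Yn n.+1 i j; last by rewrite big_split/=; lra.
under eq_bigr do rewrite E.
rewrite big_split/= big_split/= lerD//.
  apply: le_trans (sum_off i); rewrite lerD2l exchange_big/= ler_sum// => k kp.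
  by rewrite -mulr_sumr ler_piMr ?off_ge0// IH.
rewrite exchange_big/= ler_sum// => k km.
rewrite -mulr_sumr mulrC.
apply: (@le_trans _ _ (dia k * Yn n i k)); last first.
  by rewrite ler_wpM2l ?(ltW (dia_gt0 _))//; have /andP[] := Yn_mono n i k.
rewrite ler_wpM2r ?Yn_ge0// big_split/=.
apply: le_trans (sum_off k); rewrite lerD2l exchange_big/= ler_sum// => l lp.
by rewrite -mulr_sumr ler_piMr ?off_ge0// IH.
Qed.

(** The iterates of [riccati_map] from 0 increase and are bounded; their limit is a fixed point by
    continuity. *)
Lemma riccati_solution : exists Y : S -> S -> R,
  [/\ forall i j, i \in Splus c -> j \in Sminus c -> 0 <= Y i j,
      forall i, i \in Splus c -> \sum_(j in Sminus c) Y i j <= 1 &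
      forall i j, i \in Splus c -> j \in Sminus c ->
        riccati Y i j = q * (`|c i|^-1 + `|c j|^-1) * Y i j].
Proof.
have cvgY i j : i \in Splus c -> j \in Sminus c -> cvgn (fun n => Yn n i j).
  move=> ip jm; apply: nondecreasing_is_cvgn.
    by apply/nondecreasing_seqP => n; have /andP[] := Yn_mono n i j.
  exists 1 => _ [n _ <-]; apply: le_trans (Yn_row_le1 n ip).
  by rewrite (bigD1 j)//= lerDl sumr_ge0// => *; rewrite Yn_ge0.
pose Y i j := limn (fun n => Yn n i j).
exists Y; split.
- move=> i j ip jm; apply: limr_ge; first exact: cvgY.
  by near=> n; exact: Yn_ge0.
- move=> i ip.
  have : (fun n => \sum_(j in Sminus c) Yn n i j) @ \oo --> \sum_(j in Sminus c) Y i j.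
    by apply: cvg_big => [x|j jm]; [exact: add_continuous|exact: cvgY].
  move=> h; rewrite -(cvg_lim _ h)//; apply: limr_le; first by apply/cvg_ex; eexists; exact: h.
  by near=> n; exact: Yn_row_le1.
- move=> i j ip jm.
  have E : Y i j = riccati_map Y i j.
    have h1 : (fun n => Yn n.+1 i j) @ \oo --> Y i j.
      by rewrite (cvg_shiftS (fun n => Yn n i j)); exact: cvgY.
    rewrite -(cvg_lim _ h1)//; apply/cvg_lim => //.
    rewrite /riccati_map; apply: cvgMl; apply: cvgD.
      apply: cvgD; first exact: cvg_cst.
      apply: cvg_big => [x|k kp]; first exact: add_continuous.
      by apply: cvgMr; exact: cvgY.
    apply: cvg_big => [x|k km]; first exact: add_continuous.
    apply: cvgM; first exact: cvgY.
    apply: cvgD; first exact: cvg_cst.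
    apply: cvg_big => [x|l lp]; first exact: add_continuous.
    by apply: cvgMr; exact: cvgY.
  have d0 : dia i + dia j != 0 by rewrite gt_eqF// addr_gt0// dia_gt0.
  (* Once the denominator is cleared, the diagonal terms of [T] that [off] omits, and the two terms
     in [q], are exactly those carried by [dia i + dia j]. *)
  have /(congr1 (fun z => z * (dia i + dia j))) := E.
  rewrite [in X in _ = X](divfK d0).
  have ci : `|c i|^-1 * `|c i| = 1 by rewrite mulVf// normr_eq0.
  have ij : i != j by apply/eqP => ij; move: jm; rewrite -ij; move: ip; rewrite SplusNminus => /negbTE ->.
  have offE a b : off a b = T a b / `|c a| - (a == b)%:R * T a a / `|c a|.
    by rewrite /off; case: eqVneq => [->|]/=; lra.
  have s1 : \sum_(k in Splus c) off i k * Y k j =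
     \sum_(k in Splus c) T i k / `|c i| * Y k j - T i i / `|c i| * Y i j.
    rewrite (bigD1 i)//= [in RHS](bigD1 i)//= addrAC subrr add0r /off eqxx !mul0r add0r.
    by apply: eq_bigr => k /andP[_ ki]; rewrite eq_sym ki mul1r.
  have s2 : \sum_(k in Sminus c) Y i k * (off k j + \sum_(l in Splus c) off k l * Y l j) =
     \sum_(k in Sminus c) Y i k / `|c k| * (T k j + \sum_(l in Splus c) T k l * Y l j)
      - Y i j * T j j / `|c j|.
    have h k : k \in Sminus c -> \sum_(l in Splus c) off k l * Y l j =
         `|c k|^-1 * \sum_(l in Splus c) T k l * Y l j.
      move=> km; rewrite mulr_sumr; apply: eq_bigr => l lp; rewrite /off.
      have -> : k != l by apply/eqP => kl; move: lp; rewrite -kl SplusNminus km.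
      by rewrite mul1r; lra.
    rewrite (bigD1 j)//= [in RHS](bigD1 j)//= h// [off j j]/off eqxx !mul0r add0r.
    rewrite [X in _ + X](eq_bigr (fun k => Y i k / `|c k| * (T k j + \sum_(l in Splus c) T k l * Y l j))).
      by set s := \sum_(_ | _ && _) _; lra.
    by move=> k /andP[km kj]; rewrite h// /off kj mul1r; set s := \sum_(_ in _) _; ring.
  rewrite s1 s2 /riccati [off i j]/off ij /dia mul1r; lra.
Unshelve. all: by end_near. Qed.

End Riccati.

(** * A bounded harmonic function from a solution of the discounted Riccati equation *)

Section Harmonic.
Variables (R : realType) (S : finType) (T : S -> S -> R) (c : S -> R).
Hypotheses (Tgen : generator T) (c0 : forall s, c s != 0).
Variables (q : R) (q0 : 0 < q) (Y : S -> S -> R).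
Hypotheses (Y0 : forall i j, i \in Splus c -> j \in Sminus c -> 0 <= Y i j)
  (Y1 : forall i, i \in Splus c -> \sum_(j in Sminus c) Y i j <= 1)
  (Yric : forall i j, i \in Splus c -> j \in Sminus c ->
        riccati T c Y i j = q * (`|c i|^-1 + `|c j|^-1) * Y i j).

(* [U] drives the phase process censored to S_-, run in the level variable; adding
   [m] to its diagonal makes it entrywise nonnegative, which yields bounds on
   [exp (U y)] for y >= 0. *)
Let U j k : R := (T j k + \sum_(l in Splus c) T j l * Y l k - (j == k)%:R * q) / `|c j|.
Let m : R := \sum_j (q - T j j) / `|c j|.
Let N j k : R := if (j \in Sminus c) && (k \in Sminus c) then U j k + (j == k)%:R * m else 0.

Lemma unif_rate_ge j : (q - T j j) / `|c j| <= m.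
Proof.
rewrite /m (bigD1 j)//= lerDl sumr_ge0// => i _.
by rewrite divr_ge0// subr_ge0 (le_trans (generator_diag_le0 Tgen i)) ?ltW.
Qed.

Lemma unif_ge0 j k : 0 <= N j k.
Proof.
rewrite /N; case: ifP => // /andP[jm km].
have s0 : 0 <= \sum_(l in Splus c) T j l * Y l k.
  apply: sumr_ge0 => l lp; rewrite mulr_ge0 ?Y0//.
  by apply: Tgen.1; apply/eqP => jl; move: lp; rewrite -jl SplusNminus// jm.
rewrite /U; move: s0; have [<- s0|jk s0] := eqVneq j k; last first.
  by rewrite !mul0r subr0 addr0 divr_ge0// addr_ge0// Tgen.1.
have := unif_rate_ge j; rewrite !mul1r => h.
have : 0 <= (\sum_(l in Splus c) T j l * Y l j) / `|c j| by rewrite divr_ge0.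
by lra.
Qed.

(** This says that the rows of [U] have nonpositive sums: rows of [T] sum to 0, replacing the phases
    of S_+ by rows of [Y] does not increase the total, and [q] lowers it. *)
Lemma unif_row j : j \in Sminus c -> \sum_(k in Sminus c) N j k <= m.
Proof.
move=> jm.
rewrite (eq_bigr (fun k => U j k + (j == k)%:R * m)); last by move=> k km; rewrite /N jm km.
rewrite big_split/= [X in _ + X](bigD1 j)//= eqxx mul1r [X in _ + (_ + X)]big1.
  rewrite addr0 gerDr /U -mulr_suml pmulr_lle0 ?invr_gt0 ?normr_gt0//.
  rewrite sumrB big_split/= [X in _ - X](bigD1 j)//= eqxx mul1r [X in _ - (_ + X)]big1.
    rewrite addr0 exchange_big/=.
    have : \sum_(l in Splus c) \sum_(k in Sminus c) T j l * Y l k <= \sum_(l in Splus c) T j l.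
      apply: ler_sum => l lp; rewrite -mulr_sumr ler_piMr ?Y1//.
      by apply: Tgen.1; apply/eqP => jl; move: lp; rewrite -jl SplusNminus// jm.
    have := Tgen.2 j; rewrite (sum_Splus_Sminus c0).
    by have := q0; lra.
  by move=> k /andP[_ kj]; rewrite eq_sym (negbTE kj) mul0r.
by move=> k /andP[_ kj]; rewrite eq_sym (negbTE kj) mul0r.
Qed.

(** On S_-, the (j, l) entry of exp(Uy). The transpose of [N] appears because [is_derive_expm]
    multiplies on the right, while the harmonic equation needs [U] on the left. *)
Let base (l : S) (y : R) (j : S) : R := expR (- m * y) * expm (Sminus c) (fun a b => y * N b a) l j.

(** Heuristically, the expected discount at the first passage to 0 from level y and phase j, on the
    event that it happens in phase l: a start in S_+ must first return to level y, which contributes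
    the factor [Y]. The formula also makes sense for y < 0, where the walk lands when it
    overshoots. *)
Definition harm (l : S) (y : R) (j : S) : R :=
  if j \in Sminus c then base l y j else \sum_(k in Sminus c) Y j k * base l y k.

Definition harm_drv (l : S) (y : R) (j : S) : R :=
  if j \in Sminus c then \sum_(k in Sminus c) U j k * base l y k
  else \sum_(k in Sminus c) Y j k * (\sum_(p in Sminus c) U k p * base l y p).

Lemma is_derive_base l j y : j \in Sminus c ->
  is_derive y (1 : R) (fun z => base l z j) (\sum_(k in Sminus c) U j k * base l y k).
Proof.
move=> jm; apply: is_derive_eq.
  by apply: drvM; exact: is_derive_expm.
rewrite /GRing.scale/= mulr1.
rewrite (eq_bigr (fun k => expm (Sminus c) (fun a b => y * N b a) l k * (U j k + (j == k)%:R * m))); last first.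
  by move=> k km; rewrite {2}/N jm km.
rewrite (eq_bigr (fun k => U j k * expm (Sminus c) (fun a b => y * N b a) l k + (j == k)%:R * (m * expm (Sminus c) (fun a b => y * N b a) l j))); last first.
  by move=> k km; case: eqVneq => [->|_]; rewrite ?mul0r; ring.
rewrite big_split/= [X in _ * (_ + X)](bigD1 j)//= eqxx mul1r [X in _ * (_ + (_ + X))]big1; last first.
  by move=> k /andP[_ kj]; rewrite eq_sym (negbTE kj) mul0r.
rewrite [RHS](eq_bigr (fun k => expR (- m * y) * (U j k * expm (Sminus c) (fun a b => y * N b a) l k))); last first.
  by move=> k _; rewrite /base mulrCA.
by rewrite -mulr_sumr; ring.
Qed.

Lemma is_derive_harm l j y : is_derive y (1 : R) (fun z => harm l z j) (harm_drv l y j).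
Proof.
rewrite /harm /harm_drv; case: ifP => jm; first exact: is_derive_base.
by apply: drv_sum => k km; apply: drvZ; exact: is_derive_base.
Qed.

Lemma harm0 l j : j \in Sminus c -> harm l 0 j = (l == j)%:R.
Proof. by move=> jm; rewrite /harm jm /base mulr0 expR0 mul1r expm0. Qed.

Lemma harm0_plus l j : l \in Sminus c -> j \in Splus c -> harm l 0 j = Y j l.
Proof.
move=> lm jp; rewrite /harm -(negbK (j \in Sminus c)) -SplusNminus// jp/=.
rewrite (bigD1 l)//= big1 ?addr0.
  by rewrite /base mulr0 expR0 mul1r expm0 eqxx mulr1.
by move=> k /andP[_ kl]; rewrite /base mulr0 expR0 mul1r expm0 eq_sym (negbTE kl) mulr0.
Qed.

(** For j in S_- the equation is the definition of [U]; for j in S_+ it is the Riccati equation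
    multiplied by exp(Uy). *)
Lemma harm_eq l y j :
  c j * harm_drv l y j + \sum_k T j k * harm l y k - q * harm l y j = 0.
Proof.
have E1 : \sum_k T j k * harm l y k = \sum_(k in Sminus c) (T j k + \sum_(p in Splus c) T j p * Y p k) * base l y k.
  rewrite (sum_Splus_Sminus c0).
  under [RHS]eq_bigr do rewrite mulrDl.
  rewrite big_split/=; congr (_ + _); first by apply: eq_bigr => k km; rewrite /harm km.
  rewrite (eq_bigr (fun p => \sum_(k in Sminus c) T j p * Y p k * base l y k)).
    rewrite exchange_big/=; apply: eq_bigr => k _; by rewrite mulr_suml.
  move=> p; rewrite SplusNminus// /harm => /negbTE ->.
  by rewrite mulr_sumr; apply: eq_bigr => k _; rewrite mulrA.
rewrite E1 /harm /harm_drv; set a := `|c j|.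
have a0 : a != 0 by rewrite normr_eq0.
case: ifP => jm.
  have cj : c j = - a by rewrite /a ltr0_norm ?opprK.
  rewrite cj mulr_sumr -big_split/=.
  rewrite (eq_bigr (fun k => (j == k)%:R * (q * base l y j))); last first.
    move=> k km; rewrite /U -/a; set s := \sum_(_ in _) _.
    by have [->|_] := eqVneq j k; rewrite ?mul0r ?mul1r; field.
  rewrite (bigD1 j)//= eqxx mul1r big1 ?addr0 ?subrr// => k /andP[_ kj].
  by rewrite eq_sym (negbTE kj) mul0r.
have jp : j \in Splus c by rewrite SplusNminus// jm.
have cj : c j = a by rewrite /a gtr0_norm.
under eq_bigr do rewrite mulr_sumr.
rewrite exchange_big/= cj mulr_sumr -big_split/= mulr_sumr -sumrB big1// => p pm.
have := Yric jp pm; rewrite /riccati -/a.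
rewrite [X in _ + X + _](_ : _ = (\sum_(k in Splus c) T j k * Y k p) / a); last first.
  by rewrite mulr_suml; apply: eq_bigr => k _; rewrite mulrAC.
set t := \sum_(_ in Splus c) _.
set s := \sum_(_ in Sminus c) _ => E.
(* The diagonal term -q / |c p| of [U] supplies the 1 / |c p| half of the right-hand side of
   [Yric]. *)
have -> : \sum_(k in Sminus c) Y j k * (U k p * base l y p) = (s - q * Y j p / `|c p|) * base l y p.
  rewrite /s (_ : q * Y j p / `|c p| = \sum_(k in Sminus c) (k == p)%:R * (q * Y j p / `|c p|)); last first.
    rewrite (bigD1 p)//= eqxx mul1r big1 ?addr0// => k /andP[_ /negbTE ->].
    by rewrite mul0r.
  rewrite -sumrB mulr_suml; apply: eq_bigr => k km; rewrite /U.
  set r := \sum_(_ in Splus c) _.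
  by have [->|_] := eqVneq k p; rewrite ?mul0r ?mul1r; ring.
have cp0 : `|c p| != 0 by rewrite normr_eq0.
have -> : s = q * (a^-1 + `|c p|^-1) * Y j p - T j p / a - t / a by lra.
by field; rewrite a0 cp0.
Qed.

(** For y >= 0 the bound is 1, since exp(-my) compensates the growth of exp(Ny). Negative y range
    over a bounded interval, where the crude exponential bound serves. *)
Lemma base_bound l (y0 : R) : 0 <= y0 ->
  exists B, 0 <= B /\ forall y j, - y0 <= y -> j \in Sminus c -> `|base l y j| <= B.
Proof.
move=> y00; exists (expR (m * y0) * expR (mnorm (fun a b => N b a) * y0) + 1).
split; first by rewrite addr_ge0// mulr_ge0// expR_ge0.
move=> y j yy0 jm; rewrite /base normrM ger0_norm ?expR_ge0//.
have m0 : 0 <= m.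
  by rewrite sumr_ge0// => i _; rewrite divr_ge0// subr_ge0 (le_trans (generator_diag_le0 Tgen i)) ?ltW.
have [y1|y1] := leP 0 y.
  have /andP[e0 e1] : 0 <= expm (Sminus c) (fun a b => y * N b a) l j <= expR (m * y).
    apply: expm_ge0_bound => //; first by move=> a b; exact: unif_ge0.
    by move=> k km; exact: unif_row.
  rewrite ger0_norm//; apply: (@le_trans _ _ 1); last by rewrite lerDr mulr_ge0// expR_ge0.
  apply: (@le_trans _ _ (expR (- m * y) * expR (m * y))); first by rewrite ler_wpM2l// expR_ge0.
  by rewrite -expRD mulNr addNr expR0.
apply: (@le_trans _ _ (expR (m * y0) * expR (mnorm (fun a b => N b a) * y0))); last by rewrite lerDl.
apply: ler_pM; rewrite ?expR_ge0//.
  by rewrite ler_expR mulNr -mulrN ler_wpM2l// lerNl.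
apply: (le_trans (expm_bound _ _ _ _ _)).
rewrite ler_expR ler_wpM2l ?mnorm_ge0// ltr0_norm//; lra.
Qed.

Lemma harm_bound l (y0 : R) : 0 <= y0 -> exists B, 0 <= B /\ forall y j, - y0 <= y ->
  [/\ `|harm l y j| <= B, `|harm_drv l y j| <= B &
    forall t, - y0 <= y + t -> `|harm l (y + t) j - harm l y j - t * harm_drv l y j| <= B * t ^+ 2].
Proof.
move=> y00; have [B [B0 bB]] := base_bound l y00.
(* Coefficients of [harm_drv] in terms of [base]; [C] below bounds the absolute row sums of [mat]
   and of [Y]. *)
pose mat i k : R := if i \in Sminus c then U i k else \sum_(p in Sminus c) Y i p * U p k.
have drvE y i : harm_drv l y i = \sum_(k in Sminus c) mat i k * base l y k.
  rewrite /harm_drv /mat; case: ifP => // im.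
  under eq_bigr do rewrite mulr_sumr.
  rewrite exchange_big/=; apply: eq_bigr => k _; rewrite mulr_suml.
  by apply: eq_bigr => p _; rewrite mulrA.
pose C := \sum_i \sum_k (`|mat i k| + `|Y i k|).
have C0 : 0 <= C by apply: sumr_ge0 => i _; apply: sumr_ge0 => k _; rewrite addr_ge0.
have lC i : \sum_(k in Sminus c) (`|mat i k| + `|Y i k|) <= C.
  rewrite /C [leRHS](bigD1 i)//= ler_wpDr//; first by apply: sumr_ge0 => ? _; apply: sumr_ge0 => k _; rewrite addr_ge0.
  by rewrite [leRHS](bigID (mem (Sminus c)))/= lerDl sumr_ge0// => k _; rewrite addr_ge0.
have matC i : \sum_(k in Sminus c) `|mat i k| <= C.
  by apply: le_trans (lC i); apply: ler_sum => k _; rewrite lerDl.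
have YC i : \sum_(k in Sminus c) `|Y i k| <= C.
  by apply: le_trans (lC i); apply: ler_sum => k _; rewrite lerDr.
have combo (F : S -> R) (v : S -> R) b : 0 <= b -> \sum_(k in Sminus c) `|F k| <= C ->
   (forall k, k \in Sminus c -> `|v k| <= b) -> `|\sum_(k in Sminus c) F k * v k| <= C * b.
  move=> b0 FC vb; apply: le_trans (ler_norm_sum _ _ _) _.
  apply: (@le_trans _ _ (\sum_(k in Sminus c) `|F k| * b)).
    by apply: ler_sum => k km; rewrite normrM ler_wpM2l// vb.
  by rewrite -mulr_suml ler_wpM2r.
have drvB y i : - y0 <= y -> `|harm_drv l y i| <= C * B.
  by move=> yy; rewrite drvE; apply: combo => // k km; exact: bB.
have baseL y z k : k \in Sminus c -> - y0 <= y -> - y0 <= z ->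
    `|base l z k - base l y k| <= C * B * `|z - y|.
  move=> km; wlog yz : y z / y <= z.
    move=> h yy zy; have [yz|/ltW yz] := leP y z; first exact: h.
    by rewrite distrC [`|z - y|]distrC; exact: h.
  move=> yy zy.
  have dv x : is_derive x (1 : R) (fun x => base l x k) (harm_drv l x k).
    by rewrite /harm_drv km; exact: is_derive_base.
  have cb : {within `[y, z], continuous (fun x => base l x k)}.
    by apply: derivable_within_continuous => x _; exact: (@ex_derive _ _ _ _ _ _ _ (dv x)).
  have [x] := MVT_segment yz (fun x _ => dv x) cb.
  rewrite in_itv/= => /andP[yx xz] ->.
  by rewrite normrM ler_wpM2r// drvB// (le_trans yy).
(* The values are bounded by B or CB, the derivatives by CB, and C (CB) is a Lipschitz constant of
   the derivatives. *)
exists (B + C * B + C * (C * B)); split; first by rewrite !addr_ge0// !mulr_ge0.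
have CB0 : 0 <= C * B by rewrite mulr_ge0.
have CCB0 : 0 <= C * (C * B) by rewrite mulr_ge0.
move=> y j yy; split.
- rewrite /harm; case: ifP => jm.
    by have := bB _ _ yy jm; lra.
  have : `|\sum_(k in Sminus c) Y j k * base l y k| <= C * B.
    by apply: combo => // k km; exact: bB.
  by lra.
- by have := drvB y j yy; lra.
- move=> t yt; apply: (@le_trans _ _ (C * (C * B) * t ^+ 2)); last first.
    by rewrite ler_wpM2r ?sqr_ge0//; lra.
  apply: (@taylor1_lip _ (fun y => harm l y j) (fun y => harm_drv l y j)).
    by move=> z; exact: is_derive_harm.
  move=> z zt; have zy : - y0 <= z.
    by case/orP: zt => /andP[z1 z2]; [apply: le_trans z1|apply: le_trans z1].
  have zyt : `|z - y| <= `|t|.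
    case/orP: zt => /andP[z1 z2].
      by rewrite ger0_norm ?subr_ge0// ger0_norm; lra.
    by rewrite ler0_norm ?subr_le0// ler0_norm; lra.
  rewrite !drvE -sumrB; under eq_bigr do rewrite -mulrBr.
  rewrite -mulrA; apply: combo => //; first by rewrite mulr_ge0.
  move=> k km; apply: le_trans (baseL _ _ _ km yy zy) _.
  by rewrite ler_wpM2l.
Qed.

End Harmonic.

(** * Paths sampled on a grid *)

Section IntegrationTools.
Context d (T : measurableType d) (R : realType).

Lemma measurable_fun_lim (D : set T) (F : nat -> T -> R) (f : T -> R) :
  (forall n, measurable_fun D (F n)) ->
  (forall x, D x -> F ^~ x @ \oo --> f x) -> measurable_fun D f.
Proof.
move=> mF Ff; apply/measurable_EFinP.
apply: (@emeasurable_fun_cvg _ _ _ _ (fun n x => (F n x)%:E)) => [n|x Dx].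
  exact/measurable_EFinP.
by apply: cvg_EFin; [near=> n|exact: Ff].
Unshelve. all: by end_near. Qed.

Variable mu : {measure set T -> \bar R}.

Lemma Rintegral_dominated_cvg (D : set T) (F : nat -> T -> R) (f g : T -> R) :
  measurable D -> (forall n, measurable_fun D (F n)) -> measurable_fun D f ->
  {ae mu, forall x, D x -> F ^~ x @ \oo --> f x} ->
  mu.-integrable D (EFin \o g) -> (forall n x, D x -> `|F n x| <= g x) ->
  mu.-integrable D (EFin \o f) /\
  (fun n => \int[mu]_(x in D) F n x)%R @ \oo --> (\int[mu]_(x in D) f x)%R.
Proof.
move=> mD mF mf Ff ig Fg.
have mF' n : measurable_fun D (fun x => (F n x)%:E) by exact/measurable_EFinP.
have mf' : measurable_fun D (EFin \o f) by exact/measurable_EFinP.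
have Ff' : {ae mu, forall x, D x -> (fun n => (F n x)%:E) @ \oo --> (EFin \o f) x}.
  by apply: filterS Ff => x + Dx => /(_ Dx) h; apply: cvg_EFin => //; near=> n.
have Fg' : {ae mu, forall x n, D x -> (`|(F n x)%:E| <= (EFin \o g) x)%E}.
  by apply: aeW => x n Dx; rewrite lee_fin Fg.
have [if_ _ h] := dominated_convergence mD mF' mf' Ff' ig Fg'; split => //.
by apply: fine_cvg; rewrite fineK//; exact: integrable_fin_num.
Unshelve. all: by end_near. Qed.

Lemma integrable_bounded (D : set T) (f : T -> R) (B : R) : measurable D -> (mu D < +oo)%E ->
  measurable_fun D f -> (forall x, D x -> `|f x| <= B) -> mu.-integrable D (EFin \o f).
Proof.
move=> mD muD mf fB; apply: measurable_bounded_integrable => //.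
exists B; split; first exact: num_real.
by move=> M BM x Dx; apply: le_trans (fB x Dx) (ltW BM).
Qed.

End IntegrationTools.

Section Grid.
Variable R : realType.

Definition mesh (n : nat) : R := n.+1%:R^-1.

Definition gidx n (u : R) : nat := Num.truncn (u * n.+1%:R).

Definition cell n k : set R := `[k%:R * mesh n, k.+1%:R * mesh n[%classic.

(** With mesh 1/(n+1) these steps cover [0, n+1[: one index refines the mesh and pushes the horizon
    to infinity. *)
Definition nsteps n : nat := (n.+1 * n.+1)%N.

(** A finite sum of indicators of cells, so that measurability and integrals of sampled quantities
    reduce to finite sums; it vanishes beyond the horizon. *)
Definition stepf n (b : nat -> R) (u : R) : R :=
  \sum_(k < nsteps n) \1_(cell n k) u * b k.

Lemma mesh_gt0 n : 0 < mesh n. Proof. by rewrite invr_gt0. Qed.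

Lemma mesh_le1 n : mesh n <= 1.
Proof. by rewrite invf_le1// ler1n. Qed.

Lemma mesh_cvg0 : mesh @ \oo --> 0.
Proof. exact: cvg_harmonic. Qed.

Lemma nsteps_mesh n : (nsteps n)%:R * mesh n = n.+1%:R.
Proof. by rewrite /nsteps natrM /mesh mulfK// pnatr_eq0. Qed.

Lemma gidx_itv n u : 0 <= u -> (gidx n u)%:R * mesh n <= u < (gidx n u).+1%:R * mesh n.
Proof.
move=> u0; rewrite ler_pdivrMr// ltr_pdivlMr//; apply: truncn_itv.
by rewrite mulr_ge0.
Qed.

Lemma cell_gidx n k u : cell n k u -> 0 <= u /\ k = gidx n u.
Proof.
rewrite /cell/= in_itv/= => /andP[k1 k2]; split.
  by apply: le_trans k1; rewrite mulr_ge0// ltW// mesh_gt0.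
apply/esym/truncn_def.
by rewrite -ler_pdivrMr// -ltr_pdivlMr// k1 k2.
Qed.

Lemma mem_cell_gidx n u : 0 <= u -> cell n (gidx n u) u.
Proof. by move=> u0; rewrite /cell/= in_itv/= gidx_itv. Qed.

Lemma stepf_out n b u : ~ (0 <= u < n.+1%:R) -> stepf n b u = 0.
Proof.
move=> nu; rewrite /stepf big1// => k _; rewrite indicE.
have [ku|] := boolP (u \in cell n k); last by rewrite mul0r.
case: nu; move: ku; rewrite inE => ku; have [u0 _] := cell_gidx ku.
rewrite u0/=; move: ku; rewrite /cell/= in_itv/= => /andP[_ ku].
by apply: (lt_le_trans ku); rewrite -(nsteps_mesh n) ler_wpM2r ?ler_nat ?ltn_ord// ltW// mesh_gt0.
Qed.

Lemma stepfE n b u : 0 <= u < n.+1%:R -> stepf n b u = b (gidx n u).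
Proof.
move=> /andP[u0 un]; have ki : (gidx n u < nsteps n)%N.
  by rewrite /gidx truncn_lt_nat ?mulr_ge0// /nsteps natrM ltr_pM2r.
rewrite /stepf (bigD1 (Ordinal ki))//= indicE mem_set ?mul1r; last exact: mem_cell_gidx.
rewrite big1 ?addr0// => k kk; rewrite indicE.
have [|] := boolP (u \in cell n k); last by rewrite mul0r.
rewrite inE => /cell_gidx[_ E]; move: kk; rewrite -(inj_eq val_inj)/= E.
by rewrite eqxx.
Qed.

Lemma near_stepfE u (b : nat -> nat -> R) : 0 <= u ->
  \forall n \near \oo, stepf n (b n) u = b n (gidx n u).
Proof.
move=> u0; near=> n; rewrite stepfE// u0/=.
apply: (lt_le_trans (truncnS_gt u)); rewrite ler_nat ltnS; near: n.
exact: nbhs_infty_ge.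
Unshelve. all: by end_near. Qed.

Lemma measurable_cell n k : measurable (cell n k).
Proof. exact: measurable_itv. Qed.

Lemma measurable_stepf n b : measurable_fun setT (stepf n b).
Proof.
apply: measurable_sum => k; apply: measurable_funM => //.
by apply: measurable_indic; exact: measurable_cell.
Qed.

(** The grid point just after u. Right-continuity makes sampling there recover the phase at u. *)
Definition rpt n u : R := (gidx n u).+1%:R * mesh n.

Lemma rpt_itv n u : 0 <= u -> u < rpt n u <= u + mesh n.
Proof.
move=> u0; have /andP[g1 g2] := gidx_itv n u0; rewrite g2/= /rpt -natr1 mulrDl mul1r.
by rewrite lerD2r.
Qed.

Lemma near_mesh_lt e : 0 < e -> \forall n \near \oo, mesh n < e.
Proof.
move=> e0; have /cvgrPdist_lt/(_ e e0) := mesh_cvg0.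
by apply: filterS => n; rewrite sub0r normrN gtr0_norm ?mesh_gt0.
Qed.

End Grid.
Arguments mesh R n : clear implicits.

(** * The level process of a fixed path and its sampled version *)

Section Path.
Variables (R : realType) (S : finType) (c : S -> R) (z : R -> S).
Hypothesis zr : forall t, 0 <= t -> exists2 e, 0 < e &
  forall u, t <= u -> u < t + e -> z u = z t.

Local Notation mu := (@lebesgue_measure R).

Definition maxrate : R := \sum_s `|c s|.

Lemma le_maxrate s : `|c s| <= maxrate.
Proof. by rewrite /maxrate (bigD1 s)//= lerDl sumr_ge0. Qed.

Lemma maxrate_ge0 : 0 <= maxrate. Proof. by rewrite sumr_ge0. Qed.

Lemma near_rpt_const u : 0 <= u -> \forall n \near \oo, z (rpt n u) = z u.
Proof.
move=> u0; have [e e0 ze] := zr u0; near=> n.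
have /andP[r1 r2] := rpt_itv n u0; apply: ze; first exact: ltW.
by apply: (le_lt_trans r2); rewrite ltrD2l; near: n; exact: near_mesh_lt.
Unshelve. all: by end_near. Qed.

(** Pointwise limit of the step functions sampled at right end points. Nothing is known about paths
    at negative times, hence the half-line. *)
Lemma measurable_path (F : S -> R) : measurable_fun (`[0, +oo[%classic : set R) (F \o z).
Proof.
apply: (@measurable_fun_lim _ _ _ _ (fun n u => stepf n (fun k => F (z (k.+1%:R * mesh R n))) u)).
  by move=> n; apply: measurable_funTS; exact: measurable_stepf.
move=> u; rewrite /= in_itv/= andbT => u0; apply: cvg_near_cst; near=> n.
rewrite (near (near_stepfE (fun n k => F (z (k.+1%:R * mesh R n))) u0) n)//.
congr F.
by near: n; exact: near_rpt_const.
Unshelve. all: by end_near. Qed.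

Definition lev (t : R) : R := (\int[mu]_(u in `[0, t]) c (z u))%R.

Lemma integrable_path (i : interval R) (F : S -> R) : [set` i] `<=` (`[0, +oo[%classic : set R) ->
  (mu [set` i] < +oo)%E -> mu.-integrable [set` i] (EFin \o (F \o z)).
Proof.
move=> i0 mi; apply: (@integrable_bounded _ _ _ _ _ _ (\sum_s `|F s|)) => //.
  by apply: measurable_funS (measurable_path F).
by move=> x _ /=; rewrite (bigD1 (z x))//= lerDl sumr_ge0.
Qed.

Lemma mu_itv_lty (a b : R) x y : (mu [set` Interval (BSide x a) (BSide y b)] < +oo)%E.
Proof.
by rewrite lebesgue_measure_itv/=; case: ifP => _; rewrite ?ltry.
Qed.

Lemma lev_co t : lev t = (\int[mu]_(u in `[0, t[) c (z u))%R.
Proof.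
apply/esym/Rintegral_itv_bndo_bndc; apply: (@integrable_path _ c).
  by move=> x /=; rewrite !in_itv/= => /andP[->].
exact: mu_itv_lty.
Qed.

Lemma levB a b : 0 <= a <= b -> lev b = lev a + (\int[mu]_(u in `[a, b[) c (z u))%R.
Proof.
move=> /andP[a0 ab]; rewrite !lev_co.
rewrite (@itv_bndbnd_setU _ _ _ (BLeft a))//.
rewrite Rintegral_setU//; last first.
  by apply: lt_disjoint => x y; rewrite /= !in_itv/= => /andP[_ xa] /andP[ay _]; exact: lt_le_trans ay.
rewrite -itv_bndbnd_setU//; apply: (@integrable_path _ c).
  by move=> x /=; rewrite !in_itv/= => /andP[->].
exact: mu_itv_lty.
Qed.

Lemma lev0 t : t <= 0 -> lev t = 0.
Proof.
move=> t0; rewrite lev_co set_itv_ge ?Rintegral_set0//.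
by rewrite bnd_simp -leNgt.
Qed.

Lemma lev_const a b s : 0 <= a <= b -> (forall u, a <= u < b -> z u = s) ->
  lev b = lev a + c s * (b - a).
Proof.
move=> ab zs; rewrite (levB ab); congr (_ + _).
rewrite (@eq_Rintegral _ _ _ _ _ (fun _ => c s)); last first.
  by move=> u; rewrite inE/= in_itv/= => /zs ->.
rewrite Rintegral_cst//= lebesgue_measure_itv/= lte_fin.
case: ltP => //= h; have /andP[_ ab'] := ab.
by have -> : b = a; [apply/eqP; rewrite eq_le h|rewrite subrr].
Qed.

Lemma normr_intc a b : 0 <= a <= b ->
  `|(\int[mu]_(u in `[a, b[) c (z u))%R| <= maxrate * (b - a).
Proof.
move=> /andP[a0 ab].
have sub : [set` `[a, b[] `<=` (`[0, +oo[%classic : set R).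
  by move=> x /=; rewrite !in_itv/= => /andP[ax _]; rewrite (le_trans a0 ax).
have i1 := integrable_path c sub (mu_itv_lty a b true true).
apply: le_trans (le_normr_Rintegral _ _) _ => //.
apply: (@le_trans _ _ (\int[mu]_(u in `[a, b[) maxrate)%R).
  apply: le_Rintegral => //.
  - exact: (integrable_path (fun s => `|c s|) sub (mu_itv_lty a b true true)).
  - exact: (integrable_path (fun=> maxrate) sub (mu_itv_lty a b true true)).
  - by move=> x _; exact: le_maxrate.
rewrite Rintegral_cst//= lebesgue_measure_itv/= lte_fin; case: ltP => //= h.
by rewrite mulr0 mulr_ge0 ?maxrate_ge0// subr_ge0.
Qed.

Lemma lev_lip a b : `|lev b - lev a| <= maxrate * `|b - a|.
Proof.
wlog ab : a b / a <= b.
  move=> h; have [ab|/ltW ab] := leP a b; first exact: h.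
  by rewrite distrC [`|b - a|]distrC; exact: h.
have lipp x y : 0 <= x <= y -> `|lev y - lev x| <= maxrate * (y - x).
  by move=> xy; rewrite (levB xy) addrAC subrr add0r; exact: normr_intc.
rewrite (ger0_norm (_ : 0 <= b - a)) ?subr_ge0//.
have [a0|a0] := leP 0 a; first by apply: lipp; rewrite a0.
rewrite [lev a]lev0 ?(ltW a0)//; have [b0|b0] := leP b 0.
  by rewrite lev0// subrr normr0 mulr_ge0 ?maxrate_ge0// subr_ge0.
have := @lipp 0 b; rewrite lexx (ltW b0) => /(_ isT); rewrite [lev 0]lev0//.
rewrite !subr0 => h; apply: (le_trans h).
by rewrite ler_wpM2l ?maxrate_ge0// lerDl oppr_ge0 ltW.
Qed.

Lemma continuous_lev : continuous lev.
Proof.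
move=> t; apply/cvgrPdist_le => e e0; near=> u.
apply: (le_trans (lev_lip _ _)).
apply: (@le_trans _ _ ((maxrate + 1) * `|t - u|)).
  by rewrite ler_wpM2r// lerDl.
rewrite mulrC -ler_pdivlMr; last by rewrite ltr_wpDl// maxrate_ge0.
near: u; apply: cvgr_dist_le => //.
by rewrite divr_gt0// ltr_wpDl// maxrate_ge0.
Unshelve. all: by end_near. Qed.

(** The level of the sampled walk: a left Riemann sum of the rates. *)
Definition dlev n k : R := mesh R n * \sum_(i < k) c (z (i%:R * mesh R n)).

(** Sampled at right end points, where pointwise convergence holds, although [dlev] uses left ones;
    [dlev_lev] pays for the shift. *)
Definition srate n : R -> R := stepf n (fun k => c (z (k.+1%:R * mesh R n))).

Lemma srate_bound n u : `|srate n u| <= maxrate.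
Proof.
rewrite /srate; have [u0|u0] := boolP (0 <= u < n.+1%:R); first by rewrite stepfE// le_maxrate.
by rewrite stepf_out ?normr0 ?maxrate_ge0//; exact/negP.
Qed.

Lemma integrable_srate n (i : interval R) : (mu [set` i] < +oo)%E ->
  mu.-integrable [set` i] (EFin \o srate n).
Proof.
move=> mi; apply: (@integrable_bounded _ _ _ _ _ _ maxrate) => //.
  by apply: measurable_funTS; exact: measurable_stepf.
by move=> x _; exact: srate_bound.
Qed.

Lemma int_srate n k : (k <= nsteps n)%N ->
  (\int[mu]_(u in `[0%R, (k%:R * mesh R n)%R[) srate n u)%R =
  mesh R n * \sum_(i < k) c (z (i.+1%:R * mesh R n)).
Proof.
have h0 := mesh_gt0 R n.
elim: k => [|k IH] kn.
  by rewrite mul0r set_itv_ge ?bnd_simp ?ltxx// Rintegral_set0 big_ord0 mulr0.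
rewrite (@itv_bndbnd_setU _ _ _ (BLeft (k%:R * mesh R n))); last 2 first.
- by rewrite bnd_simp mulr_ge0// ltW.
- by rewrite bnd_simp ler_wpM2r ?ler_nat// ltW.
rewrite Rintegral_setU//; last 2 first.
- rewrite -itv_bndbnd_setU; first by apply: integrable_srate; exact: mu_itv_lty.
    by rewrite bnd_simp mulr_ge0// ltW.
  by rewrite bnd_simp ler_wpM2r ?ler_nat// ltW.
- by apply: lt_disjoint => x y; rewrite /= !in_itv/= => /andP[_ xa] /andP[ay _]; exact: lt_le_trans ay.
rewrite IH 1?ltnW// big_ord_recr/= mulrDr; congr (_ + _).
rewrite (@eq_Rintegral _ _ _ _ _ (fun _ => c (z (k.+1%:R * mesh R n)))); last first.
  move=> u; rewrite inE => ku; have [u0 kE] := cell_gidx ku.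
  rewrite /srate stepfE -?kE// u0/=.
  move: ku; rewrite /= in_itv/= => /andP[_ ku]; apply: (lt_le_trans ku).
  by rewrite -(nsteps_mesh R n) ler_wpM2r ?ler_nat// ltW.
rewrite Rintegral_cst//= lebesgue_measure_itv/= lte_fin ltr_pM2r// ltr_nat ltnSn/=.
by rewrite -mulrBl -natrB// subSnn mul1r mulrC.
Qed.

Definition sample_err n U : R := (\int[mu]_(u in `[0, U]) `|srate n u - c (z u)|)%R.

Lemma srate_sub_integrable n (i : interval R) : [set` i] `<=` (`[0, +oo[%classic : set R) ->
  (mu [set` i] < +oo)%E -> mu.-integrable [set` i] (EFin \o (fun u => srate n u - c (z u))).
Proof.
move=> i0 mi; have -> : EFin \o (fun u => srate n u - c (z u)) = ((EFin \o srate n) \- (EFin \o (c \o z)))%E by [].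
by apply: integrableB => //; [exact: integrable_srate|exact: integrable_path].
Qed.

Lemma sample_err_cvg0 U : 0 <= U -> sample_err ^~ U @ \oo --> 0.
Proof.
move=> U0; rewrite /sample_err.
have sub : [set` `[0, U]] `<=` (`[0, +oo[%classic : set R).
  by move=> x /=; rewrite !in_itv/= => /andP[->].
have mi := mu_itv_lty 0 U true false.
have mz : measurable_fun [set` `[0, U]] (c \o z) by apply: measurable_funS (measurable_path c).
have mF n : measurable_fun [set` `[0, U]] (fun u => `|srate n u - c (z u)|).
  apply: measurableT_comp => //; apply: measurable_funB => //.
  by apply: measurable_funTS; exact: measurable_stepf.
have m0 : measurable_fun [set` `[0, U]] (fun _ : R => 0 : R) by [].
have F0 : {ae mu, forall u, [set` `[0, U]] u -> (fun n => `|srate n u - c (z u)|) @ \oo --> (0 : R)}.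
  apply: aeW => u; rewrite /= in_itv/= => /andP[u0 _].
  apply: cvg_near_cst; near=> n.
  rewrite /srate (near (near_stepfE (fun n k => c (z (k.+1%:R * mesh R n))) u0) n)//.
  by rewrite (near (near_rpt_const u0) n)// subrr normr0.
have ig := integrable_path (fun=> maxrate + maxrate) sub mi.
have Fg n u : [set` `[0, U]] u -> `| `|srate n u - c (z u)| | <= maxrate + maxrate.
  move=> _; rewrite normr_id; apply: le_trans (ler_normB _ _) _.
  by rewrite lerD ?srate_bound ?le_maxrate.
have [_] := @Rintegral_dominated_cvg _ _ R mu _ _ _ _ (measurable_itv _) mF m0 F0 ig Fg.
by rewrite (Rintegral_cst mu (measurable_itv _) 0) mul0r.
Unshelve. all: by end_near. Qed.

Lemma dlev_lev n k U : k%:R * mesh R n <= U -> U <= n.+1%:R ->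
  `|dlev n k - lev (k%:R * mesh R n)| <= 2 * maxrate * mesh R n + sample_err n U.
Proof.
move=> kU Un; have h0 := mesh_gt0 R n.
have k0 : 0 <= k%:R * mesh R n by rewrite mulr_ge0// ltW.
have kn : (k <= nsteps n)%N.
  by rewrite -(ler_nat R) -(ler_pM2r h0) nsteps_mesh (le_trans kU).
rewrite lev_co.
have sub : [set` `[0, (k%:R * mesh R n)[] `<=` (`[0, +oo[%classic : set R).
  by move=> x /=; rewrite !in_itv/= => /andP[->].
have mi := mu_itv_lty 0 (k%:R * mesh R n) true true.
(* Moving the sampling points by one step telescopes to two boundary terms, hence the error 2
   [maxrate] times the mesh. *)
have -> : dlev n k = (\int[mu]_(u in `[0%R, (k%:R * mesh R n)%R[) srate n u)%R +
    mesh R n * (c (z 0) - c (z (k%:R * mesh R n))).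
  rewrite int_srate// -mulrDr; congr (_ * _).
  elim: k {kU k0 kn sub mi} => [|k IH]; first by rewrite !big_ord0 mul0r subrr add0r.
  by rewrite !big_ord_recr/= IH; ring.
rewrite addrAC -RintegralB//; last 2 first.
- exact: integrable_srate.
- exact: integrable_path.
rewrite addrC (le_trans (ler_normD _ _))// lerD//.
  rewrite normrM gtr0_norm// mulrC ler_wpM2r ?(ltW h0)//.
  apply: (le_trans (ler_normB _ _)).
  by have := le_maxrate (z 0); have := le_maxrate (z (k%:R * mesh R n)); lra.
apply: (le_trans (le_normr_Rintegral _ _)) => //; first exact: srate_sub_integrable.
rewrite /sample_err.
have subU : [set` `[0, U]] `<=` (`[0, +oo[%classic : set R).
  by move=> x /=; rewrite !in_itv/= => /andP[->].
apply: fine_le.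
- by apply: integrable_fin_num => //; apply: integrable_norm; exact: srate_sub_integrable.
- by apply: integrable_fin_num => //; apply: integrable_norm; apply: srate_sub_integrable => //; exact: mu_itv_lty.
apply: ge0_subset_integral => //.
- have /integrableP[/measurable_EFinP h _] := integrable_norm (srate_sub_integrable n subU (mu_itv_lty 0 U true false)).
  exact/measurable_EFinP.
- by move=> x /=; rewrite !in_itv/= => /andP[-> /ltW xk]; exact: le_trans kU.
Qed.

(** Uniform in k, because the error is controlled by a single L^1 distance on [0, U]. *)
Lemma dlev_cvg U e : 0 <= U -> 0 < e ->
  \forall n \near \oo, forall k, k%:R * mesh R n <= U -> `|dlev n k - lev (k%:R * mesh R n)| <= e.
Proof.
move=> U0 e0; have M0 := maxrate_ge0.
have M1 : 0 < 4 * (maxrate + 1) by rewrite mulr_gt0// ltr_wpDl.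
have e2 : 0 < e / 2 by exact: divr_gt0.
have /cvgrPdist_le/(_ _ e2) h := sample_err_cvg0 U0.
have eM : 0 < e / (4 * (maxrate + 1)) by exact: divr_gt0.
near=> n => k kU.
apply: (le_trans (@dlev_lev _ _ U kU _)).
  apply: (le_trans (ltW (truncnS_gt U))); rewrite ler_nat ltnS; near: n.
  exact: nbhs_infty_ge.
rewrite [leRHS](splitr e) lerD//.
  have : mesh R n < e / (4 * (maxrate + 1)) by near: n; exact: near_mesh_lt.
  rewrite ltr_pdivlMr//; have := mesh_gt0 R n; nra.
have : `|0 - sample_err n U| <= e / 2 by near: n; exact: h.
by rewrite sub0r normrN; apply: le_trans; exact: ler_norm.
Unshelve. all: by end_near. Qed.

Hypothesis c0 : forall s, c s != 0.

Definition rtime : \bar R := ereal_inf [set (t%:E)%E | t in [set t | 0 < t /\ lev t = 0]].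

Lemma lev_right t : 0 <= t -> exists2 e, 0 < e &
  forall v, t <= v <= t + e -> lev v = lev t + c (z t) * (v - t).
Proof.
move=> t0; have [e e0 ze] := zr t0; exists (e / 2); first by rewrite divr_gt0.
move=> v /andP[tv vt]; apply: lev_const; first by rewrite t0.
by move=> u /andP[tu uv]; apply: ze => //; lra.
Qed.

(** An infimum could equal t without being attained, so a zero-free margin after t is required. At t
    = 0 the level leaves 0 with nonzero slope; at t > 0 it is nonzero and Lipschitz. *)
Lemma lt_rtimeP t : 0 <= t -> (t%:E < rtime)%E <-> (forall v, 0 < v <= t -> lev v != 0).
Proof.
move=> t0; split.
  move=> tr v /andP[v0 vt]; apply/eqP => lv.
  have : (rtime <= v%:E)%E by apply: ereal_inf_lbound; exists v.
  by move=> /(lt_le_trans tr); rewrite lte_fin ltNge vt.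
move=> lv; have [e e0 le] := lev_right t0.
have [d d0 ld] : exists2 d, 0 < d & forall v, t < v <= t + d -> lev v != 0.
  have [->|tN0] := eqVneq t 0.
    have [e' e'0 le'] := lev_right (lexx 0); exists e' => // v /andP[v0 ve].
    by rewrite le' ?lev0// ?add0r ?subr0 ?mulf_neq0 ?c0 ?gt_eqF// (ltW v0)/= -[e']add0r.
  have tp : 0 < t by rewrite lt_neqAle eq_sym tN0.
  have lt0 : lev t != 0 by apply: lv; rewrite tp lexx.
  have M1 : 0 < maxrate + 1 by rewrite ltr_wpDl// maxrate_ge0.
  (* Half the time that a level moving at speed [maxrate + 1] needs to come back to 0. *)
  exists (`|lev t| / (maxrate + 1) / 2); first by rewrite !divr_gt0 ?normr_gt0.
  move=> v /andP[tv vt]; apply/eqP => lv0.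
  have := lev_lip t v; rewrite lv0 sub0r normrN [`|v - t|]ger0_norm ?subr_ge0 ?(ltW tv)//.
  have lp : 0 < `|lev t| by rewrite normr_gt0.
  have ME : (maxrate + 1) * (`|lev t| / (maxrate + 1) / 2) = `|lev t| / 2.
    by field; rewrite gt_eqF.
  have : maxrate * (v - t) <= (maxrate + 1) * (`|lev t| / (maxrate + 1) / 2).
    by apply: ler_pM; rewrite ?maxrate_ge0 ?subr_ge0 ?lerDl ?(ltW tv)//; lra.
  by rewrite ME; lra.
apply: (@lt_le_trans _ _ (t + d)%:E); first by rewrite lte_fin ltrDl.
apply: le_ereal_inf_tmp => _ [v [v0 lv0] <-]; rewrite lee_fin leNgt; apply/negP => vd.
have [vt|tv] := leP v t; first by have := lv v; rewrite v0 vt lv0 eqxx => /(_ isT).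
by have := ld v; rewrite tv (ltW vd) lv0 eqxx => /(_ isT).
Qed.

Lemma rtime_gt0 : (0 < rtime)%E.
Proof. by apply/lt_rtimeP => // v /andP[v0]; rewrite leNgt v0. Qed.

(** If the level were nonzero at the infimum r, [lt_rtimeP] would give r < [rtime]. *)
Lemma rtime_attained : (rtime < +oo)%E ->
  exists2 r, 0 < r & rtime = r%:E /\ lev r = 0.
Proof.
have := rtime_gt0; case E : rtime => [r| |]// r0 _.
exists r => //; split => //; apply/eqP/negPn/negP => lr.
suff : (r%:E < rtime)%E by rewrite E ltxx.
apply/lt_rtimeP; first exact: ltW.
move=> v /andP[v0]; rewrite le_eqVlt => /orP[/eqP ->//|vr].
apply: (proj1 (lt_rtimeP (ltW v0))); first by rewrite E lte_fin.
by rewrite v0 lexx.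
Qed.

Lemma lev_pos t v : 0 < c (z 0) -> (t%:E < rtime)%E -> 0 < v <= t -> 0 < lev v.
Proof.
move=> cz tr /andP[v0 vt].
have t0 : 0 <= t by rewrite (le_trans _ vt)// ltW.
have nz := (lt_rtimeP t0).1 tr.
have [e e0 le] := lev_right (lexx 0).
have [ve|ev] := leP v e.
  rewrite le ?lev0// ?add0r ?subr0 ?mulr_gt0// ?(ltW v0)//=.
have le0 : 0 < lev e by rewrite le ?lev0// ?add0r ?subr0 ?mulr_gt0// ?lexx ?(ltW e0).
rewrite ltNge; apply/negP => lv.
have [] := @IVT _ lev e v 0 (ltW ev) _ _.
- by apply: continuous_subspaceT; exact: continuous_lev.
- by rewrite ge_min lv orbT le_max (ltW le0).
move=> x; rewrite in_itv/= => /andP[ex xv] lx.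
by have := nz x; rewrite lx eqxx (lt_le_trans e0 ex) (le_trans xv vt) => /(_ isT).
Qed.

(** Uniform closeness to the level says nothing at small times, where the level itself is near 0.
    There the phase is still constant and the walk visibly positive; afterwards the level has a
    positive minimum, which absorbs the sampling error. *)
Lemma near_alive u : 0 < c (z 0) -> 0 <= u -> (u%:E < rtime)%E ->
  exists2 d, 0 < d & \forall n \near \oo, forall i, (0 < i)%N -> i%:R * mesh R n <= u + d -> 0 < dlev n i.
Proof.
move=> cz u0 ur.
have [u' uu' u'r] : exists2 u', u < u' & (u'%:E < rtime)%E.
  case E : rtime => [r| |] in ur *.
  - by move: ur; rewrite lte_fin => ur; exists ((u + r) / 2); rewrite ?lte_fin; lra.
  - by exists (u + 1); rewrite ?ltrDl// ltry.
  - by [].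
exists (u' - u); first by rewrite subr_gt0.
rewrite addrC subrK.
have [e e0 ze] := zr (lexx 0).
(* The time that separates the two regimes. *)
pose e' := Num.min (e / 2) u'.
have e'0 : 0 < e' by rewrite lt_min divr_gt0//= (le_lt_trans u0).
have e'u : e' <= u' by rewrite ge_min lexx orbT.
have [m me mlev] := @EVT_min _ lev e' u' e'u (continuous_subspaceT continuous_lev).
have m0 : 0 < lev m.
  apply: (lev_pos cz u'r); move: me; rewrite in_itv/= => /andP[em mu'].
  by rewrite mu' andbT (lt_le_trans e'0).
near=> n => i i0 iu.
have [ie|ei] := leP (i%:R * mesh R n) e'.
  rewrite /dlev mulr_gt0 ?mesh_gt0//.
  rewrite (eq_bigr (fun _ => c (z 0))); last first.
    move=> j _; congr c; apply: ze; first by rewrite mulr_ge0// ltW// mesh_gt0.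
    rewrite add0r.
    apply: (@lt_le_trans _ _ (i%:R * mesh R n)); first by rewrite ltr_pM2r ?mesh_gt0// ltr_nat.
    by apply: (le_trans ie); rewrite ge_min; apply/orP; left; lra.
  by rewrite sumr_const card_ord pmulrn_lgt0.
have : lev m <= lev (i%:R * mesh R n) by apply: mlev; rewrite in_itv/= ltW.
have : `|dlev n i - lev (i%:R * mesh R n)| <= lev m / 2.
  move: i iu {i0 ei}; near: n; apply: dlev_cvg; last by rewrite divr_gt0.
  by rewrite (le_trans u0)// ltW.
by rewrite ler_norml => /andP[h _]; lra.
Unshelve. all: by end_near. Qed.

(* On such paths the level crosses 0 strictly at the return time, so the sampled
   walk sees the crossing. *)
Definition no_jump_at_zero := forall u, 0 < u -> lev u = 0 ->
  exists2 e, 0 < e & forall v, `|v - u| < e -> z v = z u.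

(** Without a jump at r, the positive level just before r runs down to 0 with constant slope c (z
    r). *)
Lemma rtime_rate_neg r : no_jump_at_zero -> 0 < c (z 0) -> rtime = r%:E -> c (z r) < 0.
Proof.
move=> nj cz E; have := rtime_gt0; rewrite E lte_fin => r0.
have rlt : (rtime < +oo)%E by rewrite E ltry.
have [r' _ [E' lr]] := rtime_attained rlt.
have {E'} rr' : r' = r by apply: EFin_inj; rewrite -E'.
rewrite {}rr' {r' rlt} in lr.
have [e e0 ze] := nj _ r0 lr.
pose v := Num.max (r - e / 2) (r / 2).
have vr : v < r by rewrite gt_max; lra.
have v0 : 0 < v by rewrite lt_max; apply/orP; right; lra.
have lv : 0 < lev v by apply: (@lev_pos v) => //; rewrite ?E ?lte_fin// v0 lexx.
have := @lev_const v r (z r) _ _; rewrite (ltW v0) (ltW vr) => /(_ isT).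
move=> h; have {}h := h _; rewrite lr in h.
have zv w : v <= w < r -> z w = z r.
  move=> /andP[vw wr]; apply: ze; rewrite ltr0_norm ?subr_lt0//.
  have : r - e / 2 <= v by rewrite le_max lexx.
  by lra.
have {}h := h zv; rewrite ltNge; apply/negP => cr.
by have : 0 <= c (z r) * (r - v) by [rewrite mulr_ge0// subr_ge0 ltW]; lra.
Qed.

(** After r the level decreases linearly. The last grid point before r + d has level at most c (z r)
    d / 2 < 0, a margin that the sampling error eventually does not exceed. *)
Lemma near_dead r u : no_jump_at_zero -> 0 < c (z 0) -> rtime = r%:E -> r < u ->
  \forall n \near \oo, exists i, [/\ (0 < i)%N, i%:R * mesh R n <= u & dlev n i <= 0].
Proof.
move=> nj cz E ru; have cr := rtime_rate_neg nj cz E.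
have := rtime_gt0; rewrite E lte_fin => r0.
have rlt : (rtime < +oo)%E by rewrite E ltry.
have [r' _ [E' lr]] := rtime_attained rlt.
have {E'} rr' : r' = r by apply: EFin_inj; rewrite -E'.
rewrite {}rr' {r' rlt} in lr.
have [e e0 le] := lev_right (ltW r0).
pose d := Num.min e (u - r); have d0 : 0 < d by rewrite lt_min e0 subr_gt0.
have de : d <= e by rewrite ge_min lexx.
have du : d <= u - r by rewrite ge_min lexx orbT.
near=> n; pose i := gidx n (r + d).
have rd0 : 0 <= r + d by rewrite addr_ge0// ltW.
have /andP[i1 i2] := gidx_itv n rd0; rewrite -/i in i1 i2.
have hd : mesh R n < d / 2 by near: n; apply: near_mesh_lt; exact: divr_gt0.
have iS : (i.+1%:R * mesh R n) = i%:R * mesh R n + mesh R n by rewrite -natr1 mulrDl mul1r.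
exists i; split.
- rewrite lt0n; apply/eqP => i00; move: i2; rewrite iS i00 mul0r add0r; lra.
- by lra.
have li : lev (i%:R * mesh R n) <= c (z r) * (d / 2).
  rewrite le ?lr ?add0r; first by rewrite ler_nM2l//; lra.
  by apply/andP; split; lra.
have : `|dlev n i - lev (i%:R * mesh R n)| <= - c (z r) * (d / 2).
  move: (i) i1 {i2 iS li}; near: n; apply: dlev_cvg; first by rewrite addr_ge0// ltW.
  by rewrite mulr_gt0 ?divr_gt0// oppr_gt0.
by rewrite ler_norml mulNr => /andP[_ h]; lra.
Unshelve. all: by end_near. Qed.

End Path.

(** * Measurability in the time and the sample point, and of the return time *)

Section PathMeasurability.
Variables (R : realType) (S : finType) (c : S -> R).
Variables (d : measure_display) (Omega : measurableType d) (phi : R -> Omega -> S).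
Hypotheses (cad : cadlag_step_paths phi)
  (mphi : forall t x, 0 <= t -> measurable [set w | phi t w = x])
  (c0 : forall s, c s != 0).

Let zr w := (cad w).1.

Lemma dlev_gidx_cvg w u : 0 <= u ->
  (fun n => dlev c (phi^~ w) n (gidx n u).+1) @ \oo --> lev c (phi^~ w) u.
Proof.
move=> u0; apply/cvgrPdist_le => e e0.
have e2 : 0 < e / 2 by exact: divr_gt0.
have M1 : 0 < maxrate c + 1 by rewrite ltr_wpDl// maxrate_ge0.
have eM : 0 < e / 2 / (maxrate c + 1) by exact: divr_gt0.
have u1 : 0 <= u + 1 by rewrite addr_ge0.
have h := dlev_cvg c (zr w) u1 e2.
near=> n.
have /andP[r1 r2] := rpt_itv n u0.
have hn : mesh R n < e / 2 / (maxrate c + 1) by near: n; exact: near_mesh_lt.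
have : `|dlev c (phi^~ w) n (gidx n u).+1 - lev c (phi^~ w) (rpt n u)| <= e / 2.
  have : rpt n u <= u + 1 by apply: (le_trans r2); rewrite lerD2l mesh_le1.
  rewrite /rpt; move: (gidx n u).+1; near: n; exact: h.
have : `|lev c (phi^~ w) (rpt n u) - lev c (phi^~ w) u| <= e / 2.
  apply: (le_trans (lev_lip c (zr w) _ _)); rewrite ger0_norm ?subr_ge0 ?(ltW r1)//.
  move: hn; rewrite ltr_pdivlMr// => hn.
  have := @maxrate_ge0 _ _ c; have := mesh_gt0 R n; nra.
move=> h1 h2; rewrite distrC (splitr e).
by apply: (le_trans (ler_distD (lev c (phi^~ w) (rpt n u)) _ _)); exact: lerD.
Unshelve. all: by end_near. Qed.

Lemma measurable_phi (F : S -> R) t : 0 <= t -> measurable_fun setT (fun w => F (phi t w)).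
Proof.
move=> t0; rewrite (_ : (fun w => _) = fun w => \sum_s \1_[set w | phi t w = s] w * F s).
  apply: measurable_sum => s; apply: measurable_funM => //.
  by apply: measurable_indic; exact: mphi.
apply/funext => w; rewrite (bigD1 (phi t w))//= indicE mem_set// mul1r.
rewrite big1 ?addr0// => s sw; rewrite indicE memNset ?mul0r//= => E.
by rewrite E eqxx in sw.
Qed.

Lemma measurable_stepf2 n (b : nat -> Omega -> R) : (forall k, measurable_fun setT (b k)) ->
  measurable_fun setT (fun x : R * Omega => stepf n (fun k => b k x.2) x.1).
Proof.
move=> mb; apply: measurable_sum => k; apply: measurable_funM.
  have mc : measurable_fun setT (\1_(cell n k) : R -> R).
    by apply: measurable_indic; exact: measurable_cell.
  exact: (measurableT_comp mc measurable_fst).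
exact: (measurableT_comp (mb k) measurable_snd).
Qed.

Definition nonneg_time : set (R * Omega) := [set x | 0 <= x.1].

Lemma measurable_nonneg_time : measurable nonneg_time.
Proof.
have -> : nonneg_time = fst @^-1` (`[0, +oo[%classic : set R).
  by apply/seteqP; split => x; rewrite /nonneg_time/= in_itv/= andbT.
by rewrite -[X in measurable X]setTI; apply: measurable_fst => //; exact: measurable_itv.
Qed.

Lemma measurable_phi2 (F : S -> R) :
  measurable_fun nonneg_time (fun x => F (phi x.1 x.2)).
Proof.
apply: (@measurable_fun_lim _ _ _ _ (fun n x => stepf n (fun k => F (phi (k.+1%:R * mesh R n) x.2)) x.1)).
  move=> n; apply: measurable_funTS; apply: (@measurable_stepf2 n (fun k w => F (phi (k.+1%:R * mesh R n) w))) => k.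
  by apply: measurable_phi; rewrite mulr_ge0// ltW// mesh_gt0.
move=> [u w]; rewrite /nonneg_time/= => u0; apply: cvg_near_cst; near=> n.
rewrite (near (near_stepfE (fun n k => F (phi (k.+1%:R * mesh R n) w)) u0) n)//.
congr F; near: n; exact: (near_rpt_const (zr w)).
Unshelve. all: by end_near. Qed.

Lemma measurable_dlev n k : measurable_fun setT (fun w => dlev c (phi^~ w) n k).
Proof.
apply: measurable_funM => //; apply: measurable_sum => i; apply: measurable_phi.
by rewrite mulr_ge0// ltW// mesh_gt0.
Qed.

Lemma measurable_lev2 : measurable_fun nonneg_time (fun x => lev c (phi^~ x.2) x.1).
Proof.
apply: (@measurable_fun_lim _ _ _ _ (fun n x => stepf n (fun k => dlev c (phi^~ x.2) n k.+1) x.1)).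
  move=> n; apply: measurable_funTS; apply: (@measurable_stepf2 n (fun k w => dlev c (phi^~ w) n k.+1)) => k.
  exact: measurable_dlev.
move=> [u w]; rewrite /nonneg_time/= => u0.
have := @dlev_gidx_cvg w u u0; apply: cvg_trans; apply: near_eq_cvg; near=> n.
by rewrite (near (near_stepfE (fun n k => dlev c (phi^~ w) n k.+1) u0) n).
Unshelve. all: by end_near. Qed.

Lemma measurable_lev t : 0 <= t -> measurable_fun setT (fun w => lev c (phi^~ w) t).
Proof.
move=> t0.
have mp : measurable_fun setT (fun w : Omega => (t, w)) by apply: measurable_fun_pair.
apply: (measurable_comp measurable_nonneg_time _ measurable_lev2 mp).
by move=> _ [w _ <-].
Qed.

Let tau w : \bar R := rtime c (phi^~ w).

(** The absence of zeros in ]0, t] is an uncountable condition. By continuity it amounts to a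
    positive lower bound for the absolute level on each [t/(m+1), t], and this is testable on all
    regular subdivisions, with one bound for all of them. *)
Lemma measurable_tau_gt t : measurable [set w | (t%:E < tau w)%E].
Proof.
have [t0|t0] := ltP t 0.
  rewrite [X in measurable X](_ : _ = setT)//; apply/seteqP; split => // w _ /=.
  by apply: (lt_trans _ (rtime_gt0 (zr w) c0)); rewrite lte_fin.
have [->|tN0] := eqVneq t 0.
  rewrite [X in measurable X](_ : _ = setT)//; apply/seteqP; split => // w _ /=.
  exact: (rtime_gt0 (zr w) c0).
have tp : 0 < t by rewrite lt_neqAle eq_sym tN0.
(* The two inequalities on k say that t k / (N+1) lies in [t/(m+1), t]. *)
pose good m n N k := [set w | (N.+1 <= m.+1 * k)%N -> (k <= N.+1)%N ->
   n.+1%:R^-1 <= `|lev c (phi^~ w) (t * k%:R / N.+1%:R)|].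
rewrite [X in measurable X](_ : _ = \bigcap_m \bigcup_n \bigcap_N \bigcap_k good m n N k); last first.
  apply/seteqP; split => w /=.
    move=> tw m _.
    pose a := t / m.+1%:R.
    have a0 : 0 < a by rewrite divr_gt0.
    have at_ : a <= t by rewrite ler_pdivrMr// ler_peMr ?ler1n// ltW.
    have cl := @continuous_lev _ _ c (phi^~ w) (zr w).
    have cn : {within `[a, t], continuous (fun v => `|lev c (phi^~ w) v|)}.
      apply: continuous_subspaceT => v.
      by apply: continuous_comp; [exact: cl|exact: norm_continuous].
    have [v va vmin] := EVT_min at_ cn.
    have v0 : 0 < `|lev c (phi^~ w) v|.
      rewrite normr_gt0; apply: (lt_rtimeP (zr w) c0 t0).1 => //.
      by move: va; rewrite in_itv/= => /andP[av ->]; rewrite andbT (lt_le_trans a0).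
    (* So that 1/(n+1) is below the minimum of the absolute level on [a, t]. *)
    exists (Num.truncn (`|lev c (phi^~ w) v|^-1)) => // N _ k _ /= Nk kN.
    apply: le_trans (vmin (t * k%:R / N.+1%:R) _).
      by rewrite invf_ple ?posrE// ltW// truncnS_gt.
    rewrite in_itv/=; apply/andP; split.
      rewrite /a -mulrA ler_pM2l// ler_pdivlMr// mulrC ler_pdivrMr// mulrC -natrM ler_nat.
      exact: Nk.
    by rewrite -mulrA ler_piMr// ler_pdivrMr// mul1r ler_nat.
  move=> H; apply/(lt_rtimeP (zr w) c0 t0) => v /andP[v0 vt].
  apply/eqP => lv0.
  (* The factor 2 leaves room for the subdivision point just below the zero v to remain above
     t/(m+1). Then N is taken so large that, by the Lipschitz bound, the level at that point is
     smaller than 1/(n+1). *)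
  pose m := Num.truncn (2 * t / v).
  have [n _ Hn] := H m I.
  have M0 := @maxrate_ge0 _ _ c.
  pose N := maxn m (Num.truncn (maxrate c * t * n.+1%:R)).
  have mN : (m%:R : R) <= N%:R by rewrite ler_nat leq_maxl.
  have hN : maxrate c * t * n.+1%:R < N.+1%:R.
    by apply: lt_le_trans (truncnS_gt _) _; rewrite ler_nat ltnS leq_maxr.
  have m2 : 2 * t < m.+1%:R * v by rewrite -ltr_pdivrMr// truncnS_gt.
  pose k := Num.truncn (v / t * N.+1%:R).
  have vt1 : v / t <= 1 by rewrite ler_pdivrMr// mul1r.
  have vt0 : 0 <= v / t by rewrite divr_ge0// ltW.
  have /andP[k1 k2] : k%:R <= v / t * N.+1%:R < k.+1%:R by apply: truncn_itv; rewrite mulr_ge0.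
  have kN : (k <= N.+1)%N.
    by rewrite -(ler_nat R) (le_trans k1)// ler_piMl.
  have Nk : (N.+1 <= m.+1 * k)%N.
    rewrite -(ler_nat R) natrM.
    have : m.+1%:R * (v / t * N.+1%:R) <= m.+1%:R * (k%:R + 1) by rewrite ler_wpM2l// natr1 ltW.
    have : 2 * N.+1%:R <= m.+1%:R * (v / t * N.+1%:R).
      by rewrite mulrA ler_wpM2r// mulrA ler_pdivlMr// ltW.
    have : m.+1%:R <= (N.+1%:R : R) by rewrite ler_nat ltnS leq_maxl.
    by lra.
  have := Hn N I k I Nk kN.
  have tk : t * k%:R / N.+1%:R <= v.
    by rewrite ler_pdivrMr// -ler_pdivlMl// mulrA (mulrC _ v).
  have tk2 : v - t / N.+1%:R <= t * k%:R / N.+1%:R.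
    rewrite lerBlDr -mulrDl -{2}[t]mulr1 -mulrDr natr1 ler_pdivlMr// -ler_pdivrMl// mulrA (mulrC _ v).
    exact: ltW.
  have := @lev_lip _ _ c (phi^~ w) (zr w) v (t * k%:R / N.+1%:R).
  rewrite lv0 subr0 => h1 h2; have := le_trans h2 h1; rewrite ler0_norm ?subr_le0//.
  apply/negP; rewrite -ltNge.
  apply: (@le_lt_trans _ _ (maxrate c * (t / N.+1%:R))).
    rewrite ler_wpM2l//; move: tk2; set x := t * _ / _; set y := t / _; lra.
  by rewrite mulrA ltr_pdivrMr// [ltRHS]mulrC ltr_pdivlMr.
apply: bigcapT_measurable => m; apply: bigcupT_measurable => n.
apply: bigcapT_measurable => N; apply: bigcapT_measurable => k.
rewrite /good; have [h|h] := boolP ((N.+1 <= m.+1 * k) && (k <= N.+1))%N; last first.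
  rewrite [X in measurable X](_ : _ = setT)//; apply/seteqP; split => // w _ /= h1 h2.
  by rewrite h1 h2 in h.
rewrite [X in measurable X](_ : _ = setT `&` (fun w => n.+1%:R^-1 <= `|lev c (phi^~ w) (t * k%:R / N.+1%:R)|) @^-1` [set true]); last first.
  move/andP: h => [h1 h2]; apply/seteqP; split => w /=; first by move=> /(_ h1 h2) ->.
  by move=> [_ ->].
apply: measurable_fun_ler => //; apply: measurableT_comp => //; apply: measurable_lev.
by rewrite divr_ge0// mulr_ge0.
Qed.

Lemma measurable_tau : measurable_fun setT tau.
Proof.
apply: (measurability _ (ErealGenOInfty.measurableE R)) => // _ [_ [x ->] <-].
rewrite setTI [X in measurable X](_ : _ = [set w | (x%:E < tau w)%E]); first exact: measurable_tau_gt.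
by apply/seteqP; split => w /=; rewrite in_itv/= ?andbT.
Qed.

Lemma tau_gt0 w : (0 < tau w)%E. Proof. exact: (rtime_gt0 (zr w) c0). Qed.

Lemma measurable_phi_set l : measurable (nonneg_time `&` [set x | phi x.1 x.2 = l]).
Proof.
have -> : [set x : R * Omega | phi x.1 x.2 = l] = (fun x => (phi x.1 x.2 == l)%:R : R) @^-1` [set 1].
  apply/seteqP; split => x /=; first by move=> ->; rewrite eqxx.
  by case: eqP => // _ /eqP; rewrite eq_sym oner_eq0.
exact: (@measurable_phi2 (fun s => (s == l)%:R) measurable_nonneg_time).
Qed.

Lemma measurable_return_event l :
  measurable [set w | (tau w < +oo)%E /\ phi (fine (tau w)) w = l].
Proof.
have mp : measurable_fun setT (fun w : Omega => (fine (tau w), w)).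
  apply: measurable_fun_pair => //; apply: (measurableT_comp (@fine_measurable R setT measurableT)).
  exact: measurable_tau.
have -> : [set w | (tau w < +oo)%E /\ phi (fine (tau w)) w = l] =
   [set w | (tau w < +oo)%E] `&` (fun w : Omega => (fine (tau w), w)) @^-1` (nonneg_time `&` [set x | phi x.1 x.2 = l]).
  apply/seteqP; split => w /= [h1].
    by move=> h2; do 2 split => //; rewrite /nonneg_time/= fine_ge0// ltW// tau_gt0.
  by move=> [].
apply: measurableI.
  rewrite -[X in measurable X]setTI; apply: emeasurable_fun_infty_o => //.
  exact: measurable_tau.
by rewrite -[X in measurable X]setTI; apply: mp => //; exact: measurable_phi_set.
Qed.

Lemma measurable_lt_tau : measurable [set x : R * Omega | (x.1%:E < tau x.2)%E].
Proof.
rewrite -[X in measurable X]setTI; apply: measurable_lte => //.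
  exact: measurableT_comp.
by apply: measurableT_comp => //; exact: measurable_tau.
Qed.

Lemma measurable_eq_tau : measurable [set x : R * Omega | (x.1%:E = tau x.2)%E].
Proof.
rewrite -[X in measurable X]setTI; apply: measurable_eqe => //.
  exact: measurableT_comp.
by apply: measurableT_comp => //; exact: measurable_tau.
Qed.

End PathMeasurability.

(** * Expectations along the sampled chain *)

Section TransitionTaylor.
Variables (R : realType) (S : finType) (T : S -> S -> R).

Definition ptrans n : S -> S -> R := expm [pred _ : S | true] (fun i j => mesh R n * T i j).

Lemma ptrans_taylor : exists C, 0 <= C /\ forall n i j,
  `|ptrans n i j - (i == j)%:R - mesh R n * T i j| <= C * mesh R n ^+ 2.
Proof.
pose E (u : R) i j := expm [pred _ : S | true] (fun i j => u * T i j) i j.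
pose B := expR (mnorm T).
pose C1 := \sum_i \sum_j `|T i j|.
have B0 : 0 <= B by exact: expR_ge0.
have C10 : 0 <= C1 by rewrite sumr_ge0// => *; rewrite sumr_ge0.
have sumT (F : S -> R) j b : 0 <= b -> (forall l, `|F l| <= b) -> `|\sum_l F l * T l j| <= b * C1.
  move=> b0 Fb; apply: (le_trans (ler_norm_sum _ _ _)).
  rewrite /C1 mulr_sumr; apply: ler_sum => l _; rewrite normrM ler_pM//.
  by rewrite (bigD1 j)//= lerDl sumr_ge0.
have dE i j (u : R) : is_derive u (1 : R) (fun v => E v i j) (\sum_l E u i l * T l j).
  apply: is_derive_eq (is_derive_expm [pred _ : S | true] T i j u) _.
  by apply: eq_bigl => l; rewrite inE.
have Eb i j u : 0 <= u <= 1 -> `|E u i j| <= B.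
  move=> /andP[u0 u1]; apply: (le_trans (expm_bound _ _ _ _ _)).
  by rewrite ler_expR ger0_norm// ler_piMr// mnorm_ge0.
have E0 i j : E 0 i j = (i == j)%:R by exact: expm0.
have EL i j u : 0 <= u <= 1 -> `|E u i j - E 0 i j| <= B * C1 * u.
  move=> /andP[u0 u1].
  have cE : {within `[0, u], continuous (fun v => E v i j)}.
    by apply: derivable_within_continuous => x _; exact: (@ex_derive _ _ _ _ _ _ _ (dE i j x)).
  have [x] := MVT_segment u0 (fun x _ => dE i j x) cE.
  rewrite in_itv/= => /andP[x0 xu] ->; rewrite subr0 normrM (ger0_norm u0) ler_wpM2r//.
  by apply: sumT => // l; apply: Eb; rewrite x0 (le_trans xu).
exists (B * C1 * C1); split; first by rewrite !mulr_ge0.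
move=> n i j; have h0 := mesh_gt0 R n; have h1 := mesh_le1 R n.
have := @taylor1_lip _ (fun v => E v i j) (fun u => \sum_l E u i l * T l j) (B * C1 * C1) 0 (mesh R n) (dE i j).
rewrite add0r E0 [X in mesh R n * X](_ : _ = T i j); last first.
  rewrite (bigD1 i)//= E0 eqxx mul1r big1 ?addr0// => l li.
  by rewrite E0 eq_sym (negbTE li) mul0r.
apply=> x /orP[/andP[x0 xh]|/andP[hx x0]]; last first.
  by have := lt_le_trans h0 (le_trans hx x0); rewrite ltxx.
rewrite -sumrB; under eq_bigr do rewrite -mulrBl.
rewrite mulrAC; apply: sumT; first by rewrite !mulr_ge0// ltW.
move=> l; apply: (le_trans (EL _ _ _ _)); first by rewrite x0 (le_trans xh).
by rewrite ler_wpM2l ?mulr_ge0// gtr0_norm.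
Qed.

End TransitionTaylor.

Lemma Rintegral_sum d (Omega : measurableType d) (R : realType)
  (mu : {measure set Omega -> \bar R}) (I : Type) (r : seq I) (Q : pred I) (f : I -> Omega -> R) :
  (forall i, mu.-integrable setT (EFin \o f i)) ->
  (\int[mu]_w (\sum_(i <- r | Q i) f i w) = \sum_(i <- r | Q i) \int[mu]_w f i w)%R.
Proof.
move=> fi; elim: r => [|i r IH].
  under eq_Rintegral do rewrite big_nil.
  by rewrite big_nil Rintegral_cst// mul0r.
rewrite big_cons -IH.
under eq_Rintegral do rewrite big_cons.
case: (Q i) => //; rewrite RintegralD//.
rewrite [X in _.-integrable _ X](_ : _ = (fun w => \sum_(i <- r | Q i) (EFin \o f i) w)%E).
  by apply: integrable_sum.
by apply/funext => w; rewrite /= sumEFin.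
Qed.

Section FiniteExpectation.
Context d (Omega : measurableType d) (R : realType) (P : probability Omega R).

Lemma Rintegral_indic (A : set Omega) : measurable A ->
  (\int[P]_w (\1_A w : R) = fine (P A))%R.
Proof. by move=> mA; rewrite /Rintegral integral_indic// setIT. Qed.

Lemma prob_integrable (f : Omega -> R) B : measurable_fun setT f ->
  (forall w, `|f w| <= B) -> P.-integrable setT (EFin \o f).
Proof.
move=> mf fB; apply: (@integrable_bounded _ _ _ P _ _ B) => //.
by apply: (le_lt_trans (probability_le1 _ _)); rewrite ?ltry.
Qed.

End FiniteExpectation.

(** * The Markov property along the grid *)

Section MarkovStep.
Variables (R : realType) (S : finType) (T : S -> S -> R).
Variables (d : measure_display) (Omega : measurableType d) (phi : R -> Omega -> S).
Variables (s : S) (P : probability Omega R).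
Hypothesis mc : markov_chain_from T s P phi.

Definition gpath n (w : Omega) : nat -> S := fun k => phi (k%:R * mesh R n) w.

Lemma grid_ge0 n k : 0 <= k%:R * mesh R n.
Proof. by rewrite mulr_ge0// ltW// mesh_gt0. Qed.

Definition cylinder n k (x : nat -> S) : set Omega :=
  [set w | forall i : 'I_k.+1, gpath n w i = x i].

Lemma measurable_cylinder n k x : measurable (cylinder n k x).
Proof.
rewrite (_ : cylinder n k x = \bigcap_(i in [set i | (i <= k)%N]) [set w | gpath n w i = x i]).
  apply: bigcap_measurable => [|i _]; first by exists 0%N.
  by apply: mc.1; exact: grid_ge0.
apply/seteqP; split => w /=; first by move=> h i /= ik; exact: (h (Ordinal (ik : (i < k.+1)%N))).
by move=> h i; apply: h => /=; rewrite -ltnS.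
Qed.

Lemma cylinder_prob n k x : P (cylinder n k x) =
  ((x 0%N == s)%:R * \prod_(i < k) ptrans T n (x i) (x i.+1))%:E.
Proof.
have := mc.2 k (fun i => i%:R * mesh R n) (fun i => x i).
rewrite /= mul0r => -> //.
  congr (_ * _)%:E; apply: eq_bigr => i _; rewrite /ptrans.
  rewrite /bump/= add1n; congr (expm _ _ (x i) (x i.+1)).
  by apply/funext => a; apply/funext => b; rewrite -mulrBl -natrB// subSnn mul1r.
by move=> i; rewrite ler_wpM2r ?ler_nat /bump/= ?add1n// ltW// mesh_gt0.
Qed.

Lemma cylinderS n k x l :
  P (cylinder n k x `&` [set w | gpath n w k.+1 = l]) =
  ((fine (P (cylinder n k x))) * ptrans T n (x k) l)%:E.
Proof.
pose y i := if (i <= k)%N then x i else l.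
rewrite [X in P X](_ : _ = cylinder n k.+1 y).
  rewrite !cylinder_prob big_ord_recr/= /y leqnn ltnn /= mulrA.
  by congr (_ * _ * _)%:E; apply: eq_bigr => i _; rewrite (ltnW (ltn_ord i)) ltn_ord.
apply/seteqP; split => w.
  move=> [h1 /= h2] i; rewrite /y; case: ifPn => ik.
    exact: (h1 (Ordinal (ik : (i < k.+1)%N))).
  by have -> : i = k.+1 :> nat by apply/eqP; rewrite eqn_leq -ltnS ltn_ord/= ltnNge.
move=> h; split.
  move=> i; have := h (widen_ord (leqnSn _) i); rewrite /y/=.
  by rewrite -ltnS ltn_ord.
by have := h ord_max; rewrite /y/= ltnn.
Qed.

(** Takes the place of measurability with respect to a filtration. As [S] is finite, such an F is a
    finite combination of cylinder indicators along the grid, hence measurable and bounded. *)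
Definition adapted k (F : (nat -> S) -> R) :=
  forall z z', (forall i, (i <= k)%N -> z i = z' i) -> F z = F z'.

(** Beyond k, [inord] falls back to index 0; functionals adapted to k do not see this. *)
Definition prefix k (x : {ffun 'I_k.+1 -> S}) : nat -> S := fun i => x (inord i).

Lemma adapted_decomp n k F w : adapted k F ->
  F (gpath n w) = \sum_(x : {ffun 'I_k.+1 -> S}) F (prefix x) * \1_(cylinder n k (prefix x)) w.
Proof.
move=> aF; pose x0 := [ffun i : 'I_k.+1 => gpath n w i].
rewrite (bigD1 x0)//= indicE mem_set ?mulr1; last first.
  by move=> i; rewrite /prefix ffunE inord_val.
rewrite big1 ?addr0.
  by apply: aF => i ik; rewrite /prefix ffunE inordK.
move=> x xx0; rewrite indicE memNset ?mulr0// => h.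
move/eqP: xx0; apply; apply/ffunP => i; rewrite ffunE.
by have := h i; rewrite /prefix inord_val.
Qed.

Lemma adapted_measurable n k F : adapted k F -> measurable_fun setT (fun w => F (gpath n w)).
Proof.
move=> aF; rewrite (_ : (fun w => _) = fun w =>
  \sum_(x : {ffun 'I_k.+1 -> S}) F (prefix x) * \1_(cylinder n k (prefix x)) w).
  apply: measurable_sum => x; apply: measurable_funM => //.
  by apply: measurable_indic; exact: measurable_cylinder.
by apply/funext => w; exact: adapted_decomp.
Qed.

Lemma adapted_bounded k F : adapted k F -> exists B, forall z, `|F z| <= B.
Proof.
move=> aF; exists (\sum_(x : {ffun 'I_k.+1 -> S}) `|F (prefix x)|) => z.
pose x0 := [ffun i : 'I_k.+1 => z i].
rewrite (bigD1 x0)//= (aF z (prefix x0)) ?lerDl ?sumr_ge0// => i ik.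
by rewrite /prefix ffunE inordK.
Qed.

Lemma adapted_integrable n k F : adapted k F -> P.-integrable setT (EFin \o (fun w => F (gpath n w))).
Proof.
move=> aF; have [B FB] := adapted_bounded aF.
by apply: (@prob_integrable _ _ _ _ _ B); [exact: adapted_measurable aF|move=> w].
Qed.

Definition Ex n (F : (nat -> S) -> R) : R := (\int[P]_w F (gpath n w))%R.

Lemma adapted_leq k k' F : (k <= k')%N -> adapted k F -> adapted k' F.
Proof. by move=> kk aF z z' zz; apply: aF => i ik; apply: zz; exact: leq_trans kk. Qed.

(** Conditioning on the past, written as an equality of expectations: F is expanded over the words
    of length k+1, and [cylinderS] is applied to each. *)
Lemma markov_step n k F l : adapted k F ->
  Ex n (fun z => F z * (z k.+1 == l)%:R) = Ex n (fun z => F z * ptrans T n (z k) l).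
Proof.
move=> aF; rewrite /Ex.
have sumI (A : {ffun 'I_k.+1 -> S} -> set Omega) (a : {ffun 'I_k.+1 -> S} -> R) : (forall x, measurable (A x)) ->
    (\int[P]_w (\sum_x a x * \1_(A x) w) = \sum_x a x * fine (P (A x)))%R.
  move=> mA; have ii x : P.-integrable setT (EFin \o (\1_(A x) : Omega -> R)).
    by apply: (@prob_integrable _ _ _ _ _ 1) => // w; rewrite indicE normr_nat lern1 leq_b1.
  rewrite Rintegral_sum.
    by apply: eq_bigr => x _; rewrite RintegralZl// Rintegral_indic.
  by move=> x; rewrite (_ : EFin \o _ = (fun w => (a x)%:E * (EFin \o \1_(A x)) w)%E)//; apply: integrableZl.
transitivity (\sum_(x : {ffun 'I_k.+1 -> S}) F (prefix x) *
     fine (P (cylinder n k (prefix x) `&` [set w | gpath n w k.+1 = l]))).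
  rewrite -sumI; last first.
    move=> x; apply: measurableI; first exact: measurable_cylinder.
    by apply: mc.1; exact: grid_ge0.
  apply: eq_Rintegral => w _; rewrite (adapted_decomp n w aF) mulr_suml.
  apply: eq_bigr => x _; rewrite indicI/= -mulrA; congr (_ * (_ * _)).
  by rewrite indicE; congr (nat_of_bool _)%:R; apply/eqP/idP; [move=> h; rewrite inE|rewrite inE].
have aG : adapted k (fun z => F z * ptrans T n (z k) l).
  by move=> z z' zz; rewrite (aF z z' zz) (zz k (leqnn k)).
transitivity (\sum_(x : {ffun 'I_k.+1 -> S}) (F (prefix x) * ptrans T n (prefix x k) l) *
     fine (P (cylinder n k (prefix x)))).
  by apply: eq_bigr => x _; rewrite cylinderS/=; ring.
rewrite -sumI; last by move=> x; exact: measurable_cylinder.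
by apply: eq_Rintegral => w _; rewrite (adapted_decomp n w aG).
Qed.

Lemma ExD n k F G : adapted k F -> adapted k G -> Ex n (fun z => F z + G z) = Ex n F + Ex n G.
Proof. by move=> aF aG; rewrite /Ex RintegralD//; apply: adapted_integrable; eassumption. Qed.

Lemma ExZ n k a F : adapted k F -> Ex n (fun z => a * F z) = a * Ex n F.
Proof. by move=> aF; rewrite /Ex RintegralZl//; apply: adapted_integrable; eassumption. Qed.

Lemma ExB n k F G : adapted k F -> adapted k G -> Ex n (fun z => F z - G z) = Ex n F - Ex n G.
Proof. by move=> aF aG; rewrite /Ex RintegralB//; apply: adapted_integrable; eassumption. Qed.

Lemma Ex_sum n k (I : Type) (r : seq I) (Q : pred I) (F : I -> (nat -> S) -> R) :
  (forall i, adapted k (F i)) ->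
  Ex n (fun z => \sum_(i <- r | Q i) F i z) = \sum_(i <- r | Q i) Ex n (F i).
Proof.
by move=> aF; rewrite /Ex Rintegral_sum// => i; apply: adapted_integrable; exact: aF.
Qed.

Lemma Ex_le n k F G : adapted k F -> adapted k G -> (forall z, F z <= G z) -> Ex n F <= Ex n G.
Proof.
move=> aF aG FG; apply: le_Rintegral => //; apply: adapted_integrable; eassumption.
Qed.

Lemma Ex_norm n k F B : adapted k F -> (forall z, `|F z| <= B) -> `|Ex n F| <= B.
Proof.
move=> aF FB; have PT : (\int[P]_w B = B)%R by rewrite Rintegral_cst// [X in fine X](@probability_setT _ _ _ P) mulr1.
apply: (le_trans (le_normr_Rintegral _ _)) => //; first exact: adapted_integrable aF.
rewrite -[leRHS]PT; apply: le_Rintegral => //.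
  apply: integrable_norm; exact: adapted_integrable aF.
by apply: (@prob_integrable _ _ _ _ _ `|B|).
Qed.

End MarkovStep.

(** * The discrete Dynkin formula *)

Section DiscreteDynkin.
Variables (R : realType) (S : finType) (T : S -> S -> R) (c : S -> R).
Variables (d : measure_display) (Omega : measurableType d) (phi : R -> Omega -> S).
Variables (s : S) (P : probability Omega R).
Hypothesis mc : markov_chain_from T s P phi.
Variables (q : R) (q0 : 0 < q).

Definition walk n (z : nat -> S) k : R := mesh R n * \sum_(i < k) c (z i).

Definition disc n : R := expR (- (q * mesh R n)).

(* Level 0 at step 0 is not tested, so that a walk may start on the killing set. *)
Fixpoint alive (kill : R -> bool) n (z : nat -> S) k : bool :=
  if k is k'.+1 then alive kill n z k' && ~~ kill (walk n z k) else true.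

Notation Ex := (@Ex R S d Omega phi P).

Lemma walkS n z k : walk n z k.+1 = walk n z k + mesh R n * c (z k).
Proof. by rewrite /walk big_ord_recr/= mulrDr. Qed.

Lemma walk0 n z : walk n z 0 = 0. Proof. by rewrite /walk big_ord0 mulr0. Qed.

Lemma walk_adapted n k (z z' : nat -> S) : (forall i, (i <= k)%N -> z i = z' i) ->
  forall k', (k' <= k.+1)%N -> walk n z k' = walk n z' k'.
Proof.
move=> zz k' kk; rewrite /walk; congr (_ * _); apply: eq_bigr => i _.
by rewrite zz// -ltnS (leq_trans _ kk).
Qed.

Lemma alive_adapted kill n k (z z' : nat -> S) : (forall i, (i <= k)%N -> z i = z' i) ->
  forall k', (k' <= k.+1)%N -> alive kill n z k' = alive kill n z' k'.
Proof.
move=> zz; elim=> [//|k' IH] kk /=.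
by rewrite IH 1?ltnW// (walk_adapted n zz).
Qed.

Lemma disc_gt0 n : 0 < disc n. Proof. exact: expR_gt0. Qed.

Lemma disc_le1 n : disc n <= 1.
Proof. by rewrite -[leRHS]expR0 ler_expR oppr_le0 mulr_ge0// ltW// mesh_gt0. Qed.

Lemma discX n k : disc n ^+ k = expR (- (q * (k%:R * mesh R n))).
Proof. by rewrite /disc -expRM_natl; congr expR; ring. Qed.

Lemma disc_upper n : disc n * (1 + q * mesh R n) <= 1.
Proof.
rewrite /disc expRN mulrC ler_pdivrMr ?expR_gt0// mul1r.
exact: expR_ge1Dx.
Qed.

Lemma disc_lower n : 1 - q * mesh R n <= disc n.
Proof. exact: expR_ge1Dx. Qed.

(** With x = q mesh, 1 - x <= exp(-x) <= 1/(1+x), and the upper bound exceeds the lower by at most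
    x^2. *)
Lemma disc_taylor n : `|disc n - 1 + q * mesh R n| <= q ^+ 2 * mesh R n ^+ 2.
Proof.
have h0 := mesh_gt0 R n; have b0 := disc_gt0 n; have b1 := disc_le1 n.
have := disc_upper n; have := disc_lower n => h1 h2.
have qh : 0 < q * mesh R n by rewrite mulr_gt0.
rewrite ger0_norm; last lra.
by rewrite -exprMn; nra.
Qed.

(** Discrete counterpart of the integral 1/q of exp(-qu), uniform in n and N: mesh / (1 - disc) is
    at most (1 + q mesh)/q, and the mesh is at most 1. *)
Lemma disc_geometric n N : mesh R n * \sum_(k < N) disc n ^+ k <= (1 + q) / q.
Proof.
have h0 := mesh_gt0 R n; have h1 := mesh_le1 R n; have b0 := disc_gt0 n; have b1 := disc_le1 n.
have E : (1 - disc n) * \sum_(k < N) disc n ^+ k = 1 - disc n ^+ N.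
  have := subrX1 (disc n) N; lra.
have := disc_upper n => h2.
set sg := \sum_(k < N) _ in E *.
have sg0 : 0 <= sg by apply: sumr_ge0 => k _; rewrite exprn_ge0// ltW.
have bN : 0 <= disc n ^+ N by rewrite exprn_ge0// ltW.
have h3 : q * mesh R n * disc n <= 1 - disc n by lra.
have h4 : (1 + q * mesh R n) * (1 - disc n) >= q * mesh R n by lra.
rewrite ler_pdivlMr//.
have qh : 0 < q * mesh R n by rewrite mulr_gt0.
have h5 : q * mesh R n * sg <= (1 + q * mesh R n) * (1 - disc n) * sg by rewrite ler_wpM2r.
have : (1 + q * mesh R n) * ((1 - disc n) * sg) <= (1 + q * mesh R n) * 1.
  by rewrite E; apply: ler_wpM2l; lra.
have : q * mesh R n <= q by rewrite ler_piMr// ltW.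
by nra.
Qed.

(** Summation by parts: increments are collected up to and including the killing step. What is left
    is the value of a survivor, the value at killing and the initial value. *)
Lemma telescoping kill n (f : R -> S -> R) z N :
  \sum_(k < N) (alive kill n z k)%:R *
     (disc n ^+ k.+1 * f (walk n z k.+1) (z k.+1) - disc n ^+ k * f (walk n z k) (z k)) =
  disc n ^+ N * (alive kill n z N)%:R * f (walk n z N) (z N) +
  \sum_(k < N) ((alive kill n z k)%:R - (alive kill n z k.+1)%:R) *
     (disc n ^+ k.+1 * f (walk n z k.+1) (z k.+1)) - f 0 (z 0%N).
Proof.
elim: N => [|N IH]; first by rewrite !big_ord0 expr0 walk0 !mul1r addr0 subrr.
by rewrite !big_ord_recr IH/=; ring.
Qed.

(** The discounted generator, with g in the place of the level derivative of f. *)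
Definition gen_apply (f g : R -> S -> R) y j : R :=
  c j * g y j + \sum_l T j l * f y l - q * f y j.

Definition one_step n (f : R -> S -> R) y j : R :=
  disc n * (\sum_l ptrans T n j l * f (y + mesh R n * c j) l) - f y j.

(** What one step of the walk uses. The base point lies in D, but the shifted point may leave it;
    since the mesh is at most 1, no step exceeds [maxrate]. *)
Definition smooth_on (D : R -> bool) (f g : R -> S -> R) (B : R) :=
  0 <= B /\ forall y j, D y -> `|g y j| <= B /\
    forall t, `|t| <= maxrate c -> `|f (y + t) j| <= B /\
       `|f (y + t) j - f y j - t * g y j| <= B * t ^+ 2.

Lemma one_step_taylor D f g B : smooth_on D f g B -> exists C, 0 <= C /\
  forall n y j, D y -> `|one_step n f y j - mesh R n * gen_apply f g y j| <= C * mesh R n ^+ 2.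
Proof.
move=> [B0 sm].
have [CT [CT0 hT]] := ptrans_taylor T.
pose M := maxrate c; have M0 : 0 <= M by exact: maxrate_ge0.
pose K := \sum_i \sum_l `|T i l|.
have K0 : 0 <= K by rewrite sumr_ge0// => *; rewrite sumr_ge0.
have sumT (F : S -> R) j b : 0 <= b -> (forall l, `|F l| <= b) -> `|\sum_l T j l * F l| <= K * b.
  move=> b0 Fb; apply: (le_trans (ler_norm_sum _ _ _)).
  rewrite /K [X in _ <= X * _](bigD1 j)//= mulrDl mulr_suml ler_wpDr//.
    by rewrite mulr_ge0// sumr_ge0// => *; rewrite sumr_ge0.
  by apply: ler_sum => l _; rewrite normrM ler_wpM2l.
pose nS : R := #|S|%:R.
(* [a1] is the Taylor error of f along the step, [a2] the cost of freezing the level under [T], [a3]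
   the error of the transition probabilities; [a4] and [a5] bound the change of the averaged value,
   per unit of mesh, and the averaged value itself. *)
pose a1 := B * M ^+ 2; pose a2 := K * (M * B + B * M ^+ 2).
pose a3 := nS * (CT * B); pose a4 := (M * B + B * M ^+ 2) + K * B + a3.
pose a5 := B + a4.
exists (a1 + a2 + a3 + q * a4 + q ^+ 2 * a5).
have nS0 : 0 <= nS by rewrite ler0n.
have a10 : 0 <= a1 by rewrite mulr_ge0// sqr_ge0.
have MB0 : 0 <= M * B by rewrite mulr_ge0.
have a20 : 0 <= a2 by rewrite mulr_ge0// addr_ge0.
have a30 : 0 <= a3 by rewrite !mulr_ge0.
have a40 : 0 <= a4 by rewrite !addr_ge0 ?mulr_ge0.
have a50 : 0 <= a5 by rewrite addr_ge0.
have q0' : 0 <= q by exact: ltW.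
have qa4 : 0 <= q * a4 by exact: mulr_ge0.
have qa5 : 0 <= q ^+ 2 * a5 by rewrite mulr_ge0// sqr_ge0.
have BM20 : 0 <= B * M ^+ 2 by exact: a10.
split; first by rewrite !addr_ge0.
move=> n y j Dy; rewrite /one_step /gen_apply.
set h := mesh R n; have h0 : 0 < h by exact: mesh_gt0.
have h1 : h <= 1 by exact: mesh_le1.
pose t := h * c j.
have tM : `|t| <= h * M by rewrite normrM gtr0_norm// ler_wpM2l ?(ltW h0)// le_maxrate.
have tM1 : `|t| <= M by apply: (le_trans tM); rewrite ler_piMl.
have t2 : t ^+ 2 <= h ^+ 2 * M ^+ 2.
  by rewrite -exprMn -(real_normK (num_real t)) lerXn2r ?nnegrE// mulr_ge0// ltW.
have Fb l : `|f (y + t) l| <= B by have [_ /(_ t tM1)[]] := sm y l Dy.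
have fb l : `|f y l| <= B.
  by have [_ /(_ 0)] := sm y l Dy; rewrite normr0 addr0 => /(_ M0)[].
have gb l : `|g y l| <= B by have [] := sm y l Dy.
have rb l : `|f (y + t) l - f y l - t * g y l| <= a1 * h ^+ 2.
  have [_ /(_ t tM1)[_ H]] := sm y l Dy; apply: (le_trans H).
  by rewrite /a1 -mulrA ler_wpM2l// mulrC.
have db l : `|f (y + t) l - f y l| <= (M * B + B * M ^+ 2) * h.
  rewrite -[X in `|X|](subrK (t * g y l)); apply: (le_trans (ler_normD _ _)).
  have : `|t * g y l| <= h * M * B by rewrite normrM ler_pM.
  have : a1 * h ^+ 2 <= a1 * h by rewrite expr2 mulrA ler_piMr// mulr_ge0// ltW.
  by have := rb l; rewrite /a1; lra.
pose sE := \sum_l (ptrans T n j l - (j == l)%:R - h * T j l) * f (y + t) l.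
have sEb : `|sE| <= a3 * h ^+ 2.
  apply: (le_trans (ler_norm_sum _ _ _)).
  apply: (@le_trans _ _ (\sum_(l : S) CT * h ^+ 2 * B)).
    by apply: ler_sum => l _; rewrite normrM ler_pM// hT.
  by rewrite sumr_const -mulr_natl /a3 /nS cardT; lra.
pose sT := \sum_l T j l * f (y + t) l; pose sf := \sum_l T j l * f y l.
have sTf : `|sT - sf| <= a2 * h.
  rewrite /sT /sf -sumrB; under eq_bigr do rewrite -mulrBr.
  by rewrite /a2 -mulrA; apply: sumT => //; rewrite mulr_ge0 ?addr_ge0// ltW.
have sTb : `|sT| <= K * B by apply: sumT.
set sp := \sum_l ptrans T n j l * f (y + t) l.
have spE : sp = f (y + t) j + h * sT + sE.
  have -> : f (y + t) j = \sum_l (j == l)%:R * f (y + t) l.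
    by rewrite (bigD1 j)//= eqxx mul1r big1 ?addr0// => l lj; rewrite eq_sym (negbTE lj) mul0r.
  by rewrite /sp /sT /sE mulr_sumr -!big_split/=; apply: eq_bigr => l _; ring.
have spf : `|sp - f y j| <= a4 * h.
  rewrite spE (_ : _ - _ = (f (y + t) j - f y j) + h * sT + sE); last by ring.
  apply: (le_trans (ler_normD _ _)).
  apply: (@le_trans _ _ (`|f (y + t) j - f y j| + `|h * sT| + `|sE|)).
    by rewrite lerD2r ler_normD.
  have : `|h * sT| <= h * (K * B) by rewrite normrM gtr0_norm// ler_wpM2l// ltW.
  have : a3 * h ^+ 2 <= a3 * h by rewrite expr2 mulrA ler_piMr// mulr_ge0// ltW.
  by have := db j; rewrite /a4; lra.
have spb : `|sp| <= a5.
  rewrite -[X in `|X|](subrK (f y j)); apply: (le_trans (ler_normD _ _)).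
  have : a4 * h <= a4 by rewrite ler_piMr.
  by have := fb j; rewrite /a5; lra.
have bt := disc_taylor n; rewrite -/h in bt.
(* Five errors of order h^2, the last two coming from the discount. *)
rewrite -/t -/sf (_ : _ - _ = (f (y + t) j - f y j - t * g y j) + h * (sT - sf) + sE
   - q * h * (sp - f y j) + (disc n - 1 + q * h) * sp); last by rewrite /t spE; ring.
have n1 : `|h * (sT - sf)| <= a2 * h ^+ 2.
  by rewrite normrM gtr0_norm// expr2 mulrA [a2 * h]mulrC -mulrA ler_wpM2l ?(ltW h0)//; rewrite mulrC in sTf *; rewrite mulrC.
have n2 : `|q * h * (sp - f y j)| <= q * a4 * h ^+ 2.
  rewrite normrM gtr0_norm ?mulr_gt0//.
  rewrite (_ : q * a4 * h ^+ 2 = q * h * (a4 * h)); last by ring.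
  by rewrite ler_wpM2l// ltW// mulr_gt0.
have n3 : `|(disc n - 1 + q * h) * sp| <= q ^+ 2 * a5 * h ^+ 2.
  by rewrite normrM mulrAC ler_pM.
have sum5 (a b e u v k1 k2 k3 k4 k5 : R) : `|a| <= k1 -> `|b| <= k2 -> `|e| <= k3 ->
    `|u| <= k4 -> `|v| <= k5 -> `|a + b + e - u + v| <= k1 + k2 + k3 + k4 + k5.
  move=> ha hb he hu hv; apply: (le_trans (ler_normD _ _)); apply: lerD => //.
  apply: (le_trans (ler_normB _ _)); apply: lerD => //.
  apply: (le_trans (ler_normD _ _)); apply: lerD => //.
  by apply: (le_trans (ler_normD _ _)); exact: lerD.
have -> : (a1 + a2 + a3 + q * a4 + q ^+ 2 * a5) * h ^+ 2 =
   a1 * h ^+ 2 + a2 * h ^+ 2 + a3 * h ^+ 2 + q * a4 * h ^+ 2 + q ^+ 2 * a5 * h ^+ 2 by ring.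
exact: sum5.
Qed.

End DiscreteDynkin.

Section DynkinSum.
Variables (R : realType) (S : finType) (T : S -> S -> R) (c : S -> R).
Variables (d : measure_display) (Omega : measurableType d) (phi : R -> Omega -> S).
Variables (s : S) (P : probability Omega R).
Hypothesis mc : markov_chain_from T s P phi.
Variables (q : R) (q0 : 0 < q).

Notation Ex := (@Ex R S d Omega phi P).
Notation walk := (walk c).
Notation alive := (alive c).

Lemma adapted_state kill n k (G : bool -> R -> S -> R) :
  adapted k (fun z => G (alive kill n z k) (walk n z k) (z k)).
Proof.
move=> z z' zz; rewrite (alive_adapted c kill n zz) ?leqnSn//.
by rewrite (walk_adapted c n zz) ?leqnSn// (zz k).
Qed.

Lemma adapted_step kill n k (G : bool -> bool -> R -> R -> S -> S -> R) :
  adapted k.+1 (fun z => G (alive kill n z k) (alive kill n z k.+1)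
    (walk n z k) (walk n z k.+1) (z k) (z k.+1)).
Proof.
move=> z z' zz; have k2 : (k <= k.+2)%N by apply: leqW; exact: leqnSn.
rewrite (alive_adapted c kill n zz k2) (alive_adapted c kill n zz (leqnSn _)).
rewrite (walk_adapted c n zz k2) (walk_adapted c n zz (leqnSn _)).
by rewrite (zz k (leqnSn _)) (zz k.+1 (leqnn _)).
Qed.

(** The level at step k+1 is already determined by the state at step k, so only the next phase has
    to be averaged. *)
Lemma Ex_step kill n k (f : R -> S -> R) :
  Ex n (fun z => (alive kill n z k)%:R *
     (disc q n ^+ k.+1 * f (walk n z k.+1) (z k.+1) - disc q n ^+ k * f (walk n z k) (z k))) =
  disc q n ^+ k * Ex n (fun z => (alive kill n z k)%:R * one_step T c q n f (walk n z k) (z k)).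
Proof.
pose F l z : R := disc q n ^+ k.+1 * ((alive kill n z k)%:R * f (walk n z k + mesh R n * c (z k)) l).
have aF l : adapted k (F l).
  exact: (@adapted_state kill n k (fun a x j => disc q n ^+ k.+1 * (a%:R * f (x + mesh R n * c j) l))).
pose G z : R := disc q n ^+ k * ((alive kill n z k)%:R * f (walk n z k) (z k)).
have aG : adapted k G.
  exact: (@adapted_state kill n k (fun a x j => disc q n ^+ k * (a%:R * f x j))).
have aF1 l : adapted k.+1 (fun z => F l z * (z k.+1 == l)%:R).
  move=> z z' zz; rewrite (zz k.+1)//; congr (_ * _).
  by apply: aF => i ik; apply: zz; exact: leq_trans (leqnSn k).
transitivity (Ex n (fun z => \sum_l F l z * (z k.+1 == l)%:R - G z)).
  congr (Ex n _); apply/funext => z; rewrite (bigD1 (z k.+1))//= eqxx mulr1 big1 ?addr0.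
    by rewrite /F /G walkS; ring.
  by move=> l lz; rewrite eq_sym (negbTE lz) mulr0.
rewrite (@ExB _ _ _ _ _ _ _ _ mc n k.+1 _ _); last 2 first.
- by move=> z z' zz; apply: eq_bigr => l _; exact: aF1.
- exact: adapted_leq aG.
rewrite (@Ex_sum _ _ _ _ _ _ _ _ mc n _ _ _ _ _ aF1).
under eq_bigr do rewrite (@markov_step _ _ _ _ _ _ _ _ mc n k _ _ (aF _)).
rewrite -(@Ex_sum _ _ _ _ _ _ _ _ mc n k _ _ _ _); last first.
  by move=> l z z' zz; rewrite (aF l z z' zz) (zz k).
rewrite -(@ExB _ _ _ _ _ _ _ _ mc n k _ _)//; last first.
  by move=> z z' zz; apply: eq_bigr => l _; rewrite (aF l z z' zz) (zz k).
rewrite -(@ExZ _ _ _ _ _ _ _ _ mc n k _ _); last first.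
  exact: (@adapted_state kill n k (fun a x j => a%:R * one_step T c q n f x j)).
congr (Ex n _); apply/funext => z; rewrite /F /G /one_step exprS.
rewrite (eq_bigr (fun l => disc q n ^+ k * (alive kill n z k)%:R * disc q n * (ptrans T n (z k) l * f (walk n z k + mesh R n * c (z k)) l))).
  by rewrite -mulr_sumr; ring.
by move=> l _; ring.
Qed.

Lemma alive_walk kill n z k : alive kill n z k ->
  (walk n z k == 0) || ~~ kill (walk n z k).
Proof. by case: k => [|k] /=; [rewrite walk0 eqxx|move=> /andP[_ ->]; rewrite orbT]. Qed.

(** The discount turns the errors of order mesh^2 of all steps into a total of order mesh, uniformly
    in N. The domain is where a living walk can be: off the killing set, or at its untested
    start. *)
Lemma dynkin_discrete kill f g B :
  smooth_on c (fun y => (y == 0) || ~~ kill y) f g B -> exists C, 0 <= C /\ forall n N,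
  `|Ex n (fun z => disc q n ^+ N * (alive kill n z N)%:R * f (walk n z N) (z N) +
      \sum_(k < N) ((alive kill n z k)%:R - (alive kill n z k.+1)%:R) *
     (disc q n ^+ k.+1 * f (walk n z k.+1) (z k.+1)) - f 0 (z 0%N)) -
    mesh R n * \sum_(k < N) disc q n ^+ k *
      Ex n (fun z => (alive kill n z k)%:R * gen_apply T c q f g (walk n z k) (z k))|
  <= C * mesh R n.
Proof.
move=> sm; have [C [C0 hC]] := one_step_taylor T q0 sm.
exists (C * ((1 + q) / q)); split; first by rewrite mulr_ge0// divr_ge0// ?addr_ge0// ltW.
move=> n N; have h0 := mesh_gt0 R n.
rewrite (_ : (fun z => _) = fun z => \sum_(k < N) (alive kill n z k)%:R *
     (disc q n ^+ k.+1 * f (walk n z k.+1) (z k.+1) - disc q n ^+ k * f (walk n z k) (z k))); last first.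
  by apply/funext => z; rewrite telescoping.
pose F (k : 'I_N) (z : nat -> S) : R := (alive kill n z k)%:R *
     (disc q n ^+ k.+1 * f (walk n z k.+1) (z k.+1) - disc q n ^+ k * f (walk n z k) (z k)).
rewrite (@Ex_sum _ _ _ _ _ _ _ _ mc n N _ _ _ F); last first.
  move=> k; apply: (@adapted_leq _ _ k.+1 N (F k) (ltn_ord k)).
  exact: (@adapted_step kill n k (fun a _ x x' j j' => a%:R *
     (disc q n ^+ k.+1 * f x' j' - disc q n ^+ k * f x j))).
under eq_bigr do rewrite Ex_step.
rewrite mulr_sumr -sumrB.
rewrite (eq_bigr (fun k : 'I_N => disc q n ^+ k * Ex n (fun z => (alive kill n z k)%:R *
   (one_step T c q n f (walk n z k) (z k) - mesh R n * gen_apply T c q f g (walk n z k) (z k))))); last first.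
  move=> k _; rewrite mulrCA -mulrBr.
  rewrite -(@ExZ _ _ _ _ _ _ _ _ mc n k (mesh R n)
     (fun z => (alive kill n z k)%:R * gen_apply T c q f g (walk n z k) (z k))); last first.
    exact: (@adapted_state kill n k (fun a x j => a%:R * gen_apply T c q f g x j)).
  rewrite -(@ExB _ _ _ _ _ _ _ _ mc n k _ _); last 2 first.
  - exact: (@adapted_state kill n k (fun a x j => a%:R * one_step T c q n f x j)).
  - exact: (@adapted_state kill n k (fun a x j => mesh R n * (a%:R * gen_apply T c q f g x j))).
  congr (_ * _); congr (Ex n _); apply/funext => z; ring.
apply: (le_trans (ler_norm_sum _ _ _)).
apply: (@le_trans _ _ (\sum_(k < N) disc q n ^+ k * (C * mesh R n ^+ 2))).
  apply: ler_sum => k _; rewrite normrM ger0_norm ?exprn_ge0 ?(ltW (disc_gt0 q n))//.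
  rewrite ler_wpM2l ?exprn_ge0 ?(ltW (disc_gt0 q n))//.
  apply: (@Ex_norm _ _ _ _ _ _ _ _ mc n k).
    exact: (@adapted_state kill n k (fun a x j => a%:R * (one_step T c q n f x j - mesh R n * gen_apply T c q f g x j))).
  move=> z; rewrite normrM; case: (boolP (alive kill n z k)) => al.
    by rewrite normr1 mul1r; apply: hC; exact: alive_walk al.
  by rewrite normr0 mul0r mulr_ge0// sqr_ge0.
rewrite -mulr_suml [leLHS](_ : _ = C * (mesh R n * \sum_(k < N) disc q n ^+ k) * mesh R n); last by ring.
rewrite ler_wpM2r ?(ltW h0)// ler_wpM2l//; exact: disc_geometric.
Qed.

(* Dynkin's formula applied to e * atan (y / e) / c_j, whose derivative along the
   flow is [bump_near0] while the function itself is O(e), bounds the time spent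
   within O(e) of level 0 by O(e). *)
Definition bump_near0 (e y : R) : R := (1 + (y / e) ^+ 2)^-1.

Lemma bump_near0_bound e y : 0 < bump_near0 e y <= 1.
Proof.
have : 1 <= 1 + (y / e) ^+ 2 by rewrite lerDl sqr_ge0.
by move=> h; rewrite invr_gt0 invf_le1 ?(lt_le_trans ltr01 h)// h.
Qed.

Lemma bump_near0_lip (a b : R) : `|(1 + a ^+ 2)^-1 - (1 + b ^+ 2)^-1| <= `|a - b|.
Proof.
have a0 : 0 < 1 + a ^+ 2 by rewrite ltr_pwDl// sqr_ge0.
have b0 : 0 < 1 + b ^+ 2 by rewrite ltr_pwDl// sqr_ge0.
have -> : (1 + a ^+ 2)^-1 - (1 + b ^+ 2)^-1 = (b - a) * (a + b) / ((1 + a ^+ 2) * (1 + b ^+ 2)).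
  by field; rewrite !gt_eqF.
rewrite -mulrA normrM (distrC b) ler_piMr// normrM normfV (gtr0_norm (mulr_gt0 a0 b0)).
rewrite ler_pdivrMr ?mulr_gt0// mul1r.
have := sqr_ge0 a; have := sqr_ge0 b; have := sqr_ge0 (a - 1); have := sqr_ge0 (a + 1); have := sqr_ge0 (b - 1); have := sqr_ge0 (b + 1).
have : 0 <= a ^+ 2 * b ^+ 2 by rewrite mulr_ge0// sqr_ge0.
by rewrite ler_norml => *; apply/andP; split; lra.
Qed.

Hypothesis c0 : forall j, c j != 0.

Definition atan_test e y j : R := (c j)^-1 * (e * atan (y / e)).
Definition atan_drv e y j : R := (c j)^-1 * bump_near0 e y.

Lemma atan_abs (x : R) : `|atan x| <= 2.
Proof.
have := atan_ltpi2 x; have := atan_gtNpi2 x; have /andP[_] := @pihalf_02 R => h1 h2 h3.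
by rewrite ler_norml; lra.
Qed.

Lemma sum_inv_rate j : `|(c j)^-1| <= \sum_l `|(c l)^-1|.
Proof. by rewrite (bigD1 j)//= lerDl sumr_ge0. Qed.

Lemma atan_test_bound e y j : 0 < e -> `|atan_test e y j| <= (\sum_l `|(c l)^-1|) * (e * 2).
Proof.
move=> e0; rewrite /atan_test normrM ler_pM ?sum_inv_rate//.
by rewrite normrM gtr0_norm// ler_wpM2l ?atan_abs// ltW.
Qed.

Lemma atan_smooth e D : 0 < e -> exists B, smooth_on c D (atan_test e) (atan_drv e) B.
Proof.
move=> e0; pose K := \sum_l `|(c l)^-1|.
have K0 : 0 <= K by rewrite sumr_ge0.
exists (K * (e * 2) + K + K * e^-1); split.
  by rewrite !addr_ge0// !mulr_ge0// ?invr_ge0 ltW.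
have Ke : 0 <= K * (e * 2) by rewrite !mulr_ge0// ltW.
have Kei : 0 <= K * e^-1 by rewrite mulr_ge0// invr_ge0 ltW.
move=> y j _; have /andP[b0 b1] := bump_near0_bound e y; split.
  rewrite /atan_drv normrM (gtr0_norm b0).
  have : `|(c j)^-1| * bump_near0 e y <= K * 1 by rewrite ler_pM ?sum_inv_rate// ltW.
  by lra.
move=> t _; split.
  by have := atan_test_bound (y + t) j e0; rewrite -/K; lra.
have de z : is_derive z (1 : R) (fun x => atan_test e x j) (atan_drv e z j).
  apply: drvZ; apply: is_derive_eq.
  rewrite /bump_near0 /GRing.scale/= mulr1 mulr0 add0r mulrCA mulfV ?mulr1//.
  by rewrite gt_eqF.
apply: (@le_trans _ _ (K * e^-1 * t ^+ 2)); last by rewrite ler_wpM2r ?sqr_ge0//; lra.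
apply: (@taylor1_lip _ (fun x => atan_test e x j) (fun x => atan_drv e x j)) => // z zz.
have zt : `|z - y| <= `|t|.
  case/orP: zz => /andP[z1 z2].
    by rewrite ger0_norm ?subr_ge0// ger0_norm; lra.
  by rewrite ler0_norm ?subr_le0// ler0_norm; lra.
rewrite /atan_drv -mulrBr normrM -mulrA ler_pM ?sum_inv_rate//.
apply: (le_trans (bump_near0_lip _ _)).
by rewrite -mulrBl normrM mulrC normfV (gtr0_norm e0) ler_wpM2l// invr_ge0 ltW.
Qed.

Let nokill : R -> bool := fun _ => false.

Lemma alive_nokill n z k : alive nokill n z k.
Proof. by elim: k => //= k ->. Qed.

(** For the arctangent test function the generator equals [bump_near0] up to O(e), and the boundary
    terms are O(e). K is independent of e; C is not, because the Taylor constant grows like 1/e. *)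
Lemma occupation_near0 : exists K, 0 <= K /\ forall e, 0 < e -> exists C, 0 <= C /\ forall n N,
  mesh R n * \sum_(k < N) disc q n ^+ k * Ex n (fun z => bump_near0 e (walk n z k)) <= K * e + C * mesh R n.
Proof.
pose K1 := \sum_l `|(c l)^-1|; pose KT := \sum_i \sum_j `|T i j|.
have K10 : 0 <= K1 by rewrite sumr_ge0.
have KT0 : 0 <= KT by rewrite sumr_ge0// => *; rewrite sumr_ge0.
pose K2 := (KT + q) * (K1 * 2).
have K20 : 0 <= K2 by rewrite !mulr_ge0// addr_ge0// ltW.
have qq : 0 <= (1 + q) / q by rewrite divr_ge0// ?addr_ge0// ltW.
exists (K2 * ((1 + q) / q) + K1 * 2 + K1 * 2); split.
  have k1 : 0 <= K2 * ((1 + q) / q) by exact: mulr_ge0.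
  have k2 : 0 <= K1 * 2 by exact: mulr_ge0.
  by rewrite !addr_ge0.
move=> e e0; have [B sm] := atan_smooth (fun y => (y == 0) || ~~ nokill y) e0.
have [C [C0 hC]] := dynkin_discrete sm; exists C; split => // n N.
have := hC n N; set X := Ex n _; set Y := mesh R n * _ => H.
have h0 := mesh_gt0 R n.
have Xb : `|X| <= K1 * (e * 2) + K1 * (e * 2).
  apply: (@Ex_norm _ _ _ _ _ _ _ _ mc n N).
    move=> z z' zz; rewrite big1 => [|k _]; last by rewrite !alive_nokill subrr mul0r.
    rewrite big1 => [|k _]; last by rewrite !alive_nokill subrr mul0r.
    by rewrite !alive_nokill (walk_adapted c n zz) ?(zz N) ?(zz 0%N).
  move=> z; rewrite big1 => [|k _]; last by rewrite !alive_nokill subrr mul0r.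
  rewrite alive_nokill mulr1 addr0 (le_trans (ler_normB _ _))// lerD//; last exact: atan_test_bound.
  rewrite normrM ger0_norm ?exprn_ge0 ?(ltW (disc_gt0 q n))//.
  rewrite -[leRHS]mul1r ler_pM ?exprn_ge0 ?(ltW (disc_gt0 q n))//; last exact: atan_test_bound.
  by rewrite exprn_ile1 ?(ltW (disc_gt0 q n))// disc_le1.
have YE : mesh R n * \sum_(k < N) disc q n ^+ k * Ex n (fun z => bump_near0 e (walk n z k)) <=
   Y + mesh R n * \sum_(k < N) disc q n ^+ k * (K2 * e).
  rewrite /Y -mulrDr -big_split/= ler_wpM2l ?(ltW h0)// ler_sum// => k _.
  rewrite -mulrDr ler_wpM2l ?exprn_ge0 ?(ltW (disc_gt0 q n))//.
  have aG : adapted k (fun z => (alive nokill n z k)%:R * gen_apply T c q (atan_test e) (atan_drv e) (walk n z k) (z k)).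
    exact: (@adapted_state nokill n k (fun a x j => a%:R * gen_apply T c q (atan_test e) (atan_drv e) x j)).
  have aC : adapted k (fun _ : nat -> S => K2 * e) by [].
  have -> : K2 * e = Ex n (fun _ : nat -> S => K2 * e).
    by rewrite /Ex Rintegral_cst// [X in fine X](@probability_setT _ _ _ P) mulr1.
  rewrite -(@ExD _ _ _ _ _ _ _ _ mc n k _ _ aG aC); apply: (@Ex_le _ _ _ _ _ _ _ _ mc n k).
  - exact: (@adapted_state nokill n k (fun a x j => bump_near0 e x)).
  - by move=> z z' zz; rewrite (aG z z' zz).
  move=> z; rewrite alive_nokill mul1r /gen_apply /atan_drv mulrA mulfV// mul1r.
  rewrite -!addrA lerDl.
  have : `|\sum_l T (z k) l * atan_test e (walk n z k) l| <= KT * (K1 * (e * 2)).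
    apply: (le_trans (ler_norm_sum _ _ _)).
    rewrite /KT [X in _ <= X * _](bigD1 (z k))//= mulrDl mulr_suml ler_wpDr//.
      by rewrite !mulr_ge0// ?sumr_ge0// ?(ltW e0)// => *; rewrite sumr_ge0.
    by apply: ler_sum => l _; rewrite normrM ler_wpM2l// atan_test_bound.
  have : `|q * atan_test e (walk n z k) (z k)| <= q * (K1 * (e * 2)).
    by rewrite normrM gtr0_norm// ler_wpM2l ?(ltW q0)// atan_test_bound.
  by rewrite !ler_norml /K2 => /andP[? ?] /andP[? ?]; lra.
have : mesh R n * \sum_(k < N) disc q n ^+ k * (K2 * e) <= (1 + q) / q * (K2 * e).
  by rewrite -mulr_suml mulrA ler_wpM2r ?disc_geometric// mulr_ge0// ltW.
move: H Xb; rewrite !ler_norml => /andP[? ?] /andP[? ?] ?; lra.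
Qed.

(** Given the present, a step changes phase with probability at most [K4] times the mesh, so the
    discounted number of changes near level 0 is controlled by the occupation just bounded. *)
Lemma jumps_near0 : exists K, 0 <= K /\ forall e, 0 < e -> exists C, 0 <= C /\ forall n N,
  Ex n (fun z => \sum_(k < N) disc q n ^+ k * ((z k != z k.+1)%:R * bump_near0 e (walk n z k)))
   <= K * e + C * mesh R n.
Proof.
have [K [K0 hK]] := occupation_near0.
have [CT [CT0 hT]] := ptrans_taylor T.
pose K4 := \sum_i \sum_j `|T i j| + CT.
have K40 : 0 <= K4 by rewrite addr_ge0// sumr_ge0// => *; rewrite sumr_ge0.
have pjj n j : 1 - ptrans T n j j <= mesh R n * K4.
  have := hT n j j; rewrite eqxx (_ : true%:R = 1 :> R)// ler_norml => /andP[h _].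
  have := le_mnorm T j j; have := mesh_gt0 R n; have := mesh_le1 R n => h1 h2 h3.
  have := ler_norm (- T j j); rewrite normrN => h4; rewrite /K4.
  have : CT * mesh R n ^+ 2 <= CT * mesh R n by rewrite ler_wpM2l// expr2 ler_piMr// ltW.
  move: h3 h; set SS := \sum_i _ => h3 h h5.
  have : mesh R n * (- T j j) <= mesh R n * SS by rewrite ler_wpM2l ?(ltW h2)// (le_trans h4).
  by lra.
exists (K4 * K); split; first by rewrite mulr_ge0.
move=> e e0; have [C [C0 hC]] := hK e e0; exists (K4 * C); split; first by rewrite mulr_ge0.
move=> n N; have h0 := mesh_gt0 R n.
pose F (k : 'I_N) (z : nat -> S) : R := disc q n ^+ k * ((z k != z k.+1)%:R * bump_near0 e (walk n z k)).
rewrite (@Ex_sum _ _ _ _ _ _ _ _ mc n N _ _ _ F); last first.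
  move=> k z z' zz; rewrite /F (walk_adapted c n zz) ?(leq_trans (ltnW (ltn_ord k)))//.
  by rewrite (zz k) ?(zz k.+1)// ltnW.
apply: (@le_trans _ _ (K4 * (mesh R n * \sum_(k < N) disc q n ^+ k * Ex n (fun z => bump_near0 e (walk n z k))))); last first.
  by rewrite -!mulrA -mulrDr ler_wpM2l.
rewrite mulrA mulr_sumr; apply: ler_sum => k _; rewrite /F.
have aB : adapted k (fun z => bump_near0 e (walk n z k)).
  exact: (@adapted_state nokill n k (fun a x j => bump_near0 e x)).
have aL l : adapted k (fun z => bump_near0 e (walk n z k) * (z k == l)%:R).
  exact: (@adapted_state nokill n k (fun a x j => bump_near0 e x * (j == l)%:R)).
have dk0 : 0 <= disc q n ^+ k by rewrite exprn_ge0// ltW// disc_gt0.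
rewrite (@ExZ _ _ _ _ _ _ _ _ mc n k.+1 _ _); last first.
  by move=> z z' zz; rewrite (walk_adapted c n zz) ?(leqW (leqnSn _))// (zz k) ?(zz k.+1).
rewrite mulrCA ler_wpM2l// -(@ExZ _ _ _ _ _ _ _ _ mc n k _ _ aB).
have -> : Ex n (fun z => (z k != z k.+1)%:R * bump_near0 e (walk n z k)) =
  Ex n (fun z => bump_near0 e (walk n z k) * (1 - ptrans T n (z k) (z k))).
  transitivity (Ex n (fun z => bump_near0 e (walk n z k) - \sum_l bump_near0 e (walk n z k) * (z k == l)%:R * (z k.+1 == l)%:R)).
    congr (Ex n _); apply/funext => z; rewrite (bigD1 (z k))//= eqxx mulr1 big1 ?addr0; last first.
      by move=> l lz; rewrite eq_sym (negbTE lz) mulr0 mul0r.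
    by rewrite [z k.+1 == _]eq_sym; case: (z k == z k.+1); rewrite /= ?mul0r ?mul1r ?mulr1 ?mulr0 ?subrr ?subr0.
  have aS l : adapted k.+1 (fun z => bump_near0 e (walk n z k) * (z k == l)%:R * (z k.+1 == l)%:R).
    by move=> z z' zz; rewrite (walk_adapted c n zz) ?(leqW (leqnSn _))// (zz k) ?(zz k.+1).
  rewrite (@ExB _ _ _ _ _ _ _ _ mc n k.+1 _ _); last 2 first.
  - exact: adapted_leq aB.
  - by move=> z z' zz; apply: eq_bigr => l _; exact: aS.
  rewrite (@Ex_sum _ _ _ _ _ _ _ _ mc n _ _ _ _ _ aS).
  under eq_bigr do rewrite (@markov_step _ _ _ _ _ _ _ _ mc n k _ _ (aL _)).
  have aS' l : adapted k (fun z => bump_near0 e (walk n z k) * (z k == l)%:R * ptrans T n (z k) l).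
    by move=> z z' zz; rewrite (aL l z z' zz) (zz k).
  rewrite -(@Ex_sum _ _ _ _ _ _ _ _ mc n _ _ _ _ _ aS') -(@ExB _ _ _ _ _ _ _ _ mc n k _ _)//; last first.
    by move=> z z' zz; apply: eq_bigr => l _; exact: aS'.
  congr (Ex n _); apply/funext => z; rewrite mulrBr mulr1; congr (_ - _).
  rewrite (bigD1 (z k))//= eqxx mulr1 big1 ?addr0// => l lz.
  by rewrite eq_sym (negbTE lz) mulr0 mul0r.
apply: (@Ex_le _ _ _ _ _ _ _ _ mc n k).
- exact: (@adapted_state nokill n k (fun a x j => bump_near0 e x * (1 - ptrans T n j j))).
- by move=> z z' zz; rewrite (aB z z' zz).
move=> z; rewrite mulrC [K4 * _]mulrC; have /andP[b0 _] := bump_near0_bound e (walk n z k).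
by rewrite ler_wpM2r ?(ltW b0)// pjj.
Qed.

End DynkinSum.

(** * The path does not jump while at level zero *)

Section JumpsAtZeroPath.
Variables (R : realType) (S : finType) (c : S -> R) (z : R -> S).
Hypothesis zr : forall t, 0 <= t -> exists2 e, 0 < e &
  forall u, t <= u -> u < t + e -> z u = z t.
Hypothesis zl : forall t, 0 < t -> exists2 e, 0 < e & exists s,
  forall u, t - e < u -> u < t -> z u = s.
Variables (q : R) (q0 : 0 < q).

Definition jump_sum n (e : R) (Z : nat -> S) : R :=
  \sum_(k < nsteps n) disc q n ^+ k * ((Z k != Z k.+1)%:R * bump_near0 e (walk c n Z k)).

(** Cells open on the left, so that a jump at u itself falls between the samples k and k+1. *)
Lemma grid_left n (u : R) : 0 < u -> exists k, k%:R * mesh R n < u <= k.+1%:R * mesh R n.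
Proof.
move=> u0; have h0 := mesh_gt0 R n; have /andP[g1 g2] := gidx_itv n (ltW u0).
have [gu|gu] := boolP ((gidx n u)%:R * mesh R n < u); first by exists (gidx n u); rewrite gu ltW.
have E : (gidx n u)%:R * mesh R n = u by apply/eqP; rewrite eq_le g1 leNgt.
case Ei : (gidx n u) => [|i] in E *; first by move: u0; rewrite -E mul0r ltxx.
by exists i; rewrite -{1}E ltr_pM2r// ltr_nat ltnSn E lexx.
Qed.

(** The cell of a jump at level 0 alone contributes r, whatever the scale e. This contradicts, on
    average, the bound O(e) of [jumps_near0]. *)
Lemma jump_sum_lower : ~ no_jump_at_zero c z -> exists2 r, 0 < r &
  forall e, 0 < e -> \forall n \near \oo, r <= jump_sum n e (fun k => z (k%:R * mesh R n)).
Proof.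
move=> /existsNP[u /not_implyP[u0 /not_implyP[lu nj]]].
have [e1 e10 [s' z1]] := zl u0; have [e2 e20 z2] := zr (ltW u0).
have sz : s' != z u.
  apply/eqP => sz; apply: nj; exists (Num.min e1 e2); first by rewrite lt_min e10.
  move=> v; rewrite lt_min => /andP[v1 v2]; have [vu|uv] := ltP v u.
    by rewrite z1 ?sz//; move: v1; rewrite ltr0_norm ?subr_lt0//; lra.
  by apply: z2 => //; move: v2; rewrite ger0_norm ?subr_ge0//; lra.
(* The discount at the jump, times the value 1/2 of [bump_near0] at distance e. *)
exists (expR (- (q * u)) / 2); first by rewrite divr_gt0// expR_gt0.
move=> e e0; have e2' : 0 < e / 2 by exact: divr_gt0.
have M0 : 0 <= maxrate c by exact: maxrate_ge0.
have M1 : 0 < maxrate c + 1 by rewrite ltr_wpDl.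
have eM : 0 < e / 2 / (maxrate c + 1) by exact: divr_gt0.
have hd := dlev_cvg c zr (ltW u0) e2'.
near=> n; have h0 := mesh_gt0 R n.
have h1 : mesh R n < e1 by near: n; exact: near_mesh_lt.
have h2 : mesh R n < e2 by near: n; exact: near_mesh_lt.
have h3 : mesh R n < e / 2 / (maxrate c + 1) by near: n; exact: near_mesh_lt.
have un : u <= n.+1%:R.
  apply: (le_trans (ltW (truncnS_gt u))); rewrite ler_nat ltnS; near: n.
  exact: nbhs_infty_ge.
have [k /andP[k1 k2]] := grid_left n u0.
have kS : k.+1%:R * mesh R n = k%:R * mesh R n + mesh R n by rewrite -natr1 mulrDl mul1r.
have kn : (k < nsteps n)%N.
  by rewrite -(ltr_nat R) -(ltr_pM2r h0) nsteps_mesh (lt_le_trans k1).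
have dk : `|dlev c z n k - lev c z (k%:R * mesh R n)| <= e / 2.
  by move: (k) (ltW k1); near: n; exact: hd.
have lk : `|lev c z (k%:R * mesh R n) - lev c z u| <= e / 2.
  apply: (le_trans (lev_lip c zr _ _)); rewrite ltr0_norm ?subr_lt0//.
  move: h3; rewrite ltr_pdivlMr// => h3; nra.
have wk : `|dlev c z n k| <= e.
  rewrite lu subr0 in lk; rewrite -[dlev _ _ _ _](subrK (lev c z (k%:R * mesh R n))) (splitr e).
  by apply: (le_trans (ler_normD _ _)); exact: lerD.
pose Z k := z (k%:R * mesh R n).
have zk : Z k = s' by apply: z1 => //; lra.
have zk' : Z k.+1 = z u by apply: z2 => //; lra.
rewrite /jump_sum (bigD1 (Ordinal kn))//= -/Z -/(Z k) -/(Z k.+1) zk zk' sz mul1r.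
rewrite ler_wpDr//.
  apply: sumr_ge0 => i _; rewrite mulr_ge0 ?exprn_ge0 ?(ltW (disc_gt0 q n))//.
  by rewrite mulr_ge0//; have /andP[/ltW] := bump_near0_bound e (walk c n Z i).
rewrite ler_pM ?expR_ge0//.
  by rewrite discX ler_expR lerN2 ler_wpM2l ?(ltW q0)// ltW.
rewrite /bump_near0 lef_pV2 ?posrE//; last by rewrite ltr_pwDl// sqr_ge0.
rewrite -[leRHS]/(1 + 1) lerD2l -(real_normK (num_real _)) exprn_ile1//.
rewrite normrM normfV (gtr0_norm e0) ler_pdivrMr// mul1r; exact: wk.
Unshelve. all: by end_near. Qed.

End JumpsAtZeroPath.

Section NoJumpAtZero.
Variables (R : realType) (S : finType) (T : S -> S -> R) (c : S -> R).
Variables (d : measure_display) (Omega : measurableType d) (phi : R -> Omega -> S).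
Variables (s : S) (P : probability Omega R).
Hypotheses (cad : cadlag_step_paths phi) (mc : markov_chain_from T s P phi)
  (c0 : forall j, c j != 0).

Lemma ereal_le_approx (x : \bar R) (a : R) :
  (forall e : R, 0 < e -> (x <= (a + e)%:E)%E) -> (x <= a%:E)%E.
Proof. by move=> h; apply/lee_addgt0Pr => e e0; rewrite -EFinD; exact: h. Qed.

(** Markov's inequality for the jump sums. An explicit measurable null set is built, so
    measurability of the path property itself is not at issue; the discount is fixed to 1. *)
Lemma good_paths_ae : exists N : set Omega, [/\ measurable N, P N = 0%E &
  forall w, ~ N w -> phi 0 w = s /\ no_jump_at_zero c (phi^~ w)].
Proof.
pose V n i w := jump_sum c 1 n (i.+1%:R^-1 : R) (gpath phi n w).
have aV n i : adapted (nsteps n) (jump_sum c (1 : R) n (i.+1%:R^-1)).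
  move=> x x' xx; apply: eq_bigr => k _.
  have kn := ltn_ord k; rewrite (xx k (ltnW kn)) (xx k.+1 kn).
  by rewrite (walk_adapted c n xx)// leqW// ltnW.
have mV n i : measurable_fun setT (V n i) by exact: (adapted_measurable mc n (aV n i)).
have V0 n i w : 0 <= V n i w.
  apply: sumr_ge0 => k _; rewrite mulr_ge0 ?exprn_ge0 ?(ltW (disc_gt0 _ n))//.
  by rewrite mulr_ge0//; have /andP[/ltW] := bump_near0_bound (i.+1%:R^-1) (walk c n (gpath phi n w) k).
pose A m i n := [set w | m.+1%:R^-1 <= V n i w].
have mA m i n : measurable (A m i n).
  rewrite (_ : A m i n = setT `&` (fun w => m.+1%:R^-1 <= V n i w) @^-1` [set true]); last first.
    by rewrite setTI; apply/seteqP; split => w.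
  by apply: measurable_fun_ler.
pose B m i N := \bigcap_(n in [set n | (N <= n)%N]) A m i n.
have mB m i N : measurable (B m i N).
  by apply: bigcap_measurable => [|n _]; [exists N => /=|exact: mA].
(* At every scale 1/(i+1) the jump sum is eventually at least 1/(m+1). By [jump_sum_lower] each path
   jumping at level 0 belongs to some [bad m]. *)
pose bad m := \bigcap_i \bigcup_N B m i N.
have mbad m : measurable (bad m).
  by apply: bigcapT_measurable => i; apply: bigcupT_measurable => N; exact: mB.
have [K [K0 hK]] := jumps_near0 mc (@ltr01 R) c0.
have PB m i N : (P (B m i N) <= (m.+1%:R * (K * i.+1%:R^-1))%:E)%E.
  have i0 : 0 < i.+1%:R^-1 :> R by rewrite invr_gt0.
  have [C [C0 hC]] := hK _ i0.
  apply: ereal_le_approx => e e0.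
  have [n Nn hn] : exists2 n, (N <= n)%N & m.+1%:R * (C * mesh R n) <= e.
    have C1 : 0 < m.+1%:R * (C + 1) by rewrite mulr_gt0// ltr_wpDl.
    have : \forall n \near \oo, (N <= n)%N /\ mesh R n < e / (m.+1%:R * (C + 1)).
      near=> n; split; first by near: n; exact: nbhs_infty_ge.
      near: n; apply: near_mesh_lt; exact: divr_gt0.
    move=> [n0 _ /(_ n0 (leqnn _))[Nn hn]]; exists n0 => //.
    move: hn; rewrite ltr_pdivlMr// => hn.
    have := mesh_gt0 R n0; have : 0 < m.+1%:R :> R by []; nra.
  apply: (@le_trans _ _ (P (A m i n))).
    by apply: le_measure; rewrite ?inE// => w; apply.
  rewrite -[P _]fineK ?fin_num_measure// lee_fin.
  have H := hC n (nsteps n).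
  have : m.+1%:R^-1 * fine (P (A m i n)) <= K / i.+1%:R + C * mesh R n.
    apply: le_trans H; rewrite -Rintegral_indic// -RintegralZl//; last first.
      apply: (@prob_integrable _ _ _ _ _ 1) => // w; by rewrite indicE normr_nat lern1 leq_b1.
    apply: le_Rintegral => //.
    - apply: (@prob_integrable _ _ _ _ _ 1); first by apply: measurable_funM.
      move=> w; rewrite indicE normrM normr_nat ger0_norm ?invr_ge0// mulr_ile1 ?invr_ge0//.
        by rewrite invf_le1// ler1n.
      by rewrite lern1 leq_b1.
    - exact: (adapted_integrable mc n (aV n i)).
    move=> w _; rewrite indicE; have [|_] := boolP (w \in A m i n).
      by rewrite inE mulr1.
    by rewrite mulr0; exact: V0.
  rewrite ler_pdivrMl// => h; apply: (le_trans h); rewrite mulrDr lerD2l; exact: hn.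
(* In [PB] the mesh has already been sent to 0; now N tends to infinity by continuity from below,
   and i is chosen last. *)
have Pbad m : P (bad m) = 0%E.
  apply/eqP; rewrite eq_le measure_ge0 andbT; apply: ereal_le_approx => e e0; rewrite add0r.
  pose i := Num.truncn (m.+1%:R * K / e).
  have hi : m.+1%:R * (K * i.+1%:R^-1) <= e.
    by rewrite mulrA ler_pdivrMr// -ler_pdivrMl// [leLHS]mulrC ltW// truncnS_gt.
  apply: (@le_trans _ _ (P (\bigcup_N B m i N))).
    by apply: le_measure; rewrite ?inE//; [exact: bigcupT_measurable|move=> w; apply].
  have ndB : nondecreasing_seq (B m i).
    move=> N N' NN; apply/subsetPset => w h n /= N'n; apply: h => /=; exact: leq_trans NN N'n.
  have h : P \o B m i @ \oo --> P (\bigcup_N B m i N).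
    exact: nondecreasing_cvg_mu (mB m i) (bigcupT_measurable _ (mB m i)) ndB.
  rewrite -(cvg_lim _ h)//; apply: lime_le; first by apply/cvg_ex; eexists; exact: h.
  by near=> N; apply: (le_trans (PB m i N)); rewrite lee_fin.
have m0 : measurable [set w | phi 0 w = s] by apply: mc.1.
have P0 : P (~` [set w | phi 0 w = s]) = 0%E.
  rewrite probability_setC//.
  have -> : [set w | phi 0 w = s] = cylinder phi 0 0 (fun _ => s).
    apply/seteqP; split => w /=; first by move=> h i; rewrite /gpath ord1 mul0r.
    by move=> /(_ ord0); rewrite /gpath mul0r.
  by rewrite (cylinder_prob mc) eqxx mul1r big_ord0 subee.
exists (\bigcup_m bad m `|` ~` [set w | phi 0 w = s]); split.
- by apply: measurableU; [exact: bigcupT_measurable|exact: measurableC].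
- have Pbads : P (\bigcup_m bad m) = 0%E.
    apply/eqP; rewrite eq_le measure_ge0 andbT.
    have h : (P (\bigcup_m bad m) <= \sum_(m <oo) P (bad m))%E.
      by apply: measure_sigma_subadditive => //; exact: bigcupT_measurable.
    apply: (le_trans h).
    by rewrite eseries0// => m _ _; rewrite Pbad.
  rewrite null_set_setU//; first exact: bigcupT_measurable.
  exact: measurableC.
move=> w /not_orP[nb /contrapT h0]; split => //.
apply: contrapT => nj; apply: nb.
have [r r0 hr] := jump_sum_lower (cad w).1 (cad w).2 (@ltr01 R) nj.
exists (Num.truncn r^-1) => // i _.
have i0 : 0 < i.+1%:R^-1 :> R by rewrite invr_gt0.
have [N _ hN] := hr _ i0.
exists N => // n /= Nn; apply: le_trans (hN n Nn).
by rewrite invf_ple ?posrE// ltW// truncnS_gt.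
Unshelve. all: by end_near. Qed.

End NoJumpAtZero.

(** * The killing step of the sampled walk converges to the return time, path by path *)

Section KilledPath.
Variables (R : realType) (S : finType) (c : S -> R).
Variables (q : R) (q0 : 0 < q).

Definition below : R -> bool := fun y => y <= 0.

Notation alive := (alive c below).

Lemma aliveP n Z k : alive n Z k <-> forall i, (0 < i <= k)%N -> 0 < walk c n Z i.
Proof.
elim: k => [|k IH]; first by split => // _ [|i]; rewrite ?andbF.
split => /=.
  move=> /andP[/IH h]; rewrite /below -ltNge => hk i /andP[i0].
  by rewrite leq_eqVlt => /orP[/eqP ->//|]; rewrite ltnS => ik; apply: h; rewrite i0.
move=> h; apply/andP; split; last by rewrite /below -ltNge; apply: h; rewrite ltnSn.
by apply/IH => i /andP[i0 ik]; apply: h; rewrite i0/= leqW.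
Qed.

Lemma alive_dead n Z i k : (0 < i <= k)%N -> walk c n Z i <= 0 -> alive n Z k = false.
Proof.
move=> ik wi; apply/negbTE/negP => /aliveP/(_ i ik).
by rewrite ltNge wi.
Qed.

Lemma alive_step n Z k : alive n Z k.+1 -> alive n Z k.
Proof. by move=> /= /andP[]. Qed.

(** At most one weight is nonzero, at the killing step: this is F at that step, or 0 for a walk
    still alive at N. *)
Definition kill_sum n (F : nat -> R) Z N : R :=
  \sum_(k < N) ((alive n Z k)%:R - (alive n Z k.+1)%:R) * F k.+1.

Lemma kill_sum_total n Z N :
  \sum_(k < N) ((alive n Z k)%:R - (alive n Z k.+1)%:R) = 1 - (alive n Z N)%:R :> R.
Proof. by elim: N => [|N IH]; rewrite ?big_ord0 ?subrr// big_ord_recr IH/=; ring. Qed.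

Lemma kill_weight_ge0 n Z k : 0 <= (alive n Z k)%:R - (alive n Z k.+1)%:R :> R.
Proof.
have := @alive_step n Z k; case: (alive n Z k.+1); last by rewrite subr0.
by move=> -> //; rewrite subrr.
Qed.

(** The weights sum to 1 once the walk is dead; otherwise the missing mass is harmless only for a =
    0. *)
Lemma kill_sum_close n (F : nat -> R) Z N a e : 0 <= e ->
  (forall k, (k < N)%N -> alive n Z k -> ~~ alive n Z k.+1 -> `|F k.+1 - a| <= e) ->
  a = 0 \/ alive n Z N = false -> `|kill_sum n F Z N - a| <= e.
Proof.
move=> e0 hF ha.
have -> : kill_sum n F Z N - a = \sum_(k < N) ((alive n Z k)%:R - (alive n Z k.+1)%:R) * (F k.+1 - a).
  under [RHS]eq_bigr do rewrite mulrBr.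
  rewrite sumrB -mulr_suml kill_sum_total; congr (_ - _).
  by case: ha => ->; rewrite ?mulr0// subr0 mul1r.
apply: (le_trans (ler_norm_sum _ _ _)).
apply: (@le_trans _ _ (\sum_(k < N) ((alive n Z k)%:R - (alive n Z k.+1)%:R) * e)).
  apply: ler_sum => k _; rewrite normrM ger0_norm ?kill_weight_ge0//.
  have [ak|] := boolP (alive n Z k); last first.
    by move=> /negbTE ak; have := @alive_step n Z k; rewrite ak; case: (alive n Z k.+1) => [/(_ isT)//|_]; rewrite subrr !mul0r.
  have [ak'|ak'] := boolP (alive n Z k.+1); first by rewrite subrr !mul0r.
  by rewrite subr0 !mul1r; apply: hF.
rewrite -mulr_suml kill_sum_total ler_piMl// gerBl ler0n //.
Qed.

Variable z : R -> S.
Hypothesis zr : forall t, 0 <= t -> exists2 e, 0 < e &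
  forall u, t <= u -> u < t + e -> z u = z t.
Hypotheses (c0 : forall s, c s != 0) (cz : 0 < c (z 0)) (nj : no_jump_at_zero c z).

Let Z n k := z (k%:R * mesh R n).
Let tau := rtime c z.

Lemma near_alive_before u : 0 <= u -> (u%:E < tau)%E ->
  \forall n \near \oo, alive n (Z n) (gidx n u).+1.
Proof.
move=> u0 ut; have [d d0 hd] := near_alive zr c0 cz u0 ut.
near=> n; apply/aliveP => i /andP[i0 ik].
have hn : mesh R n < d by near: n; exact: near_mesh_lt.
have /andP[r1 r2] := rpt_itv n u0.
have iu : i%:R * mesh R n <= u + d.
  apply: (@le_trans _ _ (rpt n u)); first by rewrite /rpt ler_wpM2r ?(ltW (mesh_gt0 R n))// ler_nat.
  by apply: (le_trans r2); rewrite lerD2l ltW.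
move: i i0 iu {ik}; near: n; exact: hd.
Unshelve. all: by end_near. Qed.

Lemma near_dead_after u : (tau < u%:E)%E ->
  \forall n \near \oo, alive n (Z n) (gidx n u).+1 = false.
Proof.
move=> tu; have tlt : (tau < +oo)%E by apply: (lt_trans tu); rewrite ltry.
have [r r0 [E lr]] := rtime_attained zr c0 tlt.
have ru : r < u by move: tu; rewrite /tau E lte_fin.
have hd := near_dead zr c0 nj cz E ru.
near=> n; have [i [i0 iu wi]] : exists i, [/\ (0 < i)%N, i%:R * mesh R n <= u & dlev c z n i <= 0].
  by near: n; exact: hd.
apply: (@alive_dead _ _ i) => //; rewrite i0/=.
have u0 : 0 <= u by rewrite ltW// (lt_trans r0).
have /andP[g1 g2] := gidx_itv n u0.
by have := le_lt_trans iu g2; rewrite ltr_pM2r ?mesh_gt0// ltr_nat => /ltnW.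
Unshelve. all: by end_near. Qed.

Lemma expR_lip (a b : R) : 0 <= a -> 0 <= b -> `|expR (- (q * a)) - expR (- (q * b))| <= q * `|a - b|.
Proof.
wlog ab : a b / a <= b.
  move=> h a0 b0; have [ab|/ltW ab] := leP a b; first exact: h.
  by rewrite distrC [`|a - b|]distrC; exact: h.
move=> a0 b0.
have ba : 0 <= b - a by rewrite subr_ge0.
rewrite [`|a - b|]distrC (ger0_norm ba) ger0_norm; last first.
  by rewrite subr_ge0 ler_expR lerN2 ler_wpM2l// ltW.
have -> : expR (- (q * b)) = expR (- (q * a)) * expR (- (q * (b - a))).
  by rewrite -expRD; congr expR; ring.
have h1 : 1 - q * (b - a) <= expR (- (q * (b - a))) by exact: expR_ge1Dx.
have h2 : expR (- (q * a)) <= 1 by rewrite -[leRHS]expR0 ler_expR oppr_le0 mulr_ge0// ltW.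
have h3 : 0 <= expR (- (q * a)) by exact: expR_ge0.
have h4 : 0 <= q * (b - a) by rewrite mulr_ge0// ltW.
by nra.
Qed.

Definition return_weight l : R :=
  if (tau < +oo)%E then expR (- (q * fine tau)) * (z (fine tau) == l)%:R else 0.

(** If the return time is finite, killing eventually happens within d of it, where the phase is
    constant. If it is infinite, killing can happen only so late that the discount is negligible. *)
Lemma kill_sum_cvg l :
  (fun n => kill_sum n (fun k => disc q n ^+ k * (Z n k == l)%:R) (Z n) (nsteps n)) @ \oo
  --> return_weight l.
Proof.
apply/cvgrPdist_le => e e0.
under eq_near do rewrite distrC.
rewrite /return_weight; case: ifPn => tlt.
  have [r r0 [E lr]] := rtime_attained zr c0 tlt.
  have [e1 e10 ze] := nj r0 lr.
  rewrite /tau E /=.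
  (* Respectively: no phase change within d of r, r - d stays positive, and the discount varies by
     at most e. *)
  pose d := Num.min (e1 / 2) (Num.min (r / 2) (e / q)).
  have d0 : 0 < d by rewrite !lt_min !divr_gt0.
  have de1 : d < e1.
    by apply: (@le_lt_trans _ _ (e1 / 2)); [rewrite ge_min lexx|lra].
  have dr : d <= r / 2 by rewrite !ge_min lexx orbT.
  have dq : q * d <= e by rewrite -ler_pdivlMl// mulrC !ge_min lexx !orbT.
  have rd0 : 0 <= r - d by lra.
  have rdt : ((r - d)%:E < tau)%E by rewrite /tau E lte_fin ltrBlDr ltrDl.
  have [d' d'0 h1] := near_alive zr c0 cz rd0 rdt.
  have rrd : r < r + d by rewrite ltrDl.
  have h2 := near_dead zr c0 nj cz E rrd.
  near=> n; have h0 := mesh_gt0 R n.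
  have [i [i0 iu wi]] : exists i, [/\ (0 < i)%N, i%:R * mesh R n <= r + d & dlev c z n i <= 0].
    by near: n; exact: h2.
  have al : forall i, (0 < i)%N -> i%:R * mesh R n <= r - d + d' -> 0 < dlev c z n i.
    by near: n; exact: h1.
  have rn : r + d <= n.+1%:R.
    apply: (le_trans (ltW (truncnS_gt _))); rewrite ler_nat ltnS; near: n.
    exact: nbhs_infty_ge.
  apply: kill_sum_close; first exact: ltW.
    move=> k kN ak ak'.
    have ki : (k.+1 <= i)%N.
      rewrite ltnNge; apply/negP => ik; move: ak.
      by rewrite (@alive_dead _ _ i)// i0.
    have kr : k.+1%:R * mesh R n <= r + d.
      by apply: le_trans iu; rewrite ler_wpM2r ?(ltW h0)// ler_nat.
    have kl : r - d < k.+1%:R * mesh R n.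
      rewrite ltNge; apply/negP => kl.
      have := al k.+1 isT (le_trans kl _); rewrite lerDl (ltW d'0) => /(_ isT) wk.
      by move: ak' => /=; rewrite ak/= /below -ltNge => /negP; apply; exact: wk.
    have kd : `|k.+1%:R * mesh R n - r| <= d by rewrite ler_norml; apply/andP; split; lra.
    rewrite /Z ze ?(le_lt_trans kd)//.
    rewrite discX -mulrBl normrM; case: (z r == l); last by rewrite normr0 mulr0 ltW.
    rewrite normr1 mulr1; apply: (le_trans (expR_lip _ _)); rewrite ?grid_ge0 ?(ltW r0)//.
    by apply: le_trans dq; rewrite ler_wpM2l// ltW.
  right; apply: (@alive_dead _ _ i) => //; rewrite i0/=.
  by rewrite -(ler_nat R) -(ler_pM2r h0) nsteps_mesh (le_trans iu).
have tE : tau = +oo%E by apply/eqP; rewrite -leye_eq leNgt.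
(* Then exp(-qu) <= 1/(1 + qu) <= 1/(qu) = e. *)
pose u := (q * e)^-1.
have u0 : 0 < u by rewrite invr_gt0 mulr_gt0.
have ut : (u%:E < tau)%E by rewrite tE ltry.
have [d' d'0 h1] := near_alive zr c0 cz (ltW u0) ut.
near=> n; have h0 := mesh_gt0 R n.
have al : forall i, (0 < i)%N -> i%:R * mesh R n <= u + d' -> 0 < dlev c z n i.
  by near: n; exact: h1.
apply: kill_sum_close; [exact: ltW| |by left] => k kN ak ak'.
have kl : u < k.+1%:R * mesh R n.
  rewrite ltNge; apply/negP => kl.
  have := al k.+1 isT (le_trans kl _); rewrite lerDl (ltW d'0) => /(_ isT) wk.
  by move: ak' => /=; rewrite ak/= /below -ltNge => /negP; apply; exact: wk.
rewrite subr0 normrM ger0_norm ?exprn_ge0 ?(ltW (disc_gt0 q n))//.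
apply: (@le_trans _ _ (disc q n ^+ k.+1)).
  rewrite ler_piMr ?exprn_ge0 ?(ltW (disc_gt0 q n))//.
  by rewrite normr_nat lern1 leq_b1.
rewrite discX; apply: (@le_trans _ _ (expR (- (q * u)))).
  by rewrite ler_expR lerN2 ler_wpM2l ?(ltW q0)// ltW.
rewrite expRN invf_ple ?posrE ?expR_gt0//.
have := @expR_ge1Dx _ (q * u); apply: le_trans.
by rewrite /u invfM mulrA mulfV ?gt_eqF// mul1r lerDr.
Unshelve. all: by end_near. Qed.

End KilledPath.

(** * Passing to the limit in the Dynkin formula *)

Section OccupationLimit.
Variables (R : realType) (S : finType) (T : S -> S -> R) (c : S -> R).
Variables (d : measure_display) (Omega : measurableType d) (phi : R -> Omega -> S).
Variables (s : S) (P : probability Omega R).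
Hypotheses (cad : cadlag_step_paths phi) (mc : markov_chain_from T s P phi)
  (c0 : forall j, c j != 0) (cs : 0 < c s).
Variables (q : R) (q0 : 0 < q).

Local Notation pm := (@lebesgue_measure R \x P)%E.
Let tau w : \bar R := rtime c (phi^~ w).
Let zr w := (cad w).1.
Let mphi := mc.1.

(** Nonnegativity of the level is built in, so a bound on a test function over y >= 0 bounds the
    integrand at every point. *)
Definition occ_set l : set (R * Omega) :=
  [set x | [/\ 0 <= x.1, (x.1%:E < tau x.2)%E, 0 <= lev c (phi^~ x.2) x.1 & phi x.1 x.2 = l]].

Lemma measurable_occ_set l : measurable (occ_set l).
Proof.
rewrite (_ : occ_set l = (@nonneg_time R d Omega `&` [set x | phi x.1 x.2 = l]) `&`
  ([set x | (x.1%:E < tau x.2)%E] `&`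
   (@nonneg_time R d Omega `&` (fun x => 0 <= lev c (phi^~ x.2) x.1) @^-1` [set true]))); last first.
  apply/seteqP; split => x /=; first by move=> [? ? ? ?]; do ! split.
  by move=> [[? ?] [? [_ ?]]]; split.
apply: measurableI; first exact: (measurable_phi_set cad mphi).
apply: measurableI; first exact: (measurable_lt_tau cad mphi c0).
apply: measurable_fun_ler => //.
  exact: (measurable_lev2 c cad mphi).
exact: measurable_nonneg_time.
Qed.

Lemma integral_iter (f : R * Omega -> R) (F : R -> \bar R) : measurable_fun setT f ->
  (forall x, 0 <= f x) -> (forall u, \int[P]_w (f (u, w))%:E = F u)%E ->
  (\int[pm]_x (f x)%:E = \int[@lebesgue_measure R]_u F u)%E.
Proof.
move=> mf f0 fF.
have mf' : measurable_fun setT (EFin \o f) by exact/measurable_EFinP.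
have f0' x : (0 <= (EFin \o f) x)%E by rewrite lee_fin.
apply: (etrans (@fubini_tonelli1 _ _ _ _ R (@lebesgue_measure R) P _ mf' f0')).
by apply: eq_integral => u _; exact: fF.
Qed.

(** The dominating function on time and sample space together; its mass 1/q is read off the
    exponential density. *)
Definition disc_weight (x : R * Omega) : R := expR (- (q * x.1)) * \1_(@nonneg_time R d Omega) x.

Lemma measurable_expR_time : measurable_fun setT (fun x : R * Omega => expR (- (q * x.1))).
Proof.
apply: measurableT_comp => //; apply: measurableT_comp => //.
by apply: measurable_funM => //; exact: measurable_fst.
Qed.

Lemma disc_weight_integrable : pm.-integrable setT (EFin \o disc_weight).
Proof.
have mdw : measurable_fun setT disc_weight.
  apply: measurable_funM; first exact: measurable_expR_time.
  by apply: measurable_indic; exact: measurable_nonneg_time.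
have dw0 x : 0 <= disc_weight x by rewrite mulr_ge0 ?expR_ge0.
apply/integrableP; split; first exact/measurable_EFinP.
under eq_integral do rewrite /= ger0_norm//.
rewrite (integral_iter (F := fun u => (q^-1)%:E * (exponential_pdf q u)%:E)%E)//.
  rewrite ge0_integralZl//; last first.
  - by rewrite lee_fin invr_ge0 ltW.
  - by move=> x _; rewrite lee_fin exponential_pdf_ge0// ltW.
  - by apply/measurable_EFinP; exact: measurable_exponential_pdf.
  by rewrite integral_exponential_pdf// mule1 ltry.
move=> u; rewrite /disc_weight/=.
rewrite (_ : (fun y : Omega => _) = cst (expR (- (q * u)) * \1_(@nonneg_time R d Omega) (u, point))%:E); last first.
  by apply/funext => y /=; rewrite !indicE; congr (_ * (nat_of_bool _)%:R)%:E; apply/idP/idP; rewrite !inE.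
apply: (etrans (integral_cst _ measurableT _)).
rewrite [X in (_ * X)%E](_ : _ = 1%E) ?mule1 /exponential_pdf; last exact: probability_setT.
rewrite patchE -EFinM; congr EFin.
rewrite indicE; have [u0|u0] := leP 0 u.
  by rewrite !mem_set//= ?in_itv/= ?u0// mulr1 mulrA mulVf ?gt_eqF// mul1r mulNr.
rewrite !memNset ?mulr0 ?mulr0//= ?in_itv/= ?andbT ?leNgt ?u0//.
by rewrite /nonneg_time/= leNgt u0.
Qed.

Definition occ_fun l (psi : R -> R) (x : R * Omega) : R :=
  \1_(occ_set l) x * (expR (- (q * x.1)) * psi (lev c (phi^~ x.2) x.1)).

Lemma measurable_occ_fun l (psi : R -> R) : measurable_fun setT psi -> measurable_fun setT (occ_fun l psi).
Proof.
move=> mpsi.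
have -> : occ_fun l psi = (fun x => expR (- (q * x.1)) * psi (lev c (phi^~ x.2) x.1)) \_ (occ_set l).
  apply/funext => x; rewrite /occ_fun patchE indicE; case: ifPn => _; rewrite ?mul1r ?mul0r//.
apply/(measurable_restrictT _ _).1 => //; first exact: measurable_occ_set.
apply: (@measurable_funS _ _ _ _ (@nonneg_time R d Omega)).
- exact: measurable_nonneg_time.
- by move=> x [].
apply: measurable_funM; first by apply: measurable_funTS; exact: measurable_expR_time.
apply: (measurableT_comp mpsi); exact: (measurable_lev2 c cad mphi).
Qed.

Lemma occ_fun_bound l (psi : R -> R) B : (forall y, 0 <= y -> `|psi y| <= B) ->
  forall x, `|occ_fun l psi x| <= B * disc_weight x.
Proof.
move=> pB x; have B0 : 0 <= B by exact: le_trans (pB 0 (lexx _)).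
rewrite /occ_fun indicE; have [|_] := boolP (x \in occ_set l); last first.
  by rewrite mul0r normr0 mulr_ge0// mulr_ge0 ?expR_ge0.
rewrite inE => -[x0 _ l0 _]; rewrite mul1r /disc_weight indicE mem_set// mulr1.
by rewrite normrM ger0_norm ?expR_ge0// mulrC ler_wpM2r ?expR_ge0// pB.
Qed.

Lemma occ_fun_integrable l (psi : R -> R) B : measurable_fun setT psi ->
  (forall y, 0 <= y -> `|psi y| <= B) -> pm.-integrable setT (EFin \o occ_fun l psi).
Proof.
move=> mpsi pB; apply: (@le_integrable _ _ _ pm _ measurableT _ (fun x => (B * disc_weight x)%:E)).
- by apply/measurable_EFinP; exact: measurable_occ_fun.
- move=> x _ /=; rewrite lee_fin; apply: (le_trans (occ_fun_bound l pB x)); exact: ler_norm.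
- by under eq_fun do rewrite EFinM; apply: integrableZl => //; exact: disc_weight_integrable.
Qed.

(** E[int_0^tau exp(-qu) psi(X(u)) 1{phi(u) = l} du] as one integral for the product measure, so
    that a single dominated convergence treats time and chance. *)
Definition occ l (psi : R -> R) : R := (\int[pm]_x occ_fun l psi x)%R.

(** At u = [tau] the walk may be alive or dead in the limit. These points are negligible, as each
    path contributes at most one. *)
Lemma null_eq_tau : pm [set x | x.1%:E = tau x.2] = 0%E.
Proof.
have mE := measurable_eq_tau cad mphi c0.
have := indic_fubini_tonelli (@lebesgue_measure R) P mE.
rewrite -indic_fubini_tonelli1// integral_indic// setIT => ->.
rewrite indic_fubini_tonelli_GE//.
apply: integral0_eq => w _ /=.
apply/eqP; rewrite eq_le measure_ge0 andbT.
rewrite -(@lebesgue_measure_set1 R (fine (tau w))); apply: le_measure; rewrite ?inE//.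
  exact: measurable_ysection.
by move=> u; rewrite /ysection/= inE/= => E; rewrite /tau -E.
Qed.

Lemma null_cylinder (N : set Omega) : measurable N -> P N = 0%E ->
  pm [set x | N x.2] = 0%E.
Proof.
move=> mN N0; rewrite /product_measure1 integral0_eq// => u _ /=.
by rewrite (_ : xsection _ _ = N)//; apply/seteqP; split => w; rewrite /xsection/= inE.
Qed.

Lemma int_stepf n (b : nat -> Omega -> R) B : (forall k, measurable_fun setT (b k)) ->
  (forall k w, 0 <= b k w <= B) ->
  (\int[pm]_x stepf n (fun k => b k x.2) x.1 =
     mesh R n * \sum_(k < nsteps n) \int[P]_w b k w)%R.
Proof.
move=> mb bB.
pose f (k : 'I_(nsteps n)) (x : R * Omega) : R := \1_(cell n k) x.1 * b k x.2.
have mf k : measurable_fun setT (f k).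
  apply: measurable_funM; last exact: (measurableT_comp (mb k) measurable_snd).
  have mcell : measurable_fun setT (\1_(cell n k) : R -> R).
    by apply: measurable_indic; exact: measurable_cell.
  exact: (measurableT_comp mcell measurable_fst).
have f0 k x : 0 <= f k x by rewrite mulr_ge0//; have /andP[] := bB k x.2.
have ib k : P.-integrable setT (EFin \o b k).
  by apply: (@prob_integrable _ _ _ _ _ B) => // w; have /andP[b0 b1] := bB k w; rewrite ger0_norm.
have fE k : (\int[pm]_x (f k x)%:E = (mesh R n * \int[P]_w b k w)%:E)%E.
  rewrite (integral_iter (F := fun u => (\int[P]_w (b k w))%R%:E * (\1_(cell n k) u)%:E)%E)//; last first.
    move=> u; rewrite /f/=.
    rewrite /Rintegral fineK; last exact: (integrable_fin_num measurableT (ib k)).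
    rewrite muleC -ge0_integralZl//.
    - exact/measurable_EFinP.
    - by move=> w _; rewrite lee_fin; have /andP[] := bB k w.
  rewrite ge0_integralZl//; last first.
  - rewrite lee_fin; apply: Rintegral_ge0 => w _; by have /andP[] := bB k w.
  - by apply/measurable_EFinP/measurable_indic; exact: measurable_cell.
  rewrite integral_indic ?setIT//; last exact: measurable_cell.
  rewrite [X in (_ * X)%E](_ : _ = (mesh R n)%:E); first by rewrite -EFinM mulrC.
  apply: (etrans (lebesgue_measure_itv _)); rewrite /= lte_fin ltr_pM2r ?mesh_gt0// ltr_nat ltnSn.
  by rewrite -EFinB -mulrBl -natrB// subSnn mul1r.
rewrite /stepf (@Rintegral_sum _ _ _ pm _ _ _ f); last first.
  move=> k; have mfk : measurable_fun setT (EFin \o f k) by exact/measurable_EFinP.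
  apply/integrableP; split; first exact: mfk.
  by under eq_integral do rewrite /= ger0_norm//; rewrite fE ltry.
by rewrite mulr_sumr; apply: eq_bigr => k _; rewrite /Rintegral fE.
Qed.

Notation alive := (alive c (@below R)).
Notation Ex := (@Ex R S d Omega phi P).

Definition disc_occ n l (psi : R -> R) : R := mesh R n * \sum_(k < nsteps n)
  disc q n ^+ k * Ex n (fun z => (alive n z k)%:R * (psi (walk c n z k) * (z k == l)%:R)).

Lemma alive_walk_ge0 n z k : alive n z k -> 0 <= walk c n z k.
Proof.
move=> al; have := alive_walk al; rewrite /below -ltNge => /orP[/eqP ->//|]; exact: ltW.
Qed.

(** The sampled sum is an integral of a step function which, off the graph of [tau] and the null set
    of bad paths, converges because the walk is eventually alive before [tau] and dead after it. *)
Lemma disc_occ_cvg l (psi : R -> R) B : continuous psi -> (forall y, 0 <= y -> 0 <= psi y <= B) ->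
  (fun n => disc_occ n l psi) @ \oo --> occ l psi.
Proof.
move=> cpsi pB; have mpsi : measurable_fun setT psi by exact: continuous_measurable_fun.
have B0 : 0 <= B by have /andP[h1 h2] := pB 0 (lexx _); exact: le_trans h2.
pose t n k (z : nat -> S) : R := (alive n z k)%:R * (psi (walk c n z k) * (z k == l)%:R).
have t0B n k z : 0 <= t n k z <= B.
  rewrite /t; case: (boolP (alive n z k)) => al; last by rewrite mul0r lexx.
  have /andP[p0 p1] := pB _ (alive_walk_ge0 al).
  by case: (z k == l); rewrite mul1r ?mulr1 ?mulr0 ?p0 ?lexx.
have at_ n k : adapted k (t n k).
  exact: (@adapted_state R S c (@below R) n k (fun a y j => a%:R * (psi y * (j == l)%:R))).
(* Sampled at k+1: right end points give convergence, and their discount is below exp(-qu), so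
   [disc_weight] dominates. *)
pose b n k w : R := disc q n ^+ k.+1 * t n k.+1 (gpath phi n w).
have dk n k : 0 <= disc q n ^+ k <= 1.
  by rewrite exprn_ge0 ?(ltW (disc_gt0 q n))// exprn_ile1 ?(ltW (disc_gt0 q n))// disc_le1.
have b0B n k w : 0 <= b n k w <= B.
  have /andP[t0 tB] := t0B n k.+1 (gpath phi n w); have /andP[d0 d1] := dk n k.+1.
  by rewrite /b mulr_ge0//= -[leRHS]mul1r ler_pM.
have mb n k : measurable_fun setT (b n k).
  by apply: measurable_funM => //; exact: (adapted_measurable mc n (at_ n k.+1)).
pose G n (x : R * Omega) : R := stepf n (fun k => b n k x.2) x.1.
have GE n : (\int[pm]_x G n x = mesh R n * \sum_(k < nsteps n) disc q n ^+ k.+1 * Ex n (t n k.+1))%R.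
  rewrite (int_stepf n (mb n) (b0B n)); congr (_ * _); apply: eq_bigr => k _.
  by rewrite -(@ExZ _ _ _ _ _ _ _ _ mc n k.+1 _ _ (at_ n k.+1)).
have [N [mN N0 hN]] := good_paths_ae cad mc c0.
have Gcvg : {ae pm, forall x, setT x -> (fun n => G n x) @ \oo --> occ_fun l psi x}.
  exists ([set x | x.1%:E = tau x.2] `|` [set x | N x.2]); split.
  - apply: measurableU; first exact: (measurable_eq_tau cad mphi c0).
    by rewrite -[X in measurable X]setTI; apply: measurable_snd.
  - rewrite null_set_setU//.
    + exact: (measurable_eq_tau cad mphi c0).
    + by rewrite -[X in measurable X]setTI; apply: measurable_snd.
    + exact: null_eq_tau.
    + exact: null_cylinder.
  move=> [u w] /= /not_implyP[_ hc]; apply: contrapT => /not_orP[/= ut nw]; apply: hc.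
  have [h0 nj] := hN w nw.
  have cz : 0 < c (phi 0 w) by rewrite h0.
  have [u0|u0] := leP 0 u; last first.
    rewrite /occ_fun indicE memNset ?mul0r/=; last by move=> [+ _ _ _]; rewrite /= leNgt u0.
    apply: cvg_near_cst; near=> n; rewrite /G stepf_out//= => /andP[].
    by rewrite leNgt u0.
  have nE := near_stepfE (fun n k => b n k w) u0.
  have dl := @dlev_gidx_cvg R S c d Omega phi cad w u u0.
  have pl : (fun n => psi (dlev c (phi^~ w) n (gidx n u).+1)) @ \oo --> psi (lev c (phi^~ w) u).
    exact: (continuous_cvg _ (cpsi _) dl).
  have dd : (fun n => disc q n ^+ (gidx n u).+1) @ \oo --> expR (- (q * u)).
    apply/cvgrPdist_le => e e0; near=> n; rewrite discX.
    have /andP[r1 r2] := rpt_itv n u0.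
    apply: (le_trans (expR_lip q0 u0 (grid_ge0 _ _ _))).
    rewrite distrC ger0_norm ?subr_ge0 ?(ltW r1)//.
    rewrite -ler_pdivlMl// lerBlDl (le_trans r2)// lerD2l ltW//.
    by near: n; apply: near_mesh_lt; rewrite mulr_gt0// invr_gt0.
  have [ut'|tu] := ltP u%:E (tau w).
    have al := near_alive_before (zr w) c0 cz u0 ut'.
    have lu : 0 <= lev c (phi^~ w) u.
      have [->|uN0] := eqVneq u 0; first by rewrite (lev0 c (zr w) (lexx 0)) lexx.
      by apply/ltW/(lev_pos (zr w) c0 cz ut'); rewrite lexx andbT lt_neqAle eq_sym uN0.
    have -> : occ_fun l psi (u, w) = expR (- (q * u)) * (psi (lev c (phi^~ w) u) * (phi u w == l)%:R).
      rewrite /occ_fun indicE/=; case: eqP => ul; first by rewrite mem_set// mul1r mulr1.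
      by rewrite memNset ?mul0r ?mulr0// => -[_ _ _] /=.
    have : (fun n => disc q n ^+ (gidx n u).+1 * (psi (dlev c (phi^~ w) n (gidx n u).+1) * (phi u w == l)%:R))
       @ \oo --> expR (- (q * u)) * (psi (lev c (phi^~ w) u) * (phi u w == l)%:R).
      by apply: cvgM => //; apply: cvgMl.
    apply: cvg_trans; apply: near_eq_cvg; near=> n.
    rewrite /G/= (near nE n)// /b /t (near al n)// mul1r.
    by have -> : gpath phi n w (gidx n u).+1 = phi u w by near: n; exact: (near_rpt_const (zr w)).
  have tu' : (tau w < u%:E)%E.
    by rewrite lt_neqAle tu andbT; apply/eqP => E; apply: ut.
  have dead := near_dead_after (zr w) c0 cz nj tu'.
  rewrite /occ_fun indicE memNset ?mul0r/=; last by move=> [_ + _ _]; rewrite /= ltNge tu.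
  apply: cvg_near_cst; near=> n.
  by rewrite /G/= (near nE n)// /b /t (near dead n)// mul0r mulr0.
have Gb n x : setT x -> `|G n x| <= B * disc_weight x.
  move=> _; rewrite /G; have [xi|/negP xi] := boolP (0 <= x.1 < n.+1%:R); last first.
    by rewrite stepf_out// normr0 mulr_ge0// mulr_ge0 ?expR_ge0.
  rewrite stepfE//; have /andP[x0 _] := xi.
  rewrite /disc_weight indicE mem_set// mulr1.
  have /andP[t0 tB] := t0B n (gidx n x.1).+1 (gpath phi n x.2).
  rewrite /b ger0_norm; last by rewrite mulr_ge0// exprn_ge0// ltW// disc_gt0.
  rewrite mulrC ler_pM// ?exprn_ge0// ?(ltW (disc_gt0 q n))//.
  rewrite discX ler_expR lerN2 ler_wpM2l ?(ltW q0)//.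
  by have /andP[/ltW] := rpt_itv n x0.
have mG n : measurable_fun setT (G n) by exact: measurable_stepf2.
have ig : pm.-integrable setT (EFin \o (fun x => B * disc_weight x)).
  rewrite (_ : EFin \o _ = (fun x => B%:E * (EFin \o disc_weight) x)%E)//.
  by apply: integrableZl => //; exact: disc_weight_integrable.
have [_ Glim] := @Rintegral_dominated_cvg _ _ R pm _ _ _ _ measurableT mG (measurable_occ_fun l mpsi) Gcvg ig Gb.
(* Going back from k+1 to k telescopes, at a cost of at most 2 B times the mesh. *)
have e0 : (fun n => disc_occ n l psi - \int[pm]_x G n x)%R @ \oo --> (0 : R).
  apply/cvgrPdist_le => e e0; near=> n; have h0 := mesh_gt0 R n.
  rewrite sub0r normrN GE /disc_occ -mulrBr -sumrB.
  rewrite -(big_mkord xpredT (fun k => disc q n ^+ k * Ex n (t n k) - disc q n ^+ k.+1 * Ex n (t n k.+1))).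
  under eq_bigr do rewrite -opprB.
  rewrite sumrN telescope_sumr// opprB expr0 mul1r.
  have Eb k : `|Ex n (t n k)| <= B.
    apply: (@Ex_norm _ _ _ _ _ _ _ _ mc n k) => // z.
    by have /andP[t0 tB] := t0B n k z; rewrite ger0_norm.
  have : `|Ex n (t n 0%N) - disc q n ^+ nsteps n * Ex n (t n (nsteps n))| <= B + B.
    apply: (le_trans (ler_normB _ _)); rewrite lerD// normrM ger0_norm; last by have /andP[] := dk n (nsteps n).
    by rewrite -[leRHS]mul1r ler_pM//; have /andP[] := dk n (nsteps n).
  rewrite normrM gtr0_norm// => h.
  have hn : mesh R n < e / (B + B + 1).
    by near: n; apply: near_mesh_lt; rewrite divr_gt0// ltr_wpDl// addr_ge0.
  move: hn; rewrite ltr_pdivlMr ?ltr_wpDl ?addr_ge0// => hn.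
  apply: (@le_trans _ _ (mesh R n * (B + B))); first by rewrite ler_wpM2l// ltW.
  by nra.
have -> : (fun n => disc_occ n l psi) =
    (fun n => (disc_occ n l psi - \int[pm]_x G n x) + \int[pm]_x G n x)%R.
  by apply/funext => n; rewrite subrK.
by rewrite -[occ l psi]add0r; apply: cvgD.
Unshelve. all: by end_near. Qed.

Definition return_transform l : R := (\int[P]_w return_weight c q (phi^~ w) l)%R.

Lemma measurable_return_weight l : measurable_fun setT (fun w => return_weight c q (phi^~ w) l).
Proof.
rewrite (_ : (fun w => _) = fun w => expR (- (q * fine (tau w))) *
   \1_[set w | (tau w < +oo)%E /\ phi (fine (tau w)) w = l] w).
  apply: measurable_funM.
    apply: measurableT_comp => //; apply: measurableT_comp => //.
    apply: measurable_funM => //; apply: (measurableT_comp (@fine_measurable R setT measurableT)).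
    exact: (measurable_tau cad mphi c0).
  by apply: measurable_indic; exact: (measurable_return_event cad mphi c0).
apply/funext => w; rewrite /return_weight indicE.
case: ifPn => tw; last by rewrite memNset ?mulr0//= => -[]; rewrite (negbTE tw).
congr (_ * (nat_of_bool _)%:R); apply/eqP/idP => [h|]; first by rewrite inE.
by rewrite inE => -[].
Qed.

Lemma return_weight_bound w l : 0 <= return_weight c q (phi^~ w) l <= 1.
Proof.
rewrite /return_weight; case: ifPn => _; last by rewrite lexx ler01.
rewrite mulr_ge0 ?expR_ge0//= mulr_ile1 ?expR_ge0// ?lern1 ?leq_b1//.
rewrite -[leRHS]expR0 ler_expR oppr_le0 mulr_ge0 ?(ltW q0)//.
by apply: fine_ge0; apply: ltW; exact: (rtime_gt0 (zr w) c0).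
Qed.

Lemma kill_transform_cvg l :
  (fun n => Ex n (fun z => kill_sum c n (fun k => disc q n ^+ k * (z k == l)%:R) z (nsteps n))) @ \oo
  --> return_transform l.
Proof.
pose K n (z : nat -> S) : R := kill_sum c n (fun k => disc q n ^+ k * (z k == l)%:R) z (nsteps n).
have aK n : adapted (nsteps n) (K n).
  move=> z z' zz; apply: eq_bigr => k _; have kn := ltn_ord k.
  have := @adapted_step R S c (@below R) n k (fun a a' _ _ _ j => (a%:R - a'%:R) * (disc q n ^+ k.+1 * (j == l)%:R)) z z'.
  by apply=> i ik; apply: zz; exact: leq_trans kn.
have [N [mN N0 hN]] := good_paths_ae cad mc c0.
have mK n : measurable_fun setT (fun w => K n (gpath phi n w)) by exact: (adapted_measurable mc n (aK n)).
have Kcvg : {ae P, forall w, setT w -> (fun n => K n (gpath phi n w)) @ \oo --> return_weight c q (phi^~ w) l}.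
  exists N; split => // w /= /not_implyP[_ hc]; apply: contrapT => nw; apply: hc.
  have [h0 nj] := hN w nw.
  by apply: (kill_sum_cvg q0 (zr w) c0 _ nj); rewrite h0.
have i1 : P.-integrable setT (EFin \o (fun _ : Omega => 1 : R)).
  by apply: (@prob_integrable _ _ _ _ _ 1) => // w; rewrite normr1.
have Kb n w : setT w -> `|K n (gpath phi n w)| <= 1.
  move=> _; have := @kill_sum_close R S c n (fun k => disc q n ^+ k * (gpath phi n w k == l)%:R) (gpath phi n w) (nsteps n) 0 1 ler01.
  rewrite subr0; apply; last by left.
  move=> k _ _ _; rewrite subr0 ger0_norm; last by rewrite mulr_ge0// exprn_ge0// ltW// disc_gt0.
  by rewrite mulr_ile1// ?lern1 ?leq_b1// ?exprn_ge0// ?exprn_ile1// ?disc_le1// ltW// disc_gt0.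
by have [] := @Rintegral_dominated_cvg _ _ R P _ _ _ _ measurableT mK (measurable_return_weight l) Kcvg i1 Kb.
Qed.

End OccupationLimit.

Lemma Rintegral_eq_off_null d (U : measurableType d) (R : realType)
  (mu : {measure set U -> \bar R}) (N : set U) (f g : U -> R) :
  measurable N -> mu N = 0%E -> measurable_fun setT f -> measurable_fun setT g ->
  (forall w, ~ N w -> f w = g w) -> (\int[mu]_w f w = \int[mu]_w g w)%R.
Proof.
move=> mN N0 mf mg fg; rewrite /Rintegral; congr fine.
apply: ae_eq_integral => //; [exact/measurable_EFinP|exact/measurable_EFinP|].
by exists N; split => // w /= h; apply: contrapT => nw; apply: h => _; rewrite fg.
Qed.

(** * The limiting Dynkin formula and its two families of test functions *)

Section ReturnAndOccupation.
Variables (R : realType) (S : finType) (T : S -> S -> R) (c : S -> R).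
Variables (d : measure_display) (Omega : measurableType d) (phi : R -> Omega -> S).
Variables (s : S) (P : probability Omega R).
Hypotheses (cad : cadlag_step_paths phi) (mc : markov_chain_from T s P phi)
  (c0 : forall j, c j != 0) (cs : 0 < c s).
Variables (q : R) (q0 : 0 < q).

Let zr w := (cad w).1.
Local Notation alive := (alive c (@below R)).
Local Notation Ex := (@Ex R S d Omega phi P).
Local Notation rtr := (return_transform c phi P q).
Local Notation occ := (occ c phi P q).

Lemma return_transform_plus l : 0 < c l -> rtr l = 0.
Proof.
move=> cl; have [N [mN N0 hN]] := good_paths_ae cad mc c0.
rewrite /return_transform (@Rintegral_eq_off_null _ _ _ P N _ (fun=> 0))//.
- by rewrite Rintegral_cst// mul0r.
- exact: (measurable_return_weight cad mc c0).
move=> w /hN[h0 nj]; rewrite /return_weight; case: ifPn => // tlt.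
have [r r0 [E _]] := rtime_attained (zr w) c0 tlt.
have cz : 0 < c (phi 0 w) by rewrite h0.
have := rtime_rate_neg (zr w) c0 nj cz E; rewrite E /=.
by case: eqP => [->|]; rewrite ?mulr0// ltNge (ltW cl).
Qed.

Lemma Ex_start n (f : S -> R) : Ex n (fun z => f (z 0%N)) = f s.
Proof.
have [N [mN N0 hN]] := good_paths_ae cad mc c0.
have af : adapted 0 (fun z : nat -> S => f (z 0%N)) by move=> z z' zz; rewrite (zz 0%N).
rewrite /Ex (@Rintegral_eq_off_null _ _ _ P N _ (fun=> f s))//.
- by rewrite Rintegral_cst// [X in fine X](@probability_setT _ _ _ P) mulr1.
- exact: (adapted_measurable mc n af).
by move=> w /hN[h0 _]; rewrite /gpath mul0r h0.
Qed.

Definition disc_gen n (f g : R -> S -> R) : R := mesh R n * \sum_(k < nsteps n)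
  disc q n ^+ k * Ex n (fun z => (alive n z k)%:R * gen_apply T c q f g (walk c n z k) (z k)).

(** At killing, the step goes from y >= 0 to y + t <= 0, so both points are within one step of 0.
    The smoothness hypothesis is available at y only, hence f(y + t) and f(0) are both expanded
    about y. *)
Lemma kill_jump_close f g B n z k : smooth_on c (fun y => 0 <= y) f g B ->
  alive n z k -> ~~ alive n z k.+1 ->
  `|f (walk c n z k.+1) (z k.+1) - f 0 (z k.+1)| <= B * (2 * maxrate c + 2 * maxrate c ^+ 2) * mesh R n.
Proof.
move=> [B0 sm] ak; rewrite /= ak/= negbK /below walkS => ak'.
have y0 := alive_walk_ge0 ak; have h0 := mesh_gt0 R n; have h1 := mesh_le1 R n.
set y := walk c n z k in y0 ak' *; set t := mesh R n * c (z k) in ak' *.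
set j := z k.+1; set h := mesh R n in h0 h1 t ak' *.
pose M := maxrate c; have M0 : 0 <= M by exact: maxrate_ge0.
have tM : `|t| <= h * M by rewrite /t normrM gtr0_norm// ler_wpM2l ?(ltW h0)// le_maxrate.
have hM : h * M <= M by rewrite ler_piMl.
have [gB ft] := sm y j y0.
have [_ f1] := ft t (le_trans tM hM).
have yM : `|- y| <= h * M.
  rewrite normrN ger0_norm//; apply: le_trans tM; rewrite -normrN; apply: le_trans (ler_norm _).
  by rewrite lerNr; move: ak'; lra.
have [_ f2] := ft (- y) (le_trans yM hM); rewrite subrr in f2.
have -> : f (y + t) j - f 0 j = (f (y + t) j - f y j - t * g y j) - (f 0 j - f y j - - y * g y j) + (t + y) * g y j by ring.
apply: (le_trans (ler_normD _ _)); apply: (@le_trans _ _ (B * t ^+ 2 + B * (- y) ^+ 2 + (h * M + h * M) * B)).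
  rewrite lerD//; first by apply: (le_trans (ler_normB _ _)); rewrite lerD.
  rewrite normrM ler_pM//; apply: (le_trans (ler_normD _ _)); rewrite lerD// -normrN//.
have e1 : t ^+ 2 <= h * M ^+ 2.
  rewrite -(real_normK (num_real t)); apply: (@le_trans _ _ ((h * M) ^+ 2)); first by rewrite ler_sqr ?nnegrE// mulr_ge0// ltW.
  by rewrite exprMn ler_wpM2r ?sqr_ge0// expr2 ler_piMl// ltW.
have e2 : (- y) ^+ 2 <= h * M ^+ 2.
  rewrite -(real_normK (num_real (- y))); apply: (@le_trans _ _ ((h * M) ^+ 2)); first by rewrite ler_sqr ?nnegrE// mulr_ge0// ltW.
  by rewrite exprMn ler_wpM2r ?sqr_ge0// expr2 ler_piMl// ltW.
have := ler_wpM2l B0 e1; have := ler_wpM2l B0 e2; rewrite -/M; lra.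
Qed.

Lemma disc_nsteps n : disc q n ^+ nsteps n <= q^-1 * mesh R n.
Proof.
rewrite discX nsteps_mesh expRN -invfM lef_pV2 ?posrE ?expR_gt0 ?mulr_gt0//.
by have := @expR_ge1Dx _ (q * n.+1%:R); apply: le_trans; rewrite lerDr.
Qed.

Lemma kill_term_adapted n l : adapted (nsteps n)
  (fun z => kill_sum c n (fun k => disc q n ^+ k * (z k == l)%:R) z (nsteps n)).
Proof.
move=> z z' zz; apply: eq_bigr => k _; have kn := ltn_ord k.
have := @adapted_step R S c (@below R) n k (fun a a' _ _ _ j => (a%:R - a'%:R) * (disc q n ^+ k.+1 * (j == l)%:R)) z z'.
by apply=> i ik; apply: zz; exact: leq_trans kn.
Qed.

Lemma dynkin_limit f g B : smooth_on c (fun y => 0 <= y) f g B ->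
  (fun n => disc_gen n f g) @ \oo --> \sum_l f 0 l * rtr l - f 0 s.
Proof.
move=> sm.
have sm' : smooth_on c (fun y => (y == 0) || ~~ below y) f g B.
  split; first exact: sm.1.
  by move=> y j hy; apply: sm.2; move: hy; rewrite /below -ltNge => /orP[/eqP ->//|/ltW].
have [C [C0 hC]] := dynkin_discrete mc q0 sm'.
pose Kl n l := Ex n (fun z => kill_sum c n (fun k => disc q n ^+ k * (z k == l)%:R) z (nsteps n)).
have Kcvg : (fun n => \sum_l f 0 l * Kl n l - f 0 s) @ \oo --> \sum_l f 0 l * rtr l - f 0 s.
  apply: cvgB; last exact: cvg_cst.
  apply: cvg_big => [x|]; first exact: add_continuous.
  move=> l _; apply: cvgM; first exact: cvg_cst.
  exact: (kill_transform_cvg cad mc c0 cs q0).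
pose L := B * (2 * maxrate c + 2 * maxrate c ^+ 2).
(* The Dynkin error, the survivors at the horizon ([disc_nsteps]) and the overshoot at killing, each
   per unit of mesh. *)
pose C' := C + (B * q^-1 + L).
have B0 := sm.1; have M0 := maxrate_ge0 c.
have L0 : 0 <= L by rewrite mulr_ge0// addr_ge0// mulr_ge0// sqr_ge0.
have close n : `|disc_gen n f g - (\sum_l f 0 l * Kl n l - f 0 s)| <= C' * mesh R n.
  have h0 := mesh_gt0 R n; pose N := nsteps n.
  have := hC n N; rewrite -/(disc_gen n f g).
  set F := (fun z => _) => h1.
  pose G z := \sum_l f 0 l * kill_sum c n (fun k => disc q n ^+ k * (z k == l)%:R) z N - f 0 (z 0%N).
  have aG1 l : adapted N (fun z => f 0 l * kill_sum c n (fun k => disc q n ^+ k * (z k == l)%:R) z N).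
    by move=> z z' zz; rewrite (kill_term_adapted l zz).
  have aG2 : adapted N (fun z : nat -> S => f 0 (z 0%N)) by move=> z z' zz; rewrite (zz 0%N).
  have aG3 : adapted N (fun z => \sum_l f 0 l * kill_sum c n (fun k => disc q n ^+ k * (z k == l)%:R) z N).
    by move=> z z' zz; apply: eq_bigr => l _; exact: aG1.
  have EG : Ex n G = \sum_l f 0 l * Kl n l - f 0 s.
    rewrite (@ExB _ _ _ _ _ _ _ _ mc n N _ _ aG3 aG2) (@Ex_start n (f 0)).
    rewrite (@Ex_sum _ _ _ _ _ _ _ _ mc n N _ _ _ _ aG1); congr (_ - _); apply: eq_bigr => l _.
    by rewrite (@ExZ _ _ _ _ _ _ _ _ mc n N _ _ (kill_term_adapted (n := n) l)).
  have aF : adapted N F.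
    move=> z z' zz; rewrite /F (zz 0%N)//; congr (_ + _ - _).
      exact: (@adapted_state R S c (@below R) n N (fun a x j => disc q n ^+ N * a%:R * f x j) z z' zz).
    apply: eq_bigr => k _; have kn := ltn_ord k.
    have := @adapted_step R S c (@below R) n k (fun a a' _ x _ j => (a%:R - a'%:R) * (disc q n ^+ k.+1 * f x j)) z z'.
    by apply=> i ik; apply: zz; exact: leq_trans kn.
  have aG : adapted N G by move=> z z' zz; rewrite /G (aG3 _ _ zz) (aG2 _ _ zz).
  have FG : `|Ex n F - Ex n G| <= (B * q^-1 + L) * mesh R n.
    rewrite -(@ExB _ _ _ _ _ _ _ _ mc n N _ _ aF aG).
    apply: (@Ex_norm _ _ _ _ _ _ _ _ mc n N); first by move=> z z' zz; rewrite (aF _ _ zz) (aG _ _ zz).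
    move=> z; rewrite /F /G.
    pose D := kill_sum c n (fun k => disc q n ^+ k * (f (walk c n z k) (z k) - f 0 (z k))) z N.
    have -> : \sum_l f 0 l * kill_sum c n (fun k => disc q n ^+ k * (z k == l)%:R) z N =
       kill_sum c n (fun k => disc q n ^+ k * f 0 (z k)) z N.
      rewrite /kill_sum; under eq_bigr do rewrite mulr_sumr.
      rewrite exchange_big; apply: eq_bigr => k _ /=.
      rewrite (bigD1 (z k.+1))//= eqxx mulr1 big1 ?addr0; first by ring.
      by move=> l lz; rewrite eq_sym (negbTE lz) !mulr0.
    have -> : \sum_(k < N) ((alive n z k)%:R - (alive n z k.+1)%:R) * (disc q n ^+ k.+1 * f (walk c n z k.+1) (z k.+1))
       = D + kill_sum c n (fun k => disc q n ^+ k * f 0 (z k)) z N.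
      by rewrite /D /kill_sum -big_split/=; apply: eq_bigr => k _; ring.
    have DL : `|D| <= L * mesh R n.
      rewrite -[D]subr0; apply: kill_sum_close; [by rewrite mulr_ge0// ltW| |by left].
      move=> k kN ak ak'; rewrite subr0 normrM ger0_norm ?exprn_ge0 ?(ltW (disc_gt0 q n))//.
      rewrite -[leRHS]mul1r ler_pM ?exprn_ge0 ?(ltW (disc_gt0 q n)) ?exprn_ile1 ?disc_le1//.
        by rewrite ltW// disc_gt0.
      exact: (kill_jump_close sm ak ak').
    have DA : `|disc q n ^+ N * (alive n z N)%:R * f (walk c n z N) (z N)| <= B * q^-1 * mesh R n.
      case: (boolP (alive n z N)) => al; last by rewrite mulr0 mul0r normr0 !mulr_ge0 ?invr_ge0 ?(ltW q0) ?(ltW h0).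
      rewrite mulr1 normrM ger0_norm ?exprn_ge0 ?(ltW (disc_gt0 q n))// -mulrA mulrC ler_pM//.
      - by rewrite exprn_ge0// ltW// disc_gt0.
      - have [_ /(_ 0)] := sm.2 _ (z N) (alive_walk_ge0 al).
        by rewrite normr0 addr0 => /(_ M0)[].
      - exact: disc_nsteps.
    rewrite [X in `|X|](_ : _ = disc q n ^+ N * (alive n z N)%:R * f (walk c n z N) (z N) + D); last by ring.
    by apply: (le_trans (ler_normD _ _)); rewrite mulrDl lerD.
  rewrite -EG (_ : disc_gen n f g - Ex n G = (Ex n F - Ex n G) - (Ex n F - disc_gen n f g)); last by ring.
  by apply: (le_trans (ler_normB _ _)); rewrite /C' mulrDl addrC lerD.
have C'0 : 0 <= C' by rewrite !addr_ge0// mulr_ge0// invr_ge0 ltW.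
have d0 : (fun n => disc_gen n f g - (\sum_l f 0 l * Kl n l - f 0 s)) @ \oo --> (0 : R).
  apply/cvgrPdist_le => e e0; near=> n; rewrite sub0r normrN; apply: (le_trans (close n)).
  have hn : mesh R n < e / (C' + 1) by near: n; apply: near_mesh_lt; rewrite divr_gt0// ltr_wpDl.
  move: hn; rewrite ltr_pdivlMr ?ltr_wpDl// => hn; have := mesh_gt0 R n; lra.
have -> : (fun n => disc_gen n f g) = (fun n => (disc_gen n f g - (\sum_l f 0 l * Kl n l - f 0 s)) +
    (\sum_l f 0 l * Kl n l - f 0 s)) by apply/funext => n; rewrite subrK.
by rewrite -[X in _ --> X]add0r; apply: cvgD.
Unshelve. all: by end_near. Qed.

(** The generator annihilates [harm], so only boundary values remain: at level 0 it is 1{j = l} on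
    S_-, the only phases of return, and it starts from [Y s l]. In particular the substochastic
    solution is unique on S_+ x S_-. *)
Lemma return_transform_riccati (Y : S -> S -> R) l :
  generator T ->
  (forall i j, i \in Splus c -> j \in Sminus c -> 0 <= Y i j) ->
  (forall i, i \in Splus c -> \sum_(j in Sminus c) Y i j <= 1) ->
  (forall i j, i \in Splus c -> j \in Sminus c ->
        riccati T c Y i j = q * (`|c i|^-1 + `|c j|^-1) * Y i j) ->
  l \in Sminus c -> rtr l = Y s l.
Proof.
move=> Tgen Y0 Y1 Yric lm.
have [B [B0 hB]] := harm_bound Tgen c0 q0 Y0 Y1 l (maxrate_ge0 c).
pose f y j := harm T c q Y l y j; pose g y j := harm_drv T c q Y l y j.
have sm : smooth_on c (fun y => 0 <= y) f g B.
  split => // y j y0; have M0 := maxrate_ge0 c.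
  have yM : - maxrate c <= y by rewrite (le_trans _ y0)// oppr_le0.
  have [_ gB tB] := hB y j yM; split => // t; rewrite ler_norml => /andP[t1 t2].
  have yt : - maxrate c <= y + t by rewrite (le_trans t1)// lerDr.
  by have [fB _ _] := hB (y + t) j yt; split => //; exact: tB.
have := dynkin_limit sm.
have -> : (fun n => disc_gen n f g) = cst 0.
  apply/funext => n; rewrite /disc_gen big1 ?mulr0// => k _.
  rewrite (_ : (fun z => _) = fun=> 0); last first.
    by apply/funext => z; rewrite /gen_apply /f /g harm_eq// mulr0.
  by rewrite /Ex Rintegral_cst// mul0r mulr0.
move=> /(cvg_unique _ (cvg_cst _)) => /(_ (@Rhausdorff R)).
rewrite /f harm0_plus ?inE//.
rewrite (sum_Splus_Sminus c0) (bigD1 l)//= harm0// eqxx mul1r.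
rewrite big1 ?addr0; last by move=> j /andP[jm jl]; rewrite harm0// eq_sym (negbTE jl) mul0r.
rewrite big1 ?addr0; last by move=> j; rewrite inE => jp; rewrite return_transform_plus ?mulr0.
by move/esym/eqP; rewrite subr_eq0 => /eqP.
Qed.

(* Applied to [ramp2 x] in phase l, the generator produces [ramp x] and [ramp2 x]
   only, which gives a closed linear system for their occupation integrals. *)
Definition ramp (x y : R) : R := Num.max (x - y) 0.
Definition ramp2 (x y : R) : R := ramp x y ^+ 2 / 2.

Lemma ramp_ge0 x y : 0 <= ramp x y. Proof. by rewrite le_max lexx orbT. Qed.

Lemma ramp_case x y : (y <= x /\ ramp x y = x - y) \/ (x < y /\ ramp x y = 0).
Proof.
rewrite /ramp; have [xy|xy] := leP y x; [left|right]; split => //.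
  by apply/max_idPl; rewrite subr_ge0.
by apply/max_idPr; rewrite subr_le0 ltW.
Qed.

Lemma ramp_le x y : 0 <= x -> 0 <= y -> ramp x y <= x.
Proof. by move=> x0 y0; case: (ramp_case x y) => -[? ->] //; lra. Qed.

Lemma ramp2_taylor x y t : `|ramp2 x (y + t) - ramp2 x y - t * - ramp x y| <= 1 * t ^+ 2.
Proof.
rewrite mul1r /ramp2; case: (ramp_case x y) => -[h1 ->]; case: (ramp_case x (y + t)) => -[h2 ->];
  by rewrite ler_norml; apply/andP; split; nra.
Qed.

Lemma ramp2_shift x y e : `|ramp2 (x + e) y - ramp2 x y - e * ramp x y| <= e ^+ 2.
Proof.
rewrite /ramp2; case: (ramp_case x y) => -[h1 ->]; case: (ramp_case (x + e) y) => -[h2 ->];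
  by rewrite ler_norml; apply/andP; split; nra.
Qed.

Lemma continuous_ramp x : continuous (ramp x).
Proof.
move=> y; apply: (@continuous_max _ _ (fun y => x - y) (fun=> 0)).
  by apply: continuousB; [exact: cst_continuous|exact: id].
exact: cst_continuous.
Qed.

Lemma continuous_ramp2 x : continuous (ramp2 x).
Proof.
move=> y; apply: (@cvgM _ _ _ _ (fun y => ramp x y ^+ 2) (fun=> 2^-1)); last exact: cvg_cst.
by apply: (@cvgM _ _ _ _ (ramp x) (ramp x)); exact: continuous_ramp.
Qed.

(** A version of the flux system integrated twice in x, obtained without any prior regularity of
    sojourn times in x. *)
Lemma ramp_occ_eq x l : 0 <= x -> c l * occ l (ramp x) =
  ((s == l)%:R - rtr l) * (x ^+ 2 / 2) + \sum_m T m l * occ m (ramp2 x) - q * occ l (ramp2 x).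
Proof.
move=> x0; pose M := maxrate c; have M0 : 0 <= M := maxrate_ge0 c.
pose f y j := ramp2 x y * (j == l)%:R; pose g y j := - ramp x y * (j == l)%:R.
(* [ramp2] is unbounded below level 0, but points reached in one step are above -M. The three terms
   bound the derivative, the values and the Taylor constant. *)
have sm : smooth_on c (fun y => 0 <= y) f g (x + (x + M) ^+ 2 + 1).
  have B0 : 0 <= x + (x + M) ^+ 2 + 1 by rewrite !addr_ge0// sqr_ge0.
  split => // y j y0; rewrite /f /g; case: (j == l); rewrite ?mulr0 ?normr0; last first.
    by split => // t _; rewrite !mulr0 !subr0 normr0; split => //; rewrite mulr_ge0// sqr_ge0.
  rewrite !mulr1; split.
    rewrite normrN ger0_norm ?ramp_ge0// (le_trans (ramp_le x0 y0))//; have := sqr_ge0 (x + M); lra.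
  move=> t; rewrite ler_norml -/M => /andP[t1 t2]; rewrite !mulr1; split.
    rewrite ger0_norm /ramp2; last by rewrite divr_ge0// sqr_ge0.
    have h : ramp x (y + t) <= x + M by case: (ramp_case x (y + t)) => -[? ->]; lra.
    have := ramp_ge0 x (y + t); have := sqr_ge0 (x + M); nra.
  apply: (le_trans (ramp2_taylor _ _ _)); rewrite ler_wpM2r ?sqr_ge0//; have := sqr_ge0 (x + M); lra.
have := dynkin_limit sm.
have cr y : 0 <= y -> 0 <= ramp x y <= x by move=> y0; rewrite ramp_ge0 ramp_le.
have cr2 y : 0 <= y -> 0 <= ramp2 x y <= x ^+ 2.
  move=> y0; have /andP[r0 r1] := cr y y0; rewrite /ramp2 divr_ge0 ?sqr_ge0//=; nra.
have L1 := disc_occ_cvg cad mc c0 cs q0 (l := l) (@continuous_ramp x) cr.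
have L2 m := disc_occ_cvg cad mc c0 cs q0 (l := m) (@continuous_ramp2 x) cr2.
have a1 n k (psi : R -> R) m : adapted k (fun z => (alive n z k)%:R * (psi (walk c n z k) * (z k == m)%:R)).
  exact: (@adapted_state R S c (@below R) n k (fun a y j => a%:R * (psi y * (j == m)%:R))).
have -> : (fun n => disc_gen n f g) = (fun n => - c l * disc_occ c phi P q n l (ramp x) +
   \sum_m T m l * disc_occ c phi P q n m (ramp2 x) - q * disc_occ c phi P q n l (ramp2 x)).
  apply/funext => n; rewrite /disc_gen /disc_occ.
  pose e1 k := Ex n (fun z => (alive n z k)%:R * (ramp x (walk c n z k) * (z k == l)%:R)).
  pose e2 m k := Ex n (fun z => (alive n z k)%:R * (ramp2 x (walk c n z k) * (z k == m)%:R)).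
  transitivity (mesh R n * \sum_(k < nsteps n) disc q n ^+ k * (- c l * e1 k + \sum_m T m l * e2 m k - q * e2 l k)).
    congr (_ * _); apply: eq_bigr => k _; congr (_ * _).
    rewrite /e1 /e2 -(@ExZ _ _ _ _ _ _ _ _ mc n k (- c l) _ (a1 n k _ l)) -(@ExZ _ _ _ _ _ _ _ _ mc n k q _ (a1 n k _ l)).
    under eq_bigr do rewrite -(@ExZ _ _ _ _ _ _ _ _ mc n k _ _ (a1 n k _ _)).
    have b1 a (psi : R -> R) m : adapted k (fun z => a * ((alive n z k)%:R * (psi (walk c n z k) * (z k == m)%:R))).
      by move=> z z' zz; rewrite (a1 n k psi m z z' zz).
    rewrite -(@Ex_sum _ _ _ _ _ _ _ _ mc n k _ _ _ _ (fun m => b1 (T m l) (ramp2 x) m)).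
    have b2 : adapted k (fun z => \sum_m T m l * ((alive n z k)%:R * (ramp2 x (walk c n z k) * (z k == m)%:R))).
      by move=> z z' zz; apply: eq_bigr => m _; exact: b1.
    rewrite -(@ExD _ _ _ _ _ _ _ _ mc n k _ _ (b1 _ _ _) b2).
    rewrite -(@ExB _ _ _ _ _ _ _ _ mc n k _ _ _ (b1 _ _ _)); last first.
      by move=> z z' zz; rewrite (b1 _ _ _ z z' zz) (b2 z z' zz).
    congr (Ex n _); apply/funext => z; rewrite /gen_apply /f /g.
    rewrite (bigD1 l)//= eqxx big1 ?addr0; last by move=> m ml; rewrite (negbTE ml) !mulr0.
    rewrite [in RHS](bigD1 (z k))//= eqxx big1 ?addr0; last first.
      by move=> m mz; rewrite eq_sym (negbTE mz) !mulr0.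
    by case: (z k =P l) => [->|_] /=; ring.
  rewrite /e1 /e2 !mulr_sumr -/(e1 _).
  under [X in _ = _ + X - _]eq_bigr do rewrite mulr_sumr mulr_sumr.
  rewrite exchange_big/= -big_split/= -sumrB; apply: eq_bigr => k _.
  rewrite -/(e1 k).
  rewrite [in RHS](_ : \sum_i _ = mesh R n * (disc q n ^+ k * \sum_m T m l * e2 m k)); first by rewrite /e1 /e2; ring.
  by rewrite !mulr_sumr; apply: eq_bigr => m _; rewrite /e2; ring.
have L3 : (fun n => - c l * disc_occ c phi P q n l (ramp x) +
   \sum_m T m l * disc_occ c phi P q n m (ramp2 x) - q * disc_occ c phi P q n l (ramp2 x)) @ \oo -->
   - c l * occ l (ramp x) + \sum_m T m l * occ m (ramp2 x) - q * occ l (ramp2 x).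
  apply: cvgB; last by apply: cvgM; [exact: cvg_cst|exact: L2].
  apply: cvgD; first by apply: cvgM; [exact: cvg_cst|exact: L1].
  apply: cvg_big => [v|m _]; first exact: add_continuous.
  by apply: cvgM; [exact: cvg_cst|exact: L2].
move=> /(cvg_unique _ L3) => /(_ (@Rhausdorff R)).
have -> : \sum_m f 0 m * rtr m = ramp2 x 0 * rtr l.
  rewrite (bigD1 l)//= big1 /f ?eqxx ?addr0 ?mulr1//.
  by move=> m ml; rewrite (negbTE ml) mulr0 mul0r.
rewrite /f.
have -> : ramp2 x 0 = x ^+ 2 / 2.
  by rewrite /ramp2; case: (ramp_case x 0) => -[? ->]; rewrite ?subr0//; lra.
lra.
Qed.

End ReturnAndOccupation.

(** * Sojourn times before the return *)

Section FluxEquation.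
Variables (R : realType) (S : finType) (T : S -> S -> R) (c : S -> R).
Variables (d : measure_display) (Omega : measurableType d) (phi : R -> Omega -> S).
Variables (s : S) (P : probability Omega R).
Hypotheses (cad : cadlag_step_paths phi) (mc : markov_chain_from T s P phi)
  (c0 : forall j, c j != 0) (cs : 0 < c s).
Variables (q : R) (q0 : 0 < q).
Implicit Types (x y h : R) (l : S).

Local Notation pm := (@lebesgue_measure R \x P)%E.
Local Notation rtr := (return_transform c phi P q).
Local Notation occ := (occ c phi P q).

Definition bounded_test (psi : R -> R) := measurable_fun setT psi /\
  exists B, forall y, 0 <= y -> `|psi y| <= B.

Lemma bounded_test_cst a : bounded_test (fun=> a).
Proof. by split; [exact: measurable_cst|exists `|a|]. Qed.

Lemma bounded_testD psi1 psi2 : bounded_test psi1 -> bounded_test psi2 ->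
  bounded_test (fun y => psi1 y + psi2 y).
Proof.
move=> [m1 [B1 h1]] [m2 [B2 h2]]; split; first exact: measurable_funD.
by exists (B1 + B2) => y y0; apply: (le_trans (ler_normD _ _)); rewrite lerD ?h1 ?h2.
Qed.

Lemma bounded_testZ a psi : bounded_test psi -> bounded_test (fun y => a * psi y).
Proof.
move=> [m1 [B1 h1]]; split; first exact: measurable_funM.
by exists (`|a| * B1) => y y0; rewrite normrM ler_wpM2l// h1.
Qed.

Lemma occ_integrable l psi : bounded_test psi ->
  pm.-integrable setT (EFin \o occ_fun c phi q l psi).
Proof. by move=> [m1 [B1 h1]]; exact: (occ_fun_integrable cad mc c0 q0 l m1 h1). Qed.

Lemma occD l psi1 psi2 : bounded_test psi1 -> bounded_test psi2 ->
  occ l (fun y => psi1 y + psi2 y) = occ l psi1 + occ l psi2.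
Proof.
move=> b1 b2; rewrite /occ -RintegralD//; [|exact: occ_integrable..].
by apply: eq_Rintegral => x _; rewrite /occ_fun mulrDr mulrDr.
Qed.

Lemma occZ l a psi : bounded_test psi -> occ l (fun y => a * psi y) = a * occ l psi.
Proof.
move=> b1; rewrite /occ -RintegralZl//; [|exact: occ_integrable..].
by apply: eq_Rintegral => x _; rewrite /occ_fun; ring.
Qed.

Lemma occ_le l psi1 psi2 : bounded_test psi1 -> bounded_test psi2 ->
  (forall y, 0 <= y -> psi1 y <= psi2 y) -> occ l psi1 <= occ l psi2.
Proof.
move=> b1 b2 h; apply: le_Rintegral => //; [exact: occ_integrable..|].
move=> x _; rewrite /occ_fun indicE; case: (boolP (_ \in _)); last by rewrite !mul0r.
by rewrite inE => -[_ _ x0 _]; rewrite !mul1r ler_wpM2l ?expR_ge0// h.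
Qed.

Lemma occ_close l psi psi1 psi2 a b e :
  bounded_test psi -> bounded_test psi1 -> bounded_test psi2 ->
  (forall y, 0 <= y -> `|psi y - (a * psi1 y + b * psi2 y)| <= e) ->
  `|occ l psi - (a * occ l psi1 + b * occ l psi2)| <= e * occ l (fun=> 1).
Proof.
move=> b0 b1 b2 h.
have bz := bounded_testD (bounded_testZ a b1) (bounded_testZ b b2).
have be := bounded_testZ e (bounded_test_cst 1).
have bn := bounded_testZ (- e) (bounded_test_cst 1).
rewrite -(occZ l a b1) -(occZ l b b2) -occD; [|exact: bounded_testZ..].
rewrite ler_norml -mulNr -!(occZ _ _ (bounded_test_cst 1)) lerBrDl lerBlDl -!occD//.
apply/andP; split; apply: occ_le => //; try exact: bounded_testD.
  by move=> y y0; have := h y y0; rewrite ler_norml => /andP[? ?]; lra.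
by move=> y y0; have := h y y0; rewrite ler_norml => /andP[? ?]; lra.
Qed.

Lemma bounded_test_ramp x : bounded_test (ramp x).
Proof.
split; first by apply: continuous_measurable_fun; exact: continuous_ramp.
exists `|x| => y y0; rewrite ger0_norm ?ramp_ge0//.
have := ler_norm x; have := normr_ge0 x; case: (ramp_case x y) => -[? ->]; lra.
Qed.

Lemma bounded_test_ramp2 x : bounded_test (ramp2 x).
Proof.
split; first by apply: continuous_measurable_fun; exact: continuous_ramp2.
have [_ [B hB]] := bounded_test_ramp x; exists (B * B) => y y0.
have := hB y y0; rewrite ger0_norm ?ramp_ge0// => h.
rewrite ger0_norm /ramp2; last by rewrite divr_ge0// sqr_ge0.
by have := ramp_ge0 x y; nra.
Qed.

Lemma bounded_test_le x : bounded_test (fun y : R => (y <= x)%R%:R).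
Proof.
split; last by exists 1 => y _; rewrite normr_nat lern1 leq_b1.
rewrite (_ : (fun y => _) = \1_(`]-oo, x]%classic : set R)); last first.
  by apply/funext => y; rewrite indicE; congr (nat_of_bool _)%:R; apply/idP/idP; rewrite inE/= in_itv.
exact: measurable_indic.
Qed.

Lemma is_derive_quadratic (F : R -> R) x D K :
  (forall h, `|F (x + h) - F x - h * D| <= K * h ^+ 2) -> is_derive x (1 : R) F D.
Proof.
move=> hF.
have K0 : 0 <= K by have := hF 1; rewrite expr1n mulr1; exact: le_trans.
have lim0 : h^-1 *: ((F \o shift x) (h *: (1 : R)) - F x) @[h --> 0^'] --> D.
  apply/cvgrPdist_le => e e0; near=> h.
  have h0 : h != 0 by near: h; exact: nbhs_dnbhs_neq.
  have hs : `|h| <= e / (K + 1).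
    near: h; apply: dnbhs0_le; by rewrite divr_gt0// ltr_wpDl.
  rewrite /GRing.scale/= mulr1 [h + x]addrC.
  rewrite (_ : D - _ = - (h^-1 * (F (x + h) - F x - h * D))); last by field.
  rewrite normrN normrM normfV ler_pdivrMl ?normr_gt0//; apply: (le_trans (hF h)).
  rewrite -(real_normK (num_real h)) mulrC expr2 -mulrA ler_wpM2l//.
  move: hs; rewrite ler_pdivlMr ?ltr_wpDl// => hs; have := normr_ge0 h; nra.
by apply: DeriveDef; [exact: (cvgP D)|exact: cvg_lim].
Unshelve. all: by end_near. Qed.

Lemma is_derive_occ_ramp2 l x : is_derive x (1 : R) (fun x => occ l (ramp2 x)) (occ l (ramp x)).
Proof.
apply: (@is_derive_quadratic _ _ _ (occ l (fun=> 1))) => h.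
rewrite (_ : _ - _ - _ = occ l (ramp2 (x + h)) - (1 * occ l (ramp2 x) + h * occ l (ramp x))); last by ring.
rewrite [leRHS]mulrC; apply: occ_close; [exact: bounded_test_ramp2..|exact: bounded_test_ramp|].
by move=> y y0; rewrite mul1r opprD addrA; exact: ramp2_shift.
Qed.

Lemma ramp_shift x y h : `|ramp (x + h) y - ramp x y| <= `|h|.
Proof.
have := ler_norm h; have := ler_norm (- h); rewrite normrN => ? ?.
by case: (ramp_case x y) => -[h1 ->]; case: (ramp_case (x + h) y) => -[h2 ->];
  rewrite ler_norml; apply/andP; split; lra.
Qed.

Lemma occ_ramp_lip l x h : `|occ l (ramp (x + h)) - occ l (ramp x)| <= `|h| * occ l (fun=> 1).
Proof.
have := @occ_close l (ramp (x + h)) (ramp x) (ramp x) 1 0 `|h|.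
rewrite mul1r mul0r addr0; apply; [exact: bounded_test_ramp..|].
by move=> y y0; rewrite mul1r mul0r addr0; exact: ramp_shift.
Qed.

Lemma continuous_occ_ramp l : continuous (fun x => occ l (ramp x)).
Proof.
have W0 : 0 <= occ l (fun=> 1).
  by have := occ_ramp_lip l 0 1; rewrite normr1 mul1r; exact: le_trans.
move=> x; apply/cvgrPdist_le => e e0; near=> y.
have -> : y = x + (y - x) by ring.
rewrite distrC; apply: (le_trans (occ_ramp_lip l x (y - x))).
have : `|x - y| <= e / (occ l (fun=> 1) + 1).
  near: y; have /cvgrPdist_le := @cvg_id _ (nbhs x); apply; by rewrite divr_gt0// ltr_wpDl.
by rewrite ler_pdivlMr ?ltr_wpDl// [`|x - y|]distrC; have := normr_ge0 (y - x); nra.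
Unshelve. all: by end_near. Qed.

Lemma occ_ramp0 l : occ l (ramp 0) = 0.
Proof.
have := @occ_close l (ramp 0) (ramp 0) (ramp 0) 0 0 0.
rewrite !mul0r addr0 subr0 normr_le0 => h; apply/eqP; apply: h; try exact: bounded_test_ramp.
move=> y y0; rewrite !mul0r addr0 subr0; case: (ramp_case 0 y) => -[h ->]; rewrite ?normr0//.
by have -> : y = 0; [lra|rewrite subr0 normr0].
Qed.

(* By [flux_occ], c_l times the discounted mean sojourn time in phase l and levels [0, x]. *)
Definition flux l x : R := ((s == l)%:R - rtr l) * x + \sum_m T m l * occ m (ramp x) - q * occ l (ramp x).

Lemma flux0 l : flux l 0 = 0.
Proof.
rewrite /flux occ_ramp0 !mulr0 big1 ?addr0 ?subr0// => m _.
by rewrite occ_ramp0 mulr0.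
Qed.

Lemma continuous_flux l : continuous (flux l).
Proof.
move=> x; apply: cvgB; last first.
  by apply: cvgM; [exact: cvg_cst|exact: continuous_occ_ramp].
apply: cvgD; first by apply: cvgM; [exact: cvg_cst|exact: cvg_id].
apply: cvg_big => [v|m _]; first exact: add_continuous.
by apply: cvgM; [exact: cvg_cst|exact: continuous_occ_ramp].
Qed.

(** A bootstrap: [ramp_occ_eq] expresses this function through the occupations of [ramp2], already
    known to be differentiable. The identity must hold around x, whence x > 0. *)
Lemma is_derive_occ_ramp l x : 0 < x ->
  is_derive x (1 : R) (fun x => occ l (ramp x)) (flux l x / c l).
Proof.
move=> x0.
have der : is_derive x (1 : R) (fun x => ((s == l)%:R - rtr l) * (x ^+ 2 / 2) +
  \sum_m T m l * occ m (ramp2 x) - q * occ l (ramp2 x)) (flux l x).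
  have D1 : is_derive x (1 : R) (fun x => ((s == l)%:R - rtr l) * (x ^+ 2 / 2)) (((s == l)%:R - rtr l) * x).
    apply: is_derive_eq (drvZ _ (drvM (drvM (drv_id x) (drv_id x)) (drv_cst x 2^-1))) _; lra.
  have D2 m : is_derive x (1 : R) (fun x => T m l * occ m (ramp2 x)) (T m l * occ m (ramp x)).
    exact: drvZ (is_derive_occ_ramp2 m x).
  have D3 : is_derive x (1 : R) (fun x => \sum_m T m l * occ m (ramp2 x)) (\sum_m T m l * occ m (ramp x)).
    by apply: drv_sum => m _; exact: D2.
  exact: (drvB (drvD D1 D3) (drvZ q (is_derive_occ_ramp2 l x))).
have der' := drvM der (drv_cst x (c l)^-1).
apply: is_derive_eq.
  apply: (near_eq_is_derive _ der').
  near=> y; have y0 : 0 <= y by apply: ltW; near: y; exact: lt_nbhsr.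
  by rewrite -(ramp_occ_eq cad mc c0 cs q0 l y0) mulrAC mulfV// mul1r.
by rewrite mulr0 add0r mulrC.
Unshelve. all: by end_near. Qed.

Lemma is_derive_flux l x : 0 < x -> is_derive x (1 : R) (flux l)
  ((s == l)%:R - rtr l + \sum_m T m l * (flux m x / c m) - q * (flux l x / c l)).
Proof.
move=> x0.
have D1 : is_derive x (1 : R) (fun x => ((s == l)%:R - rtr l) * x) ((s == l)%:R - rtr l).
  by apply: is_derive_eq (drvZ _ (drv_id x)) _; rewrite mulr1.
have D2 m : is_derive x (1 : R) (fun x => T m l * occ m (ramp x)) (T m l * (flux m x / c m)).
  exact: drvZ (is_derive_occ_ramp m x0).
have D3 : is_derive x (1 : R) (fun x => \sum_m T m l * occ m (ramp x)) (\sum_m T m l * (flux m x / c m)).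
  by apply: drv_sum => m _; exact: D2.
exact: (drvB (drvD D1 D3) (drvZ q (is_derive_occ_ramp l x0))).
Qed.

Lemma ramp_step x h y : 0 < h -> h * (y <= x)%R%:R <= ramp (x + h) y - ramp x y /\
  ramp x y - ramp (x - h) y <= h * (y <= x)%R%:R.
Proof.
move=> h0; case: (ramp_case x y) => -[h1 ->]; case: (ramp_case (x + h) y) => -[h2 ->];
  case: (ramp_case (x - h) y) => -[h3 ->]; have [h4|h4] := leP y x; rewrite ?mulr1 ?mulr0; split; lra.
Qed.

(** The indicator of y <= x lies between the left and right difference quotients of [ramp] in x.
    Both have the same limit after integration, because the derivative exists. *)
Lemma flux_occ l x : 0 < x -> occ l (fun y : R => (y <= x)%R%:R) = flux l x / c l.
Proof.
move=> x0; have dA := is_derive_occ_ramp l x0.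
have lim : h^-1 *: ((fun x => occ l (ramp x)) (h *: (1 : R) + x) - occ l (ramp x)) @[h --> 0^']
   --> flux l x / c l.
  by rewrite -(@derive_val _ _ _ _ _ _ _ dA); exact: (@ex_derive _ _ _ _ _ _ _ dA).
have bl := bounded_test_le x.
set G := occ l _; set D := flux l x / c l in lim *.
have sq h : 0 < h -> h * G <= occ l (ramp (x + h)) - occ l (ramp x) /\
   occ l (ramp x) - occ l (ramp (x - h)) <= h * G.
  move=> h0; have st y := ramp_step x y h0; rewrite /G -(occZ _ _ bl); split.
    rewrite lerBrDl -occD; [|exact: bounded_test_ramp|exact: bounded_testZ].
    apply: occ_le; [|exact: bounded_test_ramp|].
      by apply: bounded_testD; [exact: bounded_test_ramp|exact: bounded_testZ].
    by move=> y _; have [h1 _] := st y; lra.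
  rewrite lerBlDl -occD; [|exact: bounded_test_ramp|exact: bounded_testZ].
  apply: occ_le; [exact: bounded_test_ramp| |].
    by apply: bounded_testD; [exact: bounded_test_ramp|exact: bounded_testZ].
  by move=> y _; have [_ h1] := st y; lra.
apply/eqP; rewrite eq_le; apply/andP; split; apply/ler_addgt0Pr => e e0.
  have [h h0 hD] : exists2 h, 0 < h & `|D - h^-1 * (occ l (ramp (h + x)) - occ l (ramp x))| <= e.
    move/cvgrPdist_le : lim => /(_ e e0) [r /= r0 hr].
    exists (r / 2); first by rewrite divr_gt0.
    have := hr (r / 2); rewrite /GRing.scale/= mulr1; apply.
      by rewrite /ball/= sub0r normrN gtr0_norm ?divr_gt0//; lra.
    by rewrite gt_eqF// divr_gt0.
  have [h1 _] := sq h h0; move: hD; rewrite [h + x]addrC ler_norml => /andP[h2 _].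
  have : G <= h^-1 * (occ l (ramp (x + h)) - occ l (ramp x)) by rewrite ler_pdivlMl.
  lra.
have [h h0 hD] : exists2 h, 0 < h & `|D - (- h)^-1 * (occ l (ramp (- h + x)) - occ l (ramp x))| <= e.
  move/cvgrPdist_le : lim => /(_ e e0) [r /= r0 hr].
  exists (r / 2); first by rewrite divr_gt0.
  have := hr (- (r / 2)); rewrite /GRing.scale/= mulr1; apply.
    by rewrite /ball/= sub0r normrN normrN gtr0_norm ?divr_gt0//; lra.
  by rewrite oppr_eq0 gt_eqF// divr_gt0.
have [_ h1] := sq h h0; move: hD; rewrite [- h + x]addrC invrN mulNr -mulrN opprB ler_norml => /andP[_ h2].
have : h^-1 * (occ l (ramp x) - occ l (ramp (x - h))) <= G by rewrite ler_pdivrMl.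
lra.
Qed.

End FluxEquation.

(** * The undiscounted system satisfied by the closed formula *)

Section LimitSystem.
Variables (R : realType) (S : finType) (T : S -> S -> R) (c : S -> R) (Psi : S -> S -> R).
Hypotheses (c0 : forall j, c j != 0)
  (Psi0 : forall i j, i \in Splus c -> j \in Splus c -> Psi i j = 0)
  (Psiric : forall i j, i \in Splus c -> j \in Sminus c -> riccati T c Psi i j = 0).
Implicit Types (x y : R) (i j l : S).

Let K := Kmat T c Psi.
Local Notation E x := (expm (Splus c) (fun a b => x * K a b)).
Local Notation mu := (@lebesgue_measure R).

Lemma continuous_expm i j : continuous (fun x => E x i j).
Proof.
move=> x; apply: differentiable_continuous; apply/derivable1_diffP.
exact: (@ex_derive _ _ _ _ _ _ _ (is_derive_expm (Splus c) K i j x)).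
Qed.

Lemma integrable_expm i j (b : R) : mu.-integrable `[0, b] (EFin \o (fun x => E x i j)).
Proof.
apply: continuous_compact_integrable; first exact: segment_compact.
by apply: continuous_subspaceT; exact: continuous_expm.
Qed.

Lemma Fint0 i j : Fint c K 0 i j = 0.
Proof. by rewrite /Fint set_itv1 Rintegral_set1. Qed.

Lemma continuous_Fint i j (b : R) : 0 <= b -> {within `[0, b], continuous (fun x => Fint c K x i j)}.
Proof.
by move=> b0; apply: (parameterized_integral_continuous b0); exact: integrable_expm.
Qed.

Lemma is_derive_Fint i j x : 0 < x -> is_derive x (1 : R) (fun x => Fint c K x i j) (E x i j).
Proof.
move=> x0; have xx : x < x + 1 by rewrite ltrDl.
have [dF F'] := continuous_FTC1_closed xx (integrable_expm i j (x + 1)) x0 (@continuous_expm i j x).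
by apply: DeriveDef; [exact: dF|rewrite -derive1E; exact: F'].
Qed.

(** The integrated form exp(Kx) = I + F(K;x) K: the difference of the two sides has zero
    derivative. *)
Lemma expm_Fint i l x : 0 <= x ->
  E x i l = (i == l)%:R + \sum_(k in Splus c) Fint c K x i k * K k l.
Proof.
rewrite le_eqVlt => /predU1P[<-|x0].
  by rewrite expm0 big1 ?addr0// => k _; rewrite Fint0 mul0r.
pose H y := E y i l - \sum_(k in Splus c) K k l * Fint c K y i k.
have dH y : 0 < y -> is_derive y (1 : R) H 0.
  move=> y0.
  have D k : is_derive y (1 : R) (fun y => K k l * Fint c K y i k) (K k l * E y i k).
    by apply: drvZ; exact: is_derive_Fint.
  have Ds : is_derive y (1 : R) (fun y => \sum_(k in Splus c) K k l * Fint c K y i k) (\sum_(k in Splus c) K k l * E y i k).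
    by apply: drv_sum => k _; exact: D.
  apply: is_derive_eq (drvB (is_derive_expm (Splus c) K i l y) Ds) _.
  by rewrite -sumrB big1// => k _; rewrite mulrC subrr.
have cH : {within `[0, x], continuous H}.
  move=> y; apply: cvgB; first by apply: continuous_subspaceT; exact: continuous_expm.
  apply: cvg_big => [v|k _]; first exact: add_continuous.
  by apply: cvgM; [exact: cvg_cst|exact: (continuous_Fint (ltW x0))].
have dH' y : y \in `]0, x[ -> is_derive y (1 : R) H 0.
  by rewrite in_itv => /andP[/dH].
have [z _] := MVT x0 dH' cH.
rewrite mul0r => /eqP; rewrite subr_eq0 => /eqP.
rewrite /H expm0 [X in _ - X = _ -> _]lock [X in _ = _ - X]big1 -?lock ?subr0; last first.
  by move=> k _; rewrite Fint0 mulr0.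
move=> <-; rewrite -addrA -[LHS]addr0; congr (_ + _).
rewrite (eq_bigr (fun k => Fint c K x i k * K k l)) ?addNr// => k _; exact: mulrC.
Qed.

(** The claimed matrix multiplied by C on the right, that is F(K;x) [I, - Psi]; the sign comes from
    c_l < 0 on S_-. *)
Definition limit_flux i l x : R :=
  if 0 < c l then Fint c K x i l else - \sum_(k in Splus c) Fint c K x i k * Psi k l.

Lemma limit_flux0 i l : limit_flux i l 0 = 0.
Proof.
rewrite /limit_flux; case: ifP => _; first exact: Fint0.
by rewrite big1 ?oppr0// => k _; rewrite Fint0 mul0r.
Qed.

Lemma continuous_limit_flux i l (b : R) : 0 <= b -> {within `[0, b], continuous (limit_flux i l)}.
Proof.
move=> b0; case: (boolP (0 < c l)) => [lp|/negbTE lN].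
  rewrite (_ : limit_flux i l = fun x => Fint c K x i l); first exact: continuous_Fint.
  by apply/funext => x; rewrite /limit_flux lp.
rewrite (_ : limit_flux i l = fun x => - \sum_(k in Splus c) Fint c K x i k * Psi k l); last first.
  by apply/funext => x; rewrite /limit_flux lN.
move=> y; apply: cvgN; apply: cvg_big => [v|k _]; first exact: add_continuous.
by apply: cvgM; [exact: (continuous_Fint b0)|exact: cvg_cst].
Qed.

Lemma limit_flux_bounded i (b : R) : 0 <= b -> exists2 B, 0 <= B &
  forall l x, x \in `[0, b] -> `|limit_flux i l x| <= B.
Proof.
move=> b0.
have hb l : exists B, forall x, x \in `[0, b] -> `|limit_flux i l x| <= B.
  have cn : {within `[0, b], continuous (fun x => `|limit_flux i l x|)}.
    by move=> y; apply: cvg_norm; exact: (@continuous_limit_flux i l b b0).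
  by have [x0 _ hx] := EVT_max b0 cn; exists `|limit_flux i l x0|.
have [f hf] := choice hb.
exists (\sum_l `|f l|) => [|l x xb]; first exact: sumr_ge0.
by rewrite (bigD1 l)//= ler_wpDr ?sumr_ge0// (le_trans (hf l x xb))// ler_norm.
Qed.

(** [Kmat] is defined for every column, so K = [C_+^-1, Psi |C_-|^-1] T also for l in S_-. *)
Lemma limit_flux_gen i l x :
  \sum_m T m l * (limit_flux i m x / c m) = \sum_(p in Splus c) Fint c K x i p * K p l.
Proof.
rewrite (sum_Splus_Sminus c0).
have -> : \sum_(m in Sminus c) T m l * (limit_flux i m x / c m) =
   \sum_(p in Splus c) Fint c K x i p * (\sum_(m in Sminus c) Psi p m / `|c m| * T m l).
  under [RHS]eq_bigr do rewrite mulr_sumr.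
  rewrite exchange_big/=; apply: eq_bigr => m; rewrite inE => mm.
  rewrite /limit_flux ltNge (ltW mm)/= (ltr0_norm mm) mulNr invrN.
  rewrite mulrN mulrC mulrAC !mulr_suml -sumrN; apply: eq_bigr => p _.
  by ring.
rewrite -big_split/=; apply: eq_bigr => p; rewrite inE => pp.
by rewrite /limit_flux pp /K /Kmat; ring.
Qed.

(* This is where the Riccati equation enters: [C_+^-1, Psi |C_-|^-1] T = K [I, - Psi]. *)
Lemma Kmat_Psi p l : p \in Splus c -> l \in Sminus c ->
  \sum_(k in Splus c) K p k * Psi k l = - K p l.
Proof.
move=> pp lm; have := Psiric pp lm; rewrite /riccati /K /Kmat => ric.
have cp : `|c p| = c p by move: pp; rewrite inE => /ltW /ger0_norm.
have -> : \sum_(k in Splus c) (T p k / c p + \sum_(k0 in Sminus c) Psi p k0 / `|c k0| * T k0 k) * Psi k l =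
   \sum_(k in Splus c) T p k / `|c p| * Psi k l + \sum_(k in Sminus c) Psi p k / `|c k| * \sum_(m in Splus c) T k m * Psi m l.
  under eq_bigr do rewrite mulrDl.
  rewrite big_split/= cp; congr (_ + _).
  under eq_bigr do rewrite mulr_suml.
  rewrite exchange_big/=; apply: eq_bigr => k _; rewrite mulr_sumr.
  by apply: eq_bigr => m _; rewrite mulrA.
move: ric; under [X in _ + _ + X = _ -> _]eq_bigr do rewrite mulrDr.
rewrite big_split/= cp; lra.
Qed.

(** The derivative is exp(Kx) [I, - Psi]; expanding the exponential by [expm_Fint] leaves F(K;x) K,
    directly for l in S_+ and through [Kmat_Psi] for l in S_-. *)
Lemma is_derive_limit_flux i l x : i \in Splus c -> 0 < x ->
  is_derive x (1 : R) (limit_flux i l)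
    ((i == l)%:R - Psi i l + \sum_m T m l * (limit_flux i m x / c m)).
Proof.
move=> ip x0; rewrite limit_flux_gen.
have [lp|lN] := boolP (0 < c l).
  rewrite /limit_flux lp Psi0// subr0 -expm_Fint ?ltW//; exact: is_derive_Fint.
have lm : l \in Sminus c by rewrite -(negbK (l \in _)) -SplusNminus.
rewrite /limit_flux (negbTE lN).
have Ds : is_derive x (1 : R) (fun x => \sum_(k in Splus c) Fint c K x i k * Psi k l)
   (\sum_(k in Splus c) Psi k l * E x i k).
  apply: drv_sum => k _.
  rewrite (_ : (fun x => _) = fun x => Psi k l * Fint c K x i k); last by apply/funext => y; rewrite mulrC.
  by apply: drvZ; exact: is_derive_Fint.
apply: is_derive_eq (drvN Ds) _.
have il : (i == l) = false by apply/negbTE/eqP => il; move: ip; rewrite il inE (negbTE lN).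
rewrite il sub0r.
have -> : \sum_(k in Splus c) Psi k l * E x i k = Psi i l +
   \sum_(p in Splus c) Fint c K x i p * (\sum_(k in Splus c) K p k * Psi k l).
  under eq_bigr do rewrite expm_Fint ?ltW// mulrDr.
  rewrite big_split/= (bigD1 i)//= eqxx mulr1 big1 ?addr0; last first.
    by move=> k /andP[_ ki]; rewrite eq_sym (negbTE ki) mulr0.
  congr (_ + _); under eq_bigr do rewrite mulr_sumr.
  rewrite exchange_big/=; apply: eq_bigr => p _; rewrite mulr_sumr.
  by apply: eq_bigr => k _; ring.
rewrite opprD -sumrN; congr (_ + _); apply: eq_bigr => p pp.
by rewrite Kmat_Psi// mulrN opprK.
Qed.

End LimitSystem.

(** * Removing the discount *)

Section ZeroDiscount.
Variables (R : realType) (S : finType) (T : S -> S -> R) (c : S -> R).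
Variables (d : measure_display) (Omega : measurableType d) (phi : R -> Omega -> S).
Variable P : S -> probability Omega R.
Hypotheses (Tgen : generator T) (cad : cadlag_step_paths phi)
  (mc : forall s, markov_chain_from T s (P s) phi) (c0 : forall j, c j != 0).
Implicit Types (x y : R) (i j l : S).

Let Psi := Psi_mat c P phi.
(** The sequence [mesh R m] now plays the role of the discount tending to 0. *)
Let rt m i l := return_transform c phi (P i) (mesh R m) l.
Let zr w := (cad w).1.

Lemma return_transform_cvg i l : 0 < c i -> (fun m => rt m i l) @ \oo --> Psi i l.
Proof.
move=> ci.
pose A := [set w | (return_time c phi w < +oo)%E /\ phi (fine (return_time c phi w)) w = l].
have mA : measurable A by exact: (measurable_return_event cad (mc i).1 c0).
have -> : Psi i l = (\int[P i]_w (\1_A w : R))%R by rewrite Rintegral_indic.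
have mF m : measurable_fun setT (fun w => return_weight c (mesh R m) (phi^~ w) l).
  exact: (measurable_return_weight cad (mc i) c0).
have mA1 : measurable_fun setT (\1_A : Omega -> R) by exact: measurable_indic.
have i1 : (P i).-integrable setT (EFin \o (fun _ : Omega => 1 : R)).
  by apply: (@prob_integrable _ _ _ _ _ 1) => // w; rewrite normr1.
have Fb m w : setT w -> `|return_weight c (mesh R m) (phi^~ w) l| <= 1.
  move=> _; have /andP[h0 h1] := return_weight_bound cad c0 (mesh_gt0 R m) w l.
  by rewrite ger0_norm.
have Fc : {ae P i, forall w, setT w -> (fun m => return_weight c (mesh R m) (phi^~ w) l) @ \oo --> (\1_A w : R)}.
  apply: aeW => w _; case: (boolP (rtime c (phi^~ w) < +oo)%E) => tw; last first.
    rewrite indicE memNset; last by move=> [+ _]; rewrite (negbTE tw).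
    by apply: cvg_near_cst; apply: nearW => m; rewrite /return_weight (negbTE tw).
  rewrite (_ : (fun m => _) = fun m => expR (- (mesh R m * fine (rtime c (phi^~ w)))) *
      (phi (fine (rtime c (phi^~ w))) w == l)%:R); last by apply/funext => m; rewrite /return_weight tw.
  have -> : \1_A w = 1 * (phi (fine (rtime c (phi^~ w))) w == l)%:R :> R.
    rewrite mul1r indicE; congr (nat_of_bool _)%:R; apply/idP/eqP; first by rewrite inE => -[].
    by move=> h; rewrite inE.
  apply: cvgM; last exact: cvg_cst.
  rewrite -[X in _ --> X]expR0 -[X in expR X]oppr0 -[X in - X](mul0r (fine (rtime c (phi^~ w)))).
  apply: continuous_cvg; first exact: continuous_expR.
  by apply: cvgN; apply: cvgM; [exact: mesh_cvg0|exact: cvg_cst].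
by have [_] := @Rintegral_dominated_cvg _ _ R (P i) _ _ _ _ measurableT mF mA1 Fc i1 Fb.
Qed.

Lemma Psi_plus i j : i \in Splus c -> j \in Splus c -> Psi i j = 0.
Proof.
rewrite !inE => ci cj.
have := return_transform_cvg (l := j) ci.
rewrite (_ : (fun m => _) = cst 0); last first.
  by apply/funext => m; rewrite /rt (return_transform_plus cad (mc i))// mesh_gt0.
by move/(cvg_unique _ (cvg_cst _)) => /(_ (@Rhausdorff R)).
Qed.

(** Needed because the return transforms are identified with a Riccati solution on S_+ x S_-
    only. *)
Lemma riccati_local (Y Z : S -> S -> R) i j : i \in Splus c -> j \in Sminus c ->
  (forall a b, a \in Splus c -> b \in Sminus c -> Y a b = Z a b) ->
  riccati T c Y i j = riccati T c Z i j.
Proof.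
move=> ip jm YZ; rewrite /riccati; congr (_ + _ + _).
  by apply: eq_bigr => k kp; rewrite YZ.
apply: eq_bigr => k km; rewrite YZ//; congr (_ * (_ + _)).
by apply: eq_bigr => l lp; rewrite YZ.
Qed.

Lemma riccati_cvg (Y : nat -> S -> S -> R) (Z : S -> S -> R) i j :
  i \in Splus c -> j \in Sminus c ->
  (forall a b, a \in Splus c -> b \in Sminus c -> (fun m => Y m a b) @ \oo --> Z a b) ->
  (fun m => riccati T c (Y m) i j) @ \oo --> riccati T c Z i j.
Proof.
move=> ip jm YZ; rewrite /riccati; apply: cvgD.
  apply: cvgD; first exact: cvg_cst.
  apply: cvg_big => [v|k kp]; first exact: add_continuous.
  by apply: cvgM; [exact: cvg_cst|exact: YZ].
apply: cvg_big => [v|k km]; first exact: add_continuous.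
apply: cvgM; first by apply: cvgM; [exact: YZ|exact: cvg_cst].
apply: cvgD; first exact: cvg_cst.
apply: cvg_big => [v|l lp]; first exact: add_continuous.
by apply: cvgM; [exact: cvg_cst|exact: YZ].
Qed.

(** The solutions produced for the successive discounts are not compared with one another: each
    equals the return transform, whose convergence is probabilistic. *)
Lemma Psi_riccati i j : i \in Splus c -> j \in Sminus c -> riccati T c Psi i j = 0.
Proof.
move=> ip jm.
have cvgY a b : a \in Splus c -> b \in Sminus c -> (fun m => rt m a b) @ \oo --> Psi a b.
  by rewrite inE => ca _; exact: return_transform_cvg.
have ric m : riccati T c (rt m) i j = mesh R m * (`|c i|^-1 + `|c j|^-1) * rt m i j.
  have m0 := mesh_gt0 R m.
  have [Y [Y0 Y1 Yric]] := riccati_solution Tgen c0 m0.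
  have rtY a b : a \in Splus c -> b \in Sminus c -> rt m a b = Y a b.
    rewrite inE => ca bm.
    exact: (return_transform_riccati cad (mc a) c0 ca m0 Tgen Y0 Y1 Yric bm).
  by rewrite (riccati_local ip jm rtY) Yric// rtY.
have h1 := riccati_cvg ip jm cvgY.
have h2 : (fun m => riccati T c (rt m) i j) @ \oo --> (0 : R).
  rewrite (_ : (fun m => _) = fun m => mesh R m * (`|c i|^-1 + `|c j|^-1) * rt m i j); last first.
    by apply/funext => m; exact: ric.
  have -> : (0 : R) = 0 * (`|c i|^-1 + `|c j|^-1) * Psi i j by rewrite !mul0r.
  apply: cvgM; last exact: cvgY.
  by apply: cvgM; [exact: mesh_cvg0|exact: cvg_cst].
by apply: (cvg_unique _ h1 h2); exact: Rhausdorff.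
Qed.

(** The two fluxes solve the same linear system up to a defect [D m], made of the error on [Psi] and
    of the discount term, and both vanish at 0. *)
Lemma flux_cvg i l x : 0 < c i -> 0 < x ->
  (fun m => flux T c phi i (P i) (mesh R m) l x) @ \oo --> limit_flux T c Psi i l x.
Proof.
move=> ci x0.
have ip : i \in Splus c by rewrite inE.
have [B B0 hB] := limit_flux_bounded T c Psi i (ltW x0).
pose fl m j y := flux T c phi i (P i) (mesh R m) j y.
pose lf j y := limit_flux T c Psi i j y.
pose w m j y := fl m j y - lf j y.
pose CI := \sum_j `|(c j)^-1|.
have CI0 : 0 <= CI by exact: sumr_ge0.
have leCI j : `|(c j)^-1| <= CI by rewrite /CI (bigD1 j)//= lerDl sumr_ge0.
pose KT := \sum_j \sum_k `|T j k|.
have KT0 : 0 <= KT by rewrite sumr_ge0// => *; rewrite sumr_ge0.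
have leKT j k : `|T j k| <= KT.
  rewrite /KT (bigD1 j)//= (bigD1 k)//= -addrA lerDl addr_ge0// sumr_ge0// => *; exact: sumr_ge0.
(* One term for the coupling through [T], one for the discount, which is at most 1. *)
pose M := KT * CI + CI.
have M0 : 0 <= M by rewrite addr_ge0// mulr_ge0.
pose D m := \sum_j `|Psi i j - rt m i j| + mesh R m * (B * CI).
have D0 m : 0 <= D m by rewrite addr_ge0 ?sumr_ge0// !mulr_ge0// ltW// mesh_gt0.
(* The discounted flux is written w + [lf] in the last term, so that only the limit flux must be
   bounded, uniformly in m. *)
pose dw m j y : R := (Psi i j - rt m i j) + \sum_k T k j * (w m k y / c k) - mesh R m * ((w m j y + lf j y) / c j).
have gw m : (w m l x) ^+ 2 <= #|S|%:R * D m ^+ 2 * x * expR ((1 + 2 * M * #|S|%:R) * x).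
  have m0 := mesh_gt0 R m; have m1 := mesh_le1 R m.
  apply: (@system_gronwall R S (w m) (dw m) x M (D m) (ltW x0) M0 (D0 m)).
  - move=> j; have cf : {within `[0, x], continuous (fl m j)}.
      by apply: continuous_subspaceT; exact: (continuous_flux cad (mc i) c0 m0).
    by move=> y; apply: cvgB; [exact: cf|exact: (@continuous_limit_flux R S T c Psi i j x (ltW x0))].
  - move=> j y; rewrite in_itv/= => /andP[y0 _].
    have d1 := is_derive_flux cad (mc i) c0 ci m0 j y0.
    have d2 := is_derive_limit_flux c0 Psi_plus Psi_riccati j ip y0.
    apply: is_derive_eq (drvB d1 d2) _; rewrite /dw /w -/(rt m i j) -/(lf j y).
    rewrite (_ : \sum_k T k j * ((fl m k y - lf k y) / c k) =
       \sum_k T k j * (fl m k y / c k) - \sum_k T k j * (lf k y / c k)).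
      by rewrite /fl /lf; ring.
    by rewrite -sumrB; apply: eq_bigr => k _; ring.
  - move=> j y yx; have yx' : y \in `[0, x] by apply: subset_itvW yx.
    have lfB := hB j y yx'.
    have wj k : `|w m k y| <= \sum_j `|w m j y| by rewrite (bigD1 k)//= lerDl sumr_ge0.
    rewrite /dw; apply: (le_trans (ler_normB _ _)); apply: (le_trans (lerD (ler_normD _ _) (lexx _))).
    have e1 : `|Psi i j - rt m i j| <= \sum_j `|Psi i j - rt m i j|.
      by rewrite [leRHS](bigD1 j)//= lerDl sumr_ge0.
    have e2 : `|\sum_k T k j * (w m k y / c k)| <= KT * CI * \sum_j `|w m j y|.
      apply: (le_trans (ler_norm_sum _ _ _)); rewrite mulr_sumr; apply: ler_sum => k _.
      rewrite normrM -mulrA ler_pM// normrM mulrC ler_wpM2r//.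
    have e3 : `|mesh R m * ((w m j y + lf j y) / c j)| <= CI * \sum_j `|w m j y| + mesh R m * (B * CI).
      rewrite normrM gtr0_norm// normrM.
      apply: (@le_trans _ _ (mesh R m * ((\sum_j `|w m j y| + B) * CI))).
        rewrite ler_wpM2l ?(ltW m0)// ler_pM// (le_trans (ler_normD _ _))// lerD//.
      have s0 : 0 <= CI * \sum_j `|w m j y| by rewrite mulr_ge0// sumr_ge0.
      nra.
    rewrite /M /D; lra.
  - by move=> j; rewrite /w /fl /lf (flux0 cad (mc i) c0 m0) limit_flux0 subrr.
pose C := #|S|%:R * x * expR ((1 + 2 * M * #|S|%:R) * x).
have Dcvg : D @ \oo --> (0 : R).
  have -> : (0 : R) = \sum_(j : S) 0 + 0 * (B * CI) by rewrite big1// mul0r addr0.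
  apply: cvgD; last by apply: cvgM; [exact: mesh_cvg0|exact: cvg_cst].
  apply: cvg_big => [v|j _]; first exact: add_continuous.
  have -> : (0 : R) = `|Psi i j - Psi i j| by rewrite subrr normr0.
  by apply: cvg_norm; apply: cvgB; [exact: cvg_cst|exact: return_transform_cvg].
have w0 : (fun m => w m l x) @ \oo --> (0 : R).
  have sq0 : (fun m => C * (D m * D m)) @ \oo --> (0 : R).
    rewrite -[X in _ --> X](mulr0 C); apply: cvgM; first exact: cvg_cst.
    by rewrite -[X in _ --> X](mulr0 (0 : R)); apply: cvgM.
  apply/cvgrPdist_le => e e0; near=> m; rewrite sub0r normrN.
  rewrite -ler_sqr ?nnegrE ?(ltW e0)// real_normK ?num_real//.
  apply: (le_trans (gw m)).
  have : `|0 - C * (D m * D m)| <= e ^+ 2.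
    by near: m; move/cvgrPdist_le : sq0; apply; rewrite exprn_gt0.
  rewrite sub0r normrN; apply: le_trans; apply: le_trans (ler_norm _).
  by rewrite le_eqVlt; apply/orP; left; apply/eqP; rewrite /C; ring.
rewrite (_ : (fun m => _) = fun m => w m l x + lf l x); last by apply/funext => m; rewrite subrK.
by rewrite -[X in _ --> X]add0r; apply: cvgD => //; exact: cvg_cst.
Unshelve. all: by end_near. Qed.

End ZeroDiscount.

(** * Mean sojourn times as limits of discounted occupations *)

Section MeanSojourn.
Variables (R : realType) (S : finType) (T : S -> S -> R) (c : S -> R).
Variables (d : measure_display) (Omega : measurableType d) (phi : R -> Omega -> S).
Variable P : S -> probability Omega R.
Hypotheses (Tgen : generator T) (cad : cadlag_step_paths phi)
  (mc : forall s, markov_chain_from T s (P s) phi) (c0 : forall j, c j != 0).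

Let zr w := (cad w).1.
Local Notation pm i := (@lebesgue_measure R \x P i)%E.
Let below_level (x y : R) : R := (y <= x)%R%:R.

(** Before the return time the level vanishes at u = 0 only, so each path spends a null set of times
    there. *)
Lemma Gamma_mat0 i l : Gamma_mat c P phi 0 i l = 0%E.
Proof.
rewrite /Gamma_mat integral0_eq// => w _.
set A := [set u | _]; have A0 : A `<=` [set 0].
  move=> u /= [u0 [ut [lu _]]]; apply/eqP; rewrite eq_le u0 andbT leNgt; apply/negP => up.
  have := (lt_rtimeP (zr w) c0 u0).1 ut u; rewrite up lexx => /(_ isT).
  by move: lu; rewrite -eq_le eq_sym => ->.
by case: (subset_set1 A0) => ->; [exact: measure0|exact: lebesgue_measure_set1].
Qed.

(** Tonelli, at discount 0: the integrand is the indicator of the set of times measured in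
    [Gamma_mat]. *)
Lemma Gamma_mat_occ i l x :
  Gamma_mat c P phi x i l = (\int[pm i]_z (occ_fun c phi 0 l (below_level x) z)%:E)%E.
Proof.
have mb : measurable_fun setT (below_level x) by exact: (bounded_test_le x).1.
have mf := measurable_occ_fun cad (mc i) c0 0 l mb.
have mf' : measurable_fun setT (EFin \o occ_fun c phi 0 l (below_level x)) by exact/measurable_EFinP.
have f0 z : (0 <= (EFin \o occ_fun c phi 0 l (below_level x)) z)%E.
  by rewrite lee_fin /occ_fun mulr_ge0// mulr_ge0// expR_ge0.
apply/esym; apply: (etrans (@fubini_tonelli2 _ _ _ _ R (@lebesgue_measure R) (P i) _ mf' f0)).
apply: eq_integral => w _; rewrite /fubini_G/=.
pose A := [set u : R | (0 <= u)%R /\ (u%:E < return_time c phi w)%E /\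
   (0 <= fluid_level c phi w u <= x)%R /\ phi u w = l].
have AE u : occ_fun c phi 0 l (below_level x) (u, w) = \1_A u.
  rewrite /occ_fun mul0r oppr0 expR0 mul1r /below_level !indicE.
  case: (boolP (u \in A)) => uA.
    move: uA; rewrite inE => -[u0 [ut [/andP[l0 l1] ul]]].
    by rewrite mem_set ?mul1r; [rewrite (_ : (_ <= _)%R = true)|split].
  case: (boolP ((u, w) \in occ_set c phi l)) => [|_]; last by rewrite mul0r.
  rewrite inE => -[/= u0 ut l0 ul]; case: leP => lx; rewrite ?mulr0//.
  by move: uA; rewrite notin_setE => -[]; split => //; split => //; split => //; rewrite l0.
have mA : measurable A.
  have m1 : measurable_fun setT (fun u : R => occ_fun c phi 0 l (below_level x) (u, w)).
    by apply: (measurableT_comp mf); exact: measurable_pair2.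
  rewrite (_ : A = setT `&` (fun u : R => occ_fun c phi 0 l (below_level x) (u, w)) @^-1` [set 1]).
    by apply: m1 => //; exact: measurable_set1.
  apply/seteqP; split => u /=; rewrite AE indicE.
    by move=> uA; split => //; rewrite mem_set.
  by move=> [_]; case: (boolP (u \in A)); rewrite ?inE// => _ /esym/eqP; rewrite oner_eq0.
under eq_integral do rewrite AE.
by rewrite integral_indic// setIT.
Qed.

(** The integrands increase as the discount decreases, so monotone convergence applies in the
    extended reals and finiteness comes out with the value. *)
Lemma Gamma_mat_flux i l x : 0 < c i -> 0 < x ->
  Gamma_mat c P phi x i l = (limit_flux T c (Psi_mat c P phi) i l x / c l)%:E.
Proof.
move=> ci x0.
have bt := bounded_test_le x.
pose g m (z : R * Omega) : \bar R := (occ_fun c phi (mesh R m) l (below_level x) z)%:E.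
have mg m : measurable_fun setT (g m).
  by apply/measurable_EFinP; exact: (measurable_occ_fun cad (mc i) c0 _ l bt.1).
have g0 m z : setT z -> (0 <= g m z)%E.
  by move=> _; rewrite lee_fin /occ_fun mulr_ge0// mulr_ge0// expR_ge0.
have ndg z : setT z -> {homo g ^~ z : a b / (a <= b)%N >-> (a <= b)%E}.
  move=> _ a b ab; rewrite lee_fin /occ_fun indicE.
  case: (boolP (_ \in _)); last by rewrite !mul0r.
  rewrite inE => -[z0 _ _ _]; rewrite !mul1r ler_wpM2r// ler_expR lerN2 ler_wpM2r//.
  by rewrite /mesh lef_pV2 ?posrE// ler_nat ltnS.
have lg z : (g ^~ z) @ \oo --> (occ_fun c phi 0 l (below_level x) z)%:E.
  apply: cvg_EFin; first by apply: nearW => m.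
  rewrite /occ_fun/=; apply: cvgM; first exact: cvg_cst.
  apply: cvgM; last exact: cvg_cst.
  apply: continuous_cvg; first exact: continuous_expR.
  by apply: cvgN; apply: cvgM; [exact: mesh_cvg0|exact: cvg_cst].
have h1 := @cvg_monotone_convergence _ _ R (pm i) _ measurableT g mg g0 ndg.
have h2 : (fun m => \int[pm i]_z g m z)%E @ \oo --> (limit_flux T c (Psi_mat c P phi) i l x / c l)%:E.
  rewrite (_ : (fun m => _) = fun m => (flux T c phi i (P i) (mesh R m) l x / c l)%:E).
    apply: cvg_EFin; first by apply: nearW.
    by apply: cvgM; [exact: flux_cvg|exact: cvg_cst].
  apply/funext => m; rewrite -(flux_occ cad (mc i) c0 ci (mesh_gt0 R m) l x0).
  rewrite /occ /Rintegral fineK//.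
  by apply: integrable_fin_num => //; exact: (occ_integrable cad (mc i) c0 (mesh_gt0 R m) l bt).
rewrite Gamma_mat_occ -(cvg_unique (@ereal_hausdorff R) h1 h2).
by apply: eq_integral => z _; apply/esym/cvg_lim => //; exact: lg.
Qed.

End MeanSojourn.

Theorem theoremA1 (R : realType) (S : finType) (T : S -> S -> R) (c : S -> R)
    (d : measure_display) (Omega : measurableType d)
    (P : S -> probability Omega R) (phi : R -> Omega -> S) :
  irreducible_generator T ->
  (forall s, c s != 0) ->
  cadlag_step_paths phi ->
  (forall s, markov_chain_from T s (P s) phi) ->
  forall x : R, 0 <= x ->
  forall s s' : S, 0 < c s ->
    Gamma_mat c P phi x s s' =
    (Gamma_formula T c (Psi_mat c P phi) x s s')%:E.
Proof.
(* Level x = 0 is treated apart, since the sojourn times were identified by differentiation at x >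
   0. *)
move=> [Tgen _] c0 cad mc x; rewrite le_eqVlt => /predU1P[<-|x0] s s' cs.
  rewrite (Gamma_mat0 P cad c0) /Gamma_formula; case: ifP => _; first by rewrite Fint0 mul0r.
  by rewrite big1 ?mul0r// => k _; rewrite Fint0 mul0r.
rewrite (Gamma_mat_flux Tgen cad mc c0 s' cs x0) /limit_flux /Gamma_formula.
case: ifPn => // cs'; have cN : c s' < 0 by rewrite lt_neqAle c0 leNgt.
by rewrite (ltr0_norm cN) mulNr invrN mulrN.
Qed.
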